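(* Let $\phi,\phi_1\in L^2(\mathbb{R})$ be such that $\{T_k\phi\}_{k\in\mathbb{Z}}$ and $\{T_k\phi_1\}_{k\in\mathbb{Z}}$ are Bessel sequences. Let $\mathcal{W}=\overline{\mathrm{span}}\{T_k\phi\}_{k\in\mathbb{Z}}$ and $\mathcal{V}=\overline{\mathrm{span}}\{T_k\phi_1\}_{k\in\mathbb{Z}}$. Let $\widetilde{\phi}_1\in\mathcal{W}$ and $\widetilde{\phi}\in\mathcal{V}$ be such that $\widehat{\widetilde{\phi}_1}=\overline{\widetilde{H}}\,\widehat{\phi}$ and $\widehat{\widetilde{\phi}}=\widetilde{H}\,\widehat{\phi_1}$, where $\widetilde{H}\in\mathcal{C}^{\infty}_{\mathrm{per}}$. Assume $\epsilon\ge0$. Then $\{T_k\widetilde{\phi}\}_{k\in\mathbb{Z}}$ and $\{T_k\widetilde{\phi}_1\}_{k\in\mathbb{Z}}$ are Bessel sequences and the following are equivalent: (i) $\big\|f-\sum_{k\in\mathbb{Z}}\langle f,T_k\widetilde{\phi}\rangle T_k\phi\big\|\le\epsilon\|f\|$ for $f\in\mathcal{W}$. (ii) $\big|\overline{\widetilde{H}}(\gamma)[\widehat{\phi},\widehat{\phi_1}](\gamma)-1\big|\le\epsilon$ for a.e. $\gamma\in N(\Phi)^{c}$. Moreover, if (ii) holds with $\epsilon<1$ and $N(\Phi_1)=N(\Phi)$, then $\{T_k\phi\}_{k\in\mathbb{Z}}$ and $\{T_kP_{\mathcal{W}}\widetilde{\phi}\}_{k\in\mathbb{Z}}$ are $\epsilon$-approximate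 dual frames in $\mathcal{W}$, whereas $\{T_k\phi_1\}_{k\in\mathbb{Z}}$ and $\{T_kP_{\mathcal{V}}\widetilde{\phi}_1\}_{k\in\mathbb{Z}}$ are $\epsilon$-approximate dual frames in $\mathcal{V}$.
   Context: $T_kf(x)=f(x-k)$ for $k\in\mathbb{Z}$. The Fourier transform is $\widehat{f}(\gamma)=\int_{\mathbb{R}}f(x)e^{-2\pi i x\gamma}\,dx$, extended to a unitary operator of $L^2(\mathbb{R})$. $\mathcal{C}^{p}_{\mathrm{per}}$ is the class of 1-periodic functions on $\mathbb{R}$ whose restriction to $[0,1)$ belongs to $L^p(0,1)$ (so $\mathcal{C}^{\infty}_{\mathrm{per}}$ consists of essentially bounded 1-periodic functions, not smooth ones). For $\phi,\psi\in L^2(\mathbb{R})$, the 1-periodic bracket is $[\widehat{\phi},\widehat{\psi}](\gamma)=\sum_{k\in\mathbb{Z}}\widehat{\phi}(\gamma+k)\overline{\widehat{\psi}(\gamma+k)}$ (a.e. defined, complex valued); $\Phi(\gamma)=\sum_{k\in\mathbb{Z}}|\widehat{\phi}(\gamma+k)|^2$, $\Phi_1(\gamma)=\sum_{k\in\mathbb{Z}}|\widehat{\phi_1}(\gamma+k)|^2$, $N(\Phi)=\{\gamma:\Phi(\gamma)=0\}$, $N(\Phi_1)=\{\gamma:\Phi_1(\gamma)=0\}$; $A^c$ is the complement of $A$ in $\mathbb{R}$. $P_{\mathcal{W}}$ is the orthogonal projection onto $\mathcal{W}$. A family $\{f_k\}\subset\mathcal{W}$ is a Bessel sequence for the closed subspace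 $\mathcal{W}$ if $\sum_k|\langle f,f_k\rangle|^2\le\beta\|f\|^2$ for all $f\in\mathcal{W}$ and some $\beta<\infty$, and a frame for $\mathcal{W}$ if moreover $\alpha\|f\|^2\le\sum_k|\langle f,f_k\rangle|^2$ for all $f\in\mathcal{W}$ and some $\alpha>0$. For a Bessel sequence $\mathcal{F}=\{f_k\}$, $T_{\mathcal{F}}\{c_k\}=\sum_kc_kf_k$ (synthesis operator on $\ell^2$) and $T_{\mathcal{F}}^{*}f=\{\langle f,f_k\rangle\}_k$. Frames $\mathcal{F}$ and $\mathcal{G}$ for $\mathcal{W}$ are $\epsilon$-approximate dual frames in $\mathcal{W}$ if $\|P_{\mathcal{W}}-T_{\mathcal{F}}T_{\mathcal{G}}^{*}\|\le\epsilon$ or, equivalently, $\|P_{\mathcal{W}}-T_{\mathcal{G}}T_{\mathcal{F}}^{*}\|\le\epsilon$. *)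

(* Defs.v *)
From mathcomp Require Import all_boot all_order all_algebra.
From mathcomp Require Import finmap all_classical all_reals all_analysis.
From mathcomp Require Import complex.
From mathcomp Require summability.

Set Implicit Arguments.
Unset Strict Implicit.
Unset Printing Implicit Defensive.

Import Order.TTheory GRing.Theory Num.Theory.
Import numFieldNormedType.Exports.

Local Open Scope classical_set_scope.
Local Open Scope ring_scope.

Notation mu R := (@lebesgue_measure R).
Notation modulus := (@ComplexField.Normc.normc _).

(* Elements of L^p(R) are represented by Borel functions R -> R[i]; equality in
   L^p is equality almost everywhere. *)
Section ComplexFunctions.
Variable R : realType.
Implicit Types (f g : R -> R[i]) (p : \bar R).

Definition cmeasurable f :=
  measurable_fun setT (fun x => complex.Re (f x)) /\
  measurable_fun setT (fun x => complex.Im (f x)).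

Definition Lpnorm p f : \bar R := Lnorm (mu R) p (fun x => (modulus (f x))%:E).

Definition Lp p : set (R -> R[i]) :=
  [set f | cmeasurable f /\ (Lpnorm p f < +oo)%E].

Definition L2 : set (R -> R[i]) := Lp 2%:E.
Definition L2norm f : \bar R := Lpnorm 2%:E f.

Definition cintegral f : R[i] :=
  complex.Complex (\int[mu R]_x complex.Re (f x)) (\int[mu R]_x complex.Im (f x)).

Definition inner f g : R[i] := cintegral (fun x => f x * conjc (g x)).

Definition translate (k : int) f : R -> R[i] := fun x => f (x - k%:~R).
Definition translates f : int -> R -> R[i] := fun k => translate k f.

(* The first two conditions are pointwise; only the size is taken in L^p(0,1). *)
Definition Cper p : set (R -> R[i]) :=
  [set f | [/\ cmeasurable f, forall x, f (x + 1) = f x &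
    (Lnorm (mrestr (mu R) (measurable_itv `[0%R, 1%R[)) p
       (fun x => (modulus (f x))%:E) < +oo)%E]].

Definition cis (t : R) : R[i] := complex.Complex (cos t) (sin t).

Definition fourierL1 f : R -> R[i] :=
  fun xi => cintegral (fun x => f x * cis (- (2 * pi * x * xi))).

(* Extension by density from L^1 /\ L^2, on which the integral formula applies. *)
Definition is_fourier f g :=
  [/\ L2 f, L2 g & exists u : nat -> R -> R[i],
    [/\ forall n, Lp 1%:E (u n) /\ L2 (u n),
        L2norm (u n \- f) @[n --> \oo] --> 0%E &
        L2norm (fourierL1 (u n) \- g) @[n --> \oo] --> 0%E]].

(* A representative of the class, which [is_fourier] determines up to a null
   set. *)
Definition fourier f : R -> R[i] := xget (cst 0) (is_fourier f).

(* Unconditional summation, componentwise; on C it is absolute summation. *)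
Definition Zsum (a : int -> R[i]) : R[i] :=
  complex.Complex (summability.sum (fun k => complex.Re (a k) : R^o))
                  (summability.sum (fun k => complex.Im (a k) : R^o)).

Definition bracket f g : R -> R[i] :=
  fun xi => Zsum (fun k => f (xi + k%:~R) * conjc (g (xi + k%:~R))).

Definition periodization f : R -> \bar R :=
  fun xi => (\esum_(k in [set: int]) (modulus (f (xi + k%:~R)) ^+ 2)%:E)%E.

Definition zeroset (P : R -> \bar R) : set R := [set xi | P xi = 0%E].

End ComplexFunctions.

Arguments L2norm {R} f%_R.

Section Frames.
Variable R : realType.
Implicit Types (f g : R -> R[i]) (F G : int -> R -> R[i]) (W : set (R -> R[i])).

Definition lincomb (A : {fset int}) (c : int -> R[i]) F : R -> R[i] :=
  fun x => \sum_(k <- A) c k * F k x.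

Definition closed_span F : set (R -> R[i]) :=
  [set f | L2 f /\ forall e : R, 0 < e ->
    exists A c, (L2norm (f \- lincomb A c F) < e%:E)%E].

(* Orthogonal projection of f onto a closed subspace W, up to a null set. *)
Definition orth_proj W f : R -> R[i] :=
  xget (cst 0) [set g | W g /\ forall h, W h -> inner (f \- g) h = 0].

Definition analysis F f : int -> R[i] := fun k => inner f (F k).

(* The series converges unconditionally in L^2 when F is a Bessel sequence and
   c is square summable. *)
Definition synthesis F (c : int -> R[i]) : R -> R[i] :=
  xget (cst 0) [set s | L2 s /\
    L2norm (s \- lincomb A c F) @[A --> summability.totally] --> 0%E].

Definition bessel W F :=
  (forall k, W (F k)) /\
  exists beta : R, forall f, W f ->
    (\esum_(k in [set: int]) (modulus (inner f (F k)) ^+ 2)%:E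
       <= beta%:E * L2norm f ^+ 2)%E.

Definition frame W F :=
  bessel W F /\
  exists2 alpha : R, 0 < alpha & forall f, W f ->
    (alpha%:E * L2norm f ^+ 2
       <= \esum_(k in [set: int]) (modulus (inner f (F k)) ^+ 2)%:E)%E.

Definition opnorm (T : (R -> R[i]) -> R -> R[i]) : \bar R :=
  ereal_sup [set L2norm (T f) | f in [set f | L2 f /\ (L2norm f <= 1)%E]].

Definition approx_dual_frames (eps : R) W F G :=
  [/\ frame W F, frame W G &
    (opnorm (fun f => orth_proj W f \- synthesis F (analysis G f))%R <= eps%:E)%E].

End Frames.

(* Main.v *)
(* On the Fourier side T_k is multiplication by e^{-2 pi i k xi}, so that
   f = sum_k c_k T_k phi has transform p phi^ with p a trigonometric polynomial,
   and folding R onto [0, 1[ gives ||f||^2 = int_0^1 |p|^2 Phi.  By Parseval on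
   the circle the operator S f = sum_k <f, T_k phit> T_k phi multiplies p by
   s = conj H [phi^, phi1^], hence ||f - S f||^2 = int_0^1 |p|^2 |1 - s|^2 Phi.
   Comparing both integrals for all p, since the |p|^2 are dense enough to
   localize, (i) on the span says exactly that |1 - s| <= eps a.e. where
   Phi <> 0; boundedness of S carries (i) over to the closure.
   For eps < 1, (1 - eps) ||f||^2 <= |<S f, f>|, and Cauchy-Schwarz bounds
   |<S f, f>|^2 by the product of the two analysis norms squared, so each Bessel
   bound yields the lower frame bound of the other system.  Projecting phit onto
   W does not change the coefficients of f in W, as W is invariant under
   translations.  The claim on V follows by exchanging phi and phi1 and
   conjugating H. *)

From HB Require Import structures.
Require Import Defs.
From mathcomp Require Import all_boot all_order all_algebra.
From mathcomp Require Import finmap all_classical all_reals all_analysis.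
From mathcomp Require Import measurable_realfun complex ring lra.

Set Implicit Arguments.
Unset Strict Implicit.
Unset Printing Implicit Defensive.

Import Order.TTheory GRing.Theory Num.Theory.
Import numFieldNormedType.Exports.

Local Open Scope classical_set_scope.
Local Open Scope ring_scope.

(** The comparison of integrals rests on one criterion, [weight_ge0]: an integrable [w] on [0, 1[
    whose integrals against all |P(e^{-2 pi i x})|^2, P a polynomial, are nonnegative is nonnegative
    almost everywhere. It is applied three times: to a function without Fourier coefficients,
    rotated by 1, -1, i and -i, which gives uniqueness and so Parseval; to beta - Phi, which turns
    the Bessel hypothesis into Phi <= beta; and to (eps^2 - |1 - s|^2) Phi, which gives (ii). The
    bound Phi <= beta in turn carries L2 convergence on the circle to L2 convergence on the line.
    [fourier] is a chosen element of an extension by density, so Plancherel has to be established.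
    For f supported in finitely many unit intervals it comes from the Zak transform: Parseval on the
    circle in x at a fixed frequency, then orthonormality of the characters in the frequency. Fatou
    and completeness extend it to L2. Synthesis, projections and transforms are chosen
    representatives, hence compared up to null sets or through norms and inner products. *)

Notation integrableR := ((@lebesgue_measure _).-integrable setT).

(** * Almost-everywhere reasoning for Lebesgue measure *)

Section AlmostEverywhere.
Variable R : realType.
Implicit Types P Q S : R -> Prop.

Lemma aeS P Q : (forall x, P x -> Q x) ->
  {ae mu R, forall x, P x} -> {ae mu R, forall x, Q x}.
Proof. by move=> PQ; apply: (@filterS _ _ (ae_filter_ringOfSetsType (mu R))). Qed.

Lemma aeS2 P Q S : (forall x, P x -> Q x -> S x) ->
  {ae mu R, forall x, P x} -> {ae mu R, forall x, Q x} ->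
  {ae mu R, forall x, S x}.
Proof. by move=> PQ; apply: (@filterS2 _ _ (ae_filter_ringOfSetsType (mu R))). Qed.

Lemma aeT P : (forall x, P x) -> {ae mu R, forall x, P x}.
Proof. by move=> h; apply: (@filterE _ _ (ae_filter_ringOfSetsType (mu R))). Qed.

End AlmostEverywhere.

(** * Complex-valued functions *)

Section ComplexArithmetic.
Variable R : realType.
Implicit Types z w : R[i].

Lemma ReD z w : complex.Re (z + w) = complex.Re z + complex.Re w.
Proof. by case: z; case: w. Qed.

Lemma ImD z w : complex.Im (z + w) = complex.Im z + complex.Im w.
Proof. by case: z; case: w. Qed.

Lemma ReN z : complex.Re (- z) = - complex.Re z.
Proof. by case: z. Qed.

Lemma ImN z : complex.Im (- z) = - complex.Im z.
Proof. by case: z. Qed.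

Lemma ReM z w : complex.Re (z * w) =
  complex.Re z * complex.Re w - complex.Im z * complex.Im w.
Proof. by case: z; case: w. Qed.

Lemma ImM z w : complex.Im (z * w) =
  complex.Re z * complex.Im w + complex.Im z * complex.Re w.
Proof. by case: z => a b; case: w => c d /=; rewrite addrC. Qed.

Lemma conjcD z w : conjc (z + w) = conjc z + conjc w.
Proof. exact: (rmorphD (@conjc R)). Qed.

Lemma conjcN z : conjc (- z) = - conjc z.
Proof. exact: (rmorphN (@conjc R)). Qed.

Lemma conjcB z w : conjc (z - w) = conjc z - conjc w.
Proof. exact: (rmorphB (@conjc R)). Qed.

Lemma conjcM z w : conjc (z * w) = conjc z * conjc w.
Proof. exact: (rmorphM (@conjc R)). Qed.

Lemma conjc_sum (I : Type) (s : seq I) (F : I -> R[i]) :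
  conjc (\sum_(i <- s) F i) = \sum_(i <- s) conjc (F i).
Proof. exact: (rmorph_sum (@conjc R)). Qed.

Lemma Re_conjc z : complex.Re (conjc z) = complex.Re z.
Proof. by case: z. Qed.

Lemma Im_conjc z : complex.Im (conjc z) = - complex.Im z.
Proof. by case: z. Qed.

Lemma ReIm_sum (I : Type) (s : seq I) (F : I -> R[i]) :
  (complex.Re (\sum_(i <- s) F i) = \sum_(i <- s) complex.Re (F i)) *
  (complex.Im (\sum_(i <- s) F i) = \sum_(i <- s) complex.Im (F i)).
Proof.
elim: s => [|a s [IH1 IH2]]; first by rewrite !big_nil.
by rewrite !big_cons ReD ImD IH1 IH2.
Qed.

Lemma complex_eqP z w : complex.Re z = complex.Re w ->
  complex.Im z = complex.Im w -> z = w.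
Proof. by case: z; case: w => a b c d /= -> ->. Qed.

Lemma modulusE2 z : modulus z ^+ 2 = complex.Re z ^+ 2 + complex.Im z ^+ 2.
Proof. by case: z => a b /=; rewrite sqr_sqrtr// addr_ge0// sqr_ge0. Qed.

Lemma modulus_ge0 z : 0 <= modulus z.
Proof. by case: z => a b /=; exact: sqrtr_ge0. Qed.

Lemma modulusE z : modulus z = Num.sqrt (complex.Re z ^+ 2 + complex.Im z ^+ 2).
Proof. by case: z. Qed.

Lemma modulus_conjc z : modulus (conjc z) = modulus z.
Proof. by case: z => a b /=; rewrite sqrrN. Qed.

Lemma modulusN z : modulus (- z) = modulus z.
Proof. by case: z => a b /=; rewrite !sqrrN. Qed.

Lemma modulusM z w : modulus (z * w) = modulus z * modulus w.
Proof. exact: ComplexField.Normc.normcM. Qed.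

Lemma modulusD z w : modulus (z + w) <= modulus z + modulus w.
Proof. exact: le_normcD. Qed.

Lemma modulusX z n : modulus (z ^+ n) = modulus z ^+ n.
Proof.
elim: n => [|n IH]; last by rewrite !exprS modulusM IH.
by rewrite !expr0 ComplexField.Normc.normc1.
Qed.

Lemma mulc_conjc z : z * conjc z = (modulus z ^+ 2)%:C%C.
Proof.
by apply: complex_eqP; rewrite ?ReM ?ImM ?Re_conjc ?Im_conjc /= ?modulusE2; ring.
Qed.

Lemma abs_Re_modulus z : `|complex.Re z| <= modulus z.
Proof.
by rewrite modulusE -sqrtr_sqr ler_sqrt ?lerDl ?sqr_ge0 // addr_ge0 ?sqr_ge0.
Qed.

Lemma abs_Im_modulus z : `|complex.Im z| <= modulus z.
Proof.
by rewrite modulusE -sqrtr_sqr ler_sqrt ?lerDr ?sqr_ge0 // addr_ge0 ?sqr_ge0.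
Qed.

Lemma modulus_le_ReIm z : modulus z <= `|complex.Re z| + `|complex.Im z|.
Proof.
rewrite -(@ler_pXn2r _ 2) ?nnegrE ?modulus_ge0 ?addr_ge0//.
rewrite modulusE2 sqrrD !real_normK ?num_real// -addrA lerD2l lerDr.
by rewrite mulrn_wge0// mulr_ge0.
Qed.

Lemma modulus2D z w : modulus (z + w) ^+ 2 <= 2 * (modulus z ^+ 2 + modulus w ^+ 2).
Proof.
rewrite !modulusE2 ReD ImD.
move: (complex.Re z) (complex.Re w) (complex.Im z) (complex.Im w) => a b c d.
have := sqr_ge0 (a - b); have := sqr_ge0 (c - d); lra.
Qed.

Lemma modulus0 : modulus (0 : R[i]) = 0.
Proof. exact: ComplexField.Normc.normc0. Qed.

Lemma modulus_real (r : R) : modulus (r%:C%C) = `|r|.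
Proof. by rewrite /= expr0n /= addr0 sqrtr_sqr. Qed.

Lemma modulus_eq0 z : modulus z = 0 -> z = 0.
Proof. exact: ComplexField.Normc.eq0_normc. Qed.

End ComplexArithmetic.

Section ComplexMeasurable.
Variable R : realType.
Implicit Types (f g h : R -> R[i]) (c : R[i]).

Lemma cmeasurableD f g : cmeasurable f -> cmeasurable g -> cmeasurable (f \+ g).
Proof.
move=> [f1 f2] [g1 g2]; split.
  by under eq_fun do rewrite ReD; exact: measurable_funD.
by under eq_fun do rewrite ImD; exact: measurable_funD.
Qed.

Lemma cmeasurableM f g :
  cmeasurable f -> cmeasurable g -> cmeasurable (fun x => f x * g x).
Proof.
move=> [f1 f2] [g1 g2]; split.
  by under eq_fun do rewrite ReM; apply: measurable_funB; exact: measurable_funM.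
by under eq_fun do rewrite ImM; apply: measurable_funD; exact: measurable_funM.
Qed.

Lemma cmeasurable_cst c : cmeasurable (fun _ : R => c).
Proof. by split; exact: measurable_cst. Qed.

Lemma cmeasurableZ c f : cmeasurable f -> cmeasurable (fun x => c * f x).
Proof. by move=> mf; apply: cmeasurableM => //; exact: cmeasurable_cst. Qed.

Lemma cmeasurableN f : cmeasurable f -> cmeasurable (fun x => - f x).
Proof.
by move=> mf; under eq_fun do rewrite -mulN1r; exact: cmeasurableZ.
Qed.

Lemma cmeasurableB f g : cmeasurable f -> cmeasurable g -> cmeasurable (f \- g).
Proof. by move=> mf /cmeasurableN mg; exact: cmeasurableD. Qed.

Lemma cmeasurable_conjc f : cmeasurable f -> cmeasurable (fun x => conjc (f x)).
Proof.
move=> [f1 f2]; split; first by under eq_fun do rewrite Re_conjc.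
by under eq_fun do rewrite Im_conjc; exact: measurable_funN.
Qed.

Lemma cmeasurable_sum (I : Type) (s : seq I) (F : I -> R -> R[i]) :
  (forall i, cmeasurable (F i)) -> cmeasurable (fun x => \sum_(i <- s) F i x).
Proof.
move=> mF; elim: s => [|a s IH].
  by under eq_fun do rewrite big_nil; exact: cmeasurable_cst.
by under eq_fun do rewrite big_cons; exact: cmeasurableD.
Qed.

Lemma measurable_modulus2 f : cmeasurable f ->
  measurable_fun setT (fun x => modulus (f x) ^+ 2).
Proof.
move=> [f1 f2]; under eq_fun do rewrite modulusE2.
by apply: measurable_funD; exact: measurable_funX.
Qed.

Lemma emeasurable_modulus2 f : cmeasurable f ->
  measurable_fun setT (fun x => (modulus (f x) ^+ 2)%:E).
Proof. by move=> /measurable_modulus2 ?; exact/measurable_EFinP. Qed.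

Lemma measurable_modulus f : cmeasurable f ->
  measurable_fun setT (fun x => modulus (f x)).
Proof.
move=> mf; have -> : (fun x => modulus (f x)) = Num.sqrt \o (fun x => modulus (f x) ^+ 2).
  by apply/funext => x /=; rewrite sqrtr_sqr ger0_norm// modulus_ge0.
apply: measurableT_comp; last exact: measurable_modulus2.
by apply: continuous_measurable_fun; exact: sqrt_continuous.
Qed.

Lemma cmeasurable_real (u : R -> R) : measurable_fun setT u ->
  cmeasurable (fun x => (u x)%:C%C).
Proof. by move=> mu_; split => //=; exact: measurable_cst. Qed.

Lemma cmeasurable_comp f (u : R -> R) : measurable_fun setT u ->
  cmeasurable f -> cmeasurable (f \o u).
Proof. by move=> mu_ [f1 f2]; split; [exact: (measurableT_comp f1 mu_)|exact: (measurableT_comp f2 mu_)]. Qed.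

End ComplexMeasurable.

Section ComplexIntegral.
Variable R : realType.
Implicit Types (f g h : R -> R[i]) (c : R[i]).

Definition cintegrable f :=
  integrableR (fun x => (complex.Re (f x))%:E) /\
  integrableR (fun x => (complex.Im (f x))%:E).

Lemma integrableR_EFin (u : R -> R) : integrableR (fun x => (u x)%:E) ->
  measurable_fun setT u.
Proof. by move=> /measurable_int/measurable_EFinP. Qed.

Lemma cintegrable_measurable f : cintegrable f -> cmeasurable f.
Proof. by move=> [/integrableR_EFin ? /integrableR_EFin ?]. Qed.

Lemma integrableR_le (u v : R -> R) : measurable_fun setT u ->
  (forall x, `|u x| <= v x) -> integrableR (fun x => (v x)%:E) ->
  integrableR (fun x => (u x)%:E).
Proof.
move=> mu_ uv iv; apply: le_integrable iv => //; first exact/measurable_EFinP.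
by move=> x _; rewrite !abse_EFin lee_fin (le_trans (uv x)) ?ler_norm.
Qed.

Lemma integrableRD (u v : R -> R) : integrableR (fun x => (u x)%:E) ->
  integrableR (fun x => (v x)%:E) -> integrableR (fun x => (u x + v x)%:E).
Proof. by move=> iu iv; under eq_fun do rewrite EFinD; exact: integrableD. Qed.

Lemma integrableRZ (k : R) (u : R -> R) : integrableR (fun x => (u x)%:E) ->
  integrableR (fun x => (k * u x)%:E).
Proof. by move=> iu; under eq_fun do rewrite EFinM; exact: integrableZl. Qed.

Lemma integrableRB (u v : R -> R) : integrableR (fun x => (u x)%:E) ->
  integrableR (fun x => (v x)%:E) -> integrableR (fun x => (u x - v x)%:E).
Proof. by move=> iu iv; under eq_fun do rewrite EFinB; exact: integrableB. Qed.

Lemma cintegrable_le f (v : R -> R) : cmeasurable f ->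
  (forall x, modulus (f x) <= v x) -> integrableR (fun x => (v x)%:E) ->
  cintegrable f.
Proof.
move=> [f1 f2] fv iv; split; apply: integrableR_le iv => // x.
  exact: le_trans (abs_Re_modulus _) (fv x).
exact: le_trans (abs_Im_modulus _) (fv x).
Qed.

Lemma cintegrable_modulus f : cintegrable f ->
  integrableR (fun x => (modulus (f x))%:E).
Proof.
move=> if_; have [i1 i2] := if_.
apply: (@integrableR_le _ (fun x => `|complex.Re (f x)| + `|complex.Im (f x)|)).
- by apply: measurable_modulus; exact: cintegrable_measurable.
- by move=> x; rewrite ger0_norm ?modulus_ge0 ?modulus_le_ReIm.
- by apply: integrableRD; exact: integrable_norm.
Qed.

Lemma cintegrableD f g : cintegrable f -> cintegrable g -> cintegrable (f \+ g).
Proof.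
move=> [f1 f2] [g1 g2]; split.
  by under eq_fun do rewrite ReD; exact: integrableRD.
by under eq_fun do rewrite ImD; exact: integrableRD.
Qed.

Lemma cintegrableZ c f : cintegrable f -> cintegrable (fun x => c * f x).
Proof.
move=> [f1 f2]; split.
  by under eq_fun do rewrite ReM; apply: integrableRB; exact: integrableRZ.
by under eq_fun do rewrite ImM; apply: integrableRD; exact: integrableRZ.
Qed.

Lemma cintegralD f g : cintegrable f -> cintegrable g ->
  cintegral (f \+ g) = cintegral f + cintegral g.
Proof.
move=> [f1 f2] [g1 g2]; apply: complex_eqP; rewrite ?ReD ?ImD /=.
  by under eq_Rintegral do rewrite ReD; exact: RintegralD.
by under eq_Rintegral do rewrite ImD; exact: RintegralD.
Qed.

Lemma cintegralZ c f : cintegrable f ->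
  cintegral (fun x => c * f x) = c * cintegral f.
Proof.
move=> [f1 f2]; apply: complex_eqP; rewrite ?ReM ?ImM /=.
  under eq_Rintegral do rewrite ReM.
  by rewrite RintegralB// ?RintegralZl//; exact: integrableRZ.
under eq_Rintegral do rewrite ImM.
by rewrite RintegralD// ?RintegralZl//; exact: integrableRZ.
Qed.

Lemma cintegral0 : cintegral (fun _ : R => 0) = 0.
Proof.
by apply: complex_eqP => /=; rewrite /Rintegral integral0.
Qed.

Lemma cintegrable0 : cintegrable (fun _ : R => 0).
Proof. by split; exact: integrable0. Qed.

Lemma cintegral_conjc f : cintegrable f ->
  cintegral (fun x => conjc (f x)) = conjc (cintegral f).
Proof.
move=> [f1 f2]; apply: complex_eqP; rewrite ?Re_conjc ?Im_conjc /=.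
  by under eq_Rintegral do rewrite Re_conjc.
under eq_Rintegral do rewrite Im_conjc -mulN1r.
by rewrite RintegralZl// mulN1r.
Qed.

Lemma cintegral_sum (I : Type) (s : seq I) (F : I -> R -> R[i]) :
  (forall i, cintegrable (F i)) ->
  cintegrable (fun x => \sum_(i <- s) F i x) /\
  cintegral (fun x => \sum_(i <- s) F i x) = \sum_(i <- s) cintegral (F i).
Proof.
move=> iF; elim: s => [|a s [IH1 IH2]].
  by rewrite big_nil; under eq_fun do rewrite big_nil;
    rewrite cintegral0; split => //; exact: cintegrable0.
rewrite big_cons; under eq_fun do rewrite big_cons.
by rewrite (cintegralD (iF a) IH1) IH2; split => //; exact: cintegrableD.
Qed.

Lemma ae_eq_Rintegral (u v : R -> R) : measurable_fun setT u ->
  measurable_fun setT v -> {ae mu R, forall x, u x = v x} ->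
  \int[mu R]_x u x = \int[mu R]_x v x.
Proof.
move=> mu_ mv uv; rewrite /Rintegral; congr fine.
apply: ae_eq_integral => //; try exact/measurable_EFinP.
by apply: aeS uv => x /= -> .
Qed.

Lemma ae_eq_cintegral f g : cmeasurable f -> cmeasurable g ->
  {ae mu R, forall x, f x = g x} -> cintegral f = cintegral g.
Proof.
move=> [f1 f2] [g1 g2] fg; apply: complex_eqP => /=;
  by apply: ae_eq_Rintegral => //; apply: aeS fg => x /= ->.
Qed.

End ComplexIntegral.

Lemma sqr_le_le (R : realType) (x y : R) : 0 <= y -> x ^+ 2 <= y ^+ 2 -> x <= y.
Proof.
move=> y0; apply: contraTT; rewrite -!ltNge => yx.
by rewrite ltr_pXn2r// nnegrE; exact: le_trans (ltW yx).
Qed.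

(** * The Hilbert space L2 *)

Section SquareIntegrable.
Variable R : realType.
Implicit Types (f g h : R -> R[i]) (c : R[i]).

Lemma L2norm_integral f : L2norm f =
  ((\int[mu R]_x (modulus (f x) ^+ 2)%:E) `^ 2^-1)%E.
Proof.
rewrite /L2norm /Lpnorm unlock; congr (_ `^ _)%E; apply: eq_integral => x _.
by rewrite abse_EFin ger0_norm ?modulus_ge0// poweR_EFin powR_mulrn ?modulus_ge0.
Qed.

Lemma integral_modulus2_ge0 f :
  (0 <= \int[mu R]_x (modulus (f x) ^+ 2)%:E)%E.
Proof. by apply: integral_ge0 => x _; rewrite lee_fin sqr_ge0. Qed.

Lemma L2P f : L2 f <-> cmeasurable f /\
  integrableR (fun x => (modulus (f x) ^+ 2)%:E).
Proof.
rewrite /L2 /Lp /=; split => -[mf h]; split => //.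
  apply/integrableP; split; first exact: emeasurable_modulus2.
  under eq_integral do rewrite abse_EFin ger0_norm ?sqr_ge0//.
  move: h; rewrite -/(L2norm f) L2norm_integral; have := integral_modulus2_ge0 f.
  by case: (integral _ _ _) => [r _ _|_|//]; rewrite ?ltry// poweRyr ?invr_eq0 ?pnatr_eq0.
rewrite -/(L2norm f) L2norm_integral.
move: (integrable_fin_num measurableT h).
by case: (integral _ _ _) => // r _; rewrite poweR_EFin ltry.
Qed.

Lemma L2_measurable f : L2 f -> cmeasurable f. Proof. by case. Qed.

Lemma L2_integrable f : L2 f -> integrableR (fun x => (modulus (f x) ^+ 2)%:E).
Proof. by move=> /L2P[]. Qed.

Lemma L2_le f (v : R -> R) : cmeasurable f ->
  (forall x, modulus (f x) ^+ 2 <= v x) -> integrableR (fun x => (v x)%:E) -> L2 f.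
Proof.
move=> mf fv iv; apply/L2P; split => //.
apply: integrableR_le iv; first exact: measurable_modulus2.
by move=> x; rewrite ger0_norm ?sqr_ge0.
Qed.

Lemma L2D f g : L2 f -> L2 g -> L2 (f \+ g).
Proof.
move=> /L2P[mf if_] /L2P[mg ig].
apply: (@L2_le _ (fun x => 2 * (modulus (f x) ^+ 2 + modulus (g x) ^+ 2))).
- exact: cmeasurableD.
- by move=> x; exact: modulus2D.
- by apply: integrableRZ; exact: integrableRD.
Qed.

Lemma L2Z c f : L2 f -> L2 (fun x => c * f x).
Proof.
move=> /L2P[mf if_].
apply: (@L2_le _ (fun x => modulus c ^+ 2 * modulus (f x) ^+ 2)).
- exact: cmeasurableZ.
- by move=> x; rewrite modulusM exprMn.
- exact: integrableRZ.
Qed.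

Lemma L2N f : L2 f -> L2 (fun x => - f x).
Proof. by move=> lf; under eq_fun do rewrite -mulN1r; exact: L2Z. Qed.

Lemma L2B f g : L2 f -> L2 g -> L2 (f \- g).
Proof. by move=> lf /L2N lg; exact: L2D. Qed.

Lemma L2_0 : L2 (fun _ : R => 0).
Proof.
apply: (@L2_le _ (fun=> 0)); first exact: cmeasurable_cst.
  by move=> x; rewrite modulus0 expr0n.
exact: integrable0.
Qed.

Lemma L2_lincomb (A : {fset int}) (c : int -> R[i]) (F : int -> R -> R[i]) :
  (forall k, L2 (F k)) -> L2 (lincomb A c F).
Proof.
move=> lF; rewrite /lincomb; elim: (enum_fset A) => [|a s IH].
  by under eq_fun do rewrite big_nil; exact: L2_0.
by under eq_fun do rewrite big_cons; apply: L2D => //; exact: L2Z.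
Qed.

Lemma L2M_cintegrable f g : L2 f -> L2 g ->
  cintegrable (fun x => f x * conjc (g x)).
Proof.
move=> /L2P[mf if_] /L2P[mg ig].
apply: (@cintegrable_le _ _ (fun x => modulus (f x) ^+ 2 + modulus (g x) ^+ 2)).
- by apply: cmeasurableM => //; exact: cmeasurable_conjc.
- move=> x; rewrite modulusM modulus_conjc.
  have := sqr_ge0 (modulus (f x) - modulus (g x)).
  have := mulr_ge0 (modulus_ge0 (f x)) (modulus_ge0 (g x)); nra.
- exact: integrableRD.
Qed.

Fact nrm_key : unit. Proof. by []. Qed.
(* Locked, as [rewrite sqr_sqrtr] would otherwise see through it. *)
Definition nrm f : R :=
  locked_with nrm_key (Num.sqrt (\int[mu R]_x (modulus (f x) ^+ 2))).

Lemma nrmE f : nrm f = Num.sqrt (\int[mu R]_x (modulus (f x) ^+ 2)).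
Proof. by rewrite /nrm unlock. Qed.

Lemma nrm_ge0 f : 0 <= nrm f. Proof. by rewrite nrmE sqrtr_ge0. Qed.

Lemma nrm_sqr f : nrm f ^+ 2 = \int[mu R]_x (modulus (f x) ^+ 2).
Proof. by rewrite nrmE sqr_sqrtr// Rintegral_ge0// => x _; rewrite sqr_ge0. Qed.

Lemma nrm_sqrE f : L2 f ->
  (nrm f ^+ 2)%:E = (\int[mu R]_x (modulus (f x) ^+ 2)%:E)%E.
Proof.
by move=> /L2_integrable if_; rewrite nrm_sqr /Rintegral fineK// integrable_fin_num.
Qed.

Lemma L2normE f : L2 f -> L2norm f = (nrm f)%:E.
Proof.
move=> lf; rewrite L2norm_integral -nrm_sqrE// poweR_EFin powR12_sqrt ?sqr_ge0//.
by rewrite sqrtr_sqr ger0_norm ?nrm_ge0.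
Qed.

Lemma innerDl f g h : L2 f -> L2 g -> L2 h ->
  inner (f \+ g) h = inner f h + inner g h.
Proof.
move=> lf lg lh; rewrite /inner -cintegralD//; try exact: L2M_cintegrable.
by congr cintegral; apply/funext => x /=; rewrite mulrDl.
Qed.

Lemma innerZl c f h : L2 f -> L2 h -> inner (fun x => c * f x) h = c * inner f h.
Proof.
move=> lf lh; rewrite /inner -cintegralZ; last exact: L2M_cintegrable.
by congr cintegral; apply/funext => x /=; rewrite mulrA.
Qed.

Lemma innerC f g : L2 f -> L2 g -> inner g f = conjc (inner f g).
Proof.
move=> lf lg; rewrite /inner -cintegral_conjc; last exact: L2M_cintegrable.
by congr cintegral; apply/funext => x /=; rewrite conjcM conjcK mulrC.
Qed.

Lemma innerDr f g h : L2 f -> L2 g -> L2 h ->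
  inner h (f \+ g) = inner h f + inner h g.
Proof.
move=> lf lg lh.
rewrite (innerC (L2D lf lg) lh) innerDl// conjcD -!innerC//.
Qed.

Lemma innerZr c f h : L2 f -> L2 h ->
  inner h (fun x => c * f x) = conjc c * inner h f.
Proof.
move=> lf lh; rewrite (innerC (L2Z c lf) lh) innerZl// conjcM -innerC//.
Qed.

Lemma innerNl f h : L2 f -> L2 h -> inner (fun x => - f x) h = - inner f h.
Proof.
by move=> lf lh; under eq_fun do rewrite -mulN1r; rewrite innerZl// mulN1r.
Qed.

Lemma innerBl f g h : L2 f -> L2 g -> L2 h ->
  inner (f \- g) h = inner f h - inner g h.
Proof. by move=> lf lg lh; rewrite innerDl ?innerNl//; exact: L2N. Qed.

Lemma innerBr f g h : L2 f -> L2 g -> L2 h ->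
  inner h (f \- g) = inner h f - inner h g.
Proof.
move=> lf lg lh.
rewrite (innerC (L2B lf lg) lh) innerBl// conjcB -!innerC//.
Qed.

Lemma inner_self f : L2 f -> inner f f = (nrm f ^+ 2)%:C%C.
Proof.
move=> lf; rewrite nrm_sqr /inner; under eq_fun do rewrite mulc_conjc.
by apply: complex_eqP => //=; rewrite /Rintegral integral0.
Qed.

Lemma inner_lincombl (A : {fset int}) (c : int -> R[i]) (F : int -> R -> R[i]) g :
  (forall k, L2 (F k)) -> L2 g ->
  inner (lincomb A c F) g = \sum_(k <- A) c k * inner (F k) g.
Proof.
move=> lF lg; rewrite /inner /lincomb.
under eq_fun do rewrite mulr_suml.
have [|_ ->] := @cintegral_sum _ _ (enum_fset A)
  (fun k x => c k * F k x * conjc (g x)).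
  by move=> k; apply: (L2M_cintegrable (L2Z (c k) (lF k)) lg).
by apply: eq_bigr => k _; rewrite -(innerZl _ (lF k) lg).
Qed.

Lemma inner_lincombr (A : {fset int}) (c : int -> R[i]) (F : int -> R -> R[i]) g :
  (forall k, L2 (F k)) -> L2 g ->
  inner g (lincomb A c F) = \sum_(k <- A) conjc (c k) * inner g (F k).
Proof.
move=> lF lg; rewrite (innerC (L2_lincomb A c lF) lg) inner_lincombl// conjc_sum.
by apply: eq_bigr => k _; rewrite conjcM -innerC.
Qed.

Lemma nrm_sqrD f g : L2 f -> L2 g ->
  nrm (f \+ g) ^+ 2 = nrm f ^+ 2 + nrm g ^+ 2 + 2 * complex.Re (inner f g).
Proof.
move=> lf lg; have lfg := L2D lf lg.
have := inner_self lfg; rewrite innerDl// !innerDr// !inner_self// (innerC lf lg).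
move=> /(congr1 (@complex.Re R)); rewrite !ReD Re_conjc /= => <-; ring.
Qed.

Lemma nrmZ c f : L2 f -> nrm (fun x => c * f x) = modulus c * nrm f.
Proof.
move=> lf; apply/eqP; rewrite -(@eqrXn2 _ 2) ?nrm_ge0//; last first.
  by rewrite mulr_ge0 ?nrm_ge0 ?modulus_ge0.
apply/eqP; have := inner_self (L2Z c lf); rewrite innerZl ?innerZr//; last exact: L2Z.
rewrite mulrA mulc_conjc inner_self// => /(congr1 (@complex.Re R)) /=.
by rewrite mulr0 subr0 exprMn => ->.
Qed.

Lemma nrmN f : L2 f -> nrm (fun x => - f x) = nrm f.
Proof. by move=> lf; rewrite !nrmE; under eq_Rintegral do rewrite modulusN. Qed.

Lemma nrm0 : nrm (fun _ : R => 0) = 0.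
Proof.
rewrite nrmE; under eq_Rintegral do rewrite modulus0 expr0n /=.
by rewrite /Rintegral integral0 sqrtr0.
Qed.

(** With [a] the inner product, [||f - t a g||^2 >= 0] is a real quadratic inequality in [t],
    evaluated at [t = 1 / ||g||^2]. *)
Lemma cauchy_schwarz f g : L2 f -> L2 g -> modulus (inner f g) <= nrm f * nrm g.
Proof.
move=> lf lg; set a := inner f g.
have H t : 0 <= nrm f ^+ 2 - 2 * t * modulus a ^+ 2 +
    t ^+ 2 * modulus a ^+ 2 * nrm g ^+ 2.
  have := sqr_ge0 (nrm (f \+ (fun x => (- t%:C%C * a) * g x))).
  rewrite nrm_sqrD//; last exact: L2Z.
  rewrite nrmZ// innerZr// -/a modulusM modulusN modulus_real !exprMn real_normK ?num_real//.
  rewrite (_ : conjc _ * a = - (t * modulus a ^+ 2)%:C%C); last first.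
    by rewrite conjcM conjcN conjc_real [LHS]mulrAC -[LHS]mulrA mulc_conjc mulNr -rmorphM.
  by rewrite ReN /= => h; apply: le_trans h _; rewrite le_eqVlt; apply/orP; left; apply/eqP; ring.
have [a0|a0] := eqVneq (modulus a) 0; first by rewrite a0 mulr_ge0 ?nrm_ge0.
rewrite -(@ler_pXn2r _ 2) ?nnegrE ?modulus_ge0 ?mulr_ge0 ?nrm_ge0// exprMn.
have [g0|g0] := eqVneq (nrm g ^+ 2) 0.
  (* If [g] has norm zero the quadratic is affine in [t]; this [t] would give it the value
     [- ||f||^2 - 2]. *)
  have := H ((nrm f ^+ 2 + 1) / modulus a ^+ 2).
  rewrite g0 mulr0 addr0 -mulrA mulfVK ?expf_neq0//.
  have := sqr_ge0 (nrm f); lra.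
have := H ((nrm g ^+ 2)^-1).
have g1 : 0 < nrm g ^+ 2 by rewrite lt_neqAle eq_sym g0 sqr_ge0.
move=> h; rewrite -subr_ge0; move: h.
move: (nrm g ^+ 2) (modulus a ^+ 2) (nrm f ^+ 2) g0 g1 => G A F g0 g1 h.
have -> : F * G - A = (F - 2 * G^-1 * A + G^-1 ^+ 2 * A * G) * G by field.
by apply: mulr_ge0 => //; exact: ltW.
Qed.

Lemma nrmD f g : L2 f -> L2 g -> nrm (f \+ g) <= nrm f + nrm g.
Proof.
move=> lf lg; rewrite -(@ler_pXn2r _ 2) ?nnegrE ?nrm_ge0 ?addr_ge0 ?nrm_ge0//.
rewrite nrm_sqrD// sqrrD -addrA (addrC (nrm g ^+ 2)) addrA lerD2r lerD2l.
rewrite mulr_natl ler_wMn2r//.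
exact: le_trans (ler_norm _) (le_trans (abs_Re_modulus _) (cauchy_schwarz lf lg)).
Qed.

Lemma nrmBC f g : nrm (f \- g) = nrm (g \- f).
Proof.
by rewrite !nrmE; under eq_Rintegral do rewrite -modulusN opprB.
Qed.

Lemma nrmB f g : L2 f -> L2 g -> nrm (f \- g) <= nrm f + nrm g.
Proof. by move=> lf lg; rewrite -(nrmN lg); apply: nrmD => //; exact: L2N. Qed.

Lemma nrm_triangle f g h : L2 f -> L2 g -> L2 h ->
  nrm (f \- h) <= nrm (f \- g) + nrm (g \- h).
Proof.
move=> lf lg lh; rewrite (_ : f \- h = (f \- g) \+ (g \- h)).
  by apply: nrmD; exact: L2B.
by apply/funext => x /=; ring.
Qed.

Lemma nrm_le_sub f g : L2 f -> L2 g -> nrm f <= nrm g + nrm (f \- g).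
Proof.
move=> lf lg; rewrite [in leLHS](_ : f = g \+ (f \- g)).
  by apply: nrmD => //; exact: L2B.
by apply/funext => x /=; ring.
Qed.

Lemma parallelogram f g : L2 f -> L2 g ->
  nrm (f \+ g) ^+ 2 + nrm (f \- g) ^+ 2 = 2 * (nrm f ^+ 2 + nrm g ^+ 2).
Proof.
move=> lf lg; rewrite nrm_sqrD// (nrm_sqrD lf (L2N lg)) nrmN//.
rewrite (innerC (L2N lg) lf) innerNl// conjcN -innerC// ReN; ring.
Qed.

Lemma ae_L2 f g : cmeasurable g -> {ae mu R, forall x, f x = g x} -> L2 f -> L2 g.
Proof.
move=> mg fg /L2P[mf if_]; apply/L2P; split => //.
apply/integrableP; split; first exact: emeasurable_modulus2.
move/integrableP : if_ => [_]; apply: le_lt_trans.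
apply: ae_ge0_le_integral => //.
- by apply: measurableT_comp => //; exact: emeasurable_modulus2.
- by apply: measurableT_comp => //; exact: emeasurable_modulus2.
- by apply: aeS fg => x ->.
Qed.

Lemma ae_nrm f g : cmeasurable f -> cmeasurable g ->
  {ae mu R, forall x, f x = g x} -> nrm f = nrm g.
Proof.
move=> mf mg fg; rewrite !nrmE; congr Num.sqrt.
by apply: ae_eq_Rintegral; [exact: measurable_modulus2..|apply: aeS fg => x ->].
Qed.

Lemma ae_inner f f' g g' : cmeasurable f -> cmeasurable f' ->
  cmeasurable g -> cmeasurable g' ->
  {ae mu R, forall x, f x = f' x} -> {ae mu R, forall x, g x = g' x} ->
  inner f g = inner f' g'.
Proof.
move=> mf mf' mg mg' ff gg; apply: ae_eq_cintegral.
- by apply: cmeasurableM => //; exact: cmeasurable_conjc.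
- by apply: cmeasurableM => //; exact: cmeasurable_conjc.
- by apply: aeS2 ff gg => x -> ->.
Qed.

Lemma nrm_eq0_ae f : L2 f -> nrm f = 0 -> {ae mu R, forall x, f x = 0}.
Proof.
move=> lf f0; have := nrm_sqrE lf; rewrite f0 expr0n /= => /esym h.
have mf2 : measurable_fun setT (fun x => (modulus (f x) ^+ 2)%:E).
  apply: emeasurable_modulus2; exact: L2_measurable.
have H : (\int[mu R]_x `|(modulus (f x) ^+ 2)%:E|)%E = 0%E.
  by apply: etrans h; apply: eq_integral => x _; rewrite abse_EFin ger0_norm ?sqr_ge0.
have := (ae_eq_integral_abs (mu R) measurableT mf2).1 H.
apply: aeS => x /= /(_ I) [] /eqP; rewrite sqrf_eq0 => /eqP; exact: modulus_eq0.
Qed.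

Lemma L2_le_nrm f g (C : R) : 0 <= C -> L2 f -> cmeasurable g ->
  {ae mu R, forall x, modulus (g x) <= C * modulus (f x)} ->
  L2 g /\ nrm g <= C * nrm f.
Proof.
move=> C0 lf mg gf; have [mf if_] := (L2P f).1 lf.
have h : (\int[mu R]_x (modulus (g x) ^+ 2)%:E <=
    (C ^+ 2)%:E * \int[mu R]_x (modulus (f x) ^+ 2)%:E)%E.
  rewrite -ge0_integralZl//; last 3 first.
    exact: emeasurable_modulus2.
    by move=> x _; rewrite lee_fin sqr_ge0.
    by rewrite lee_fin sqr_ge0.
  apply: ae_ge0_le_integral => //.
  - by move=> x _; rewrite lee_fin sqr_ge0.
  - exact: emeasurable_modulus2.
  - by move=> x _; rewrite -EFinM lee_fin mulr_ge0 ?sqr_ge0.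
  - apply/measurable_EFinP; apply: measurable_funM => //; exact: measurable_modulus2.
  - apply: aeS gf => x gf _; rewrite -EFinM lee_fin -exprMn.
    by rewrite ler_pXn2r ?nnegrE ?mulr_ge0 ?modulus_ge0.
have lg : L2 g.
  apply/L2P; split => //; apply/integrableP; split.
    exact: emeasurable_modulus2.
  under eq_integral do rewrite abse_EFin ger0_norm ?sqr_ge0//.
  by apply: le_lt_trans h _; rewrite -nrm_sqrE// -EFinM ltry.
split => //; rewrite -(@ler_pXn2r _ 2) ?nnegrE ?mulr_ge0 ?nrm_ge0// exprMn.
by move: h; rewrite -!nrm_sqrE// -EFinM lee_fin.
Qed.

Lemma lincombB (A : {fset int}) (c d : int -> R[i]) (F : int -> R -> R[i]) :
  lincomb A c F \- lincomb A d F = lincomb A (fun k => c k - d k) F.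
Proof.
apply/funext => x; rewrite /lincomb /= -sumrB.
by apply: eq_bigr => k _; rewrite mulrBl.
Qed.

End SquareIntegrable.

(** * Fatou's lemma and completeness of L2 (Riesz-Fischer) *)

Section Completeness.
Variable R : realType.
Implicit Types (f g h : R -> R[i]) (c : R[i]).

Lemma measurable_nneseries (u : nat -> R -> \bar R) :
  (forall n, measurable_fun setT (u n)) -> (forall n x, 0 <= u n x)%E ->
  measurable_fun setT (fun x => \sum_(0 <= k <oo) u k x)%E.
Proof.
move=> mu_ u0; apply: (emeasurable_fun_cvg (fun n x => \sum_(0 <= k < n) u k x)%E).
  by move=> n; exact: emeasurable_sum.
by move=> x _; apply: is_cvg_nneseries.
Qed.

Lemma fatou_le (u : nat -> R -> R) (v : R -> R) (M : \bar R) :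
  (forall n, measurable_fun setT (u n)) -> (forall n x, 0 <= u n x) ->
  (forall x, u n x @[n --> \oo] --> v x) ->
  (forall n, (\int[mu R]_x (u n x)%:E <= M)%E) ->
  measurable_fun setT v /\ (\int[mu R]_x (v x)%:E <= M)%E.
Proof.
move=> mu_ u0 uv uM; split; first exact: measurable_fun_cvg mu_ (fun x _ => uv x).
have -> : (\int[mu R]_x (v x)%:E = \int[mu R]_x limn_einf (fun n => (u n x)%:E))%E.
  apply: eq_integral => x _.
  have h : (u n x)%:E @[n --> \oo] --> (v x)%:E by apply: cvg_EFin (uv x); exact: nearW.
  by have [-> _] := cvg_limn_einf_sup h.
apply: le_trans (fatou (mu R) measurableT _ _) _.
- by move=> n; apply/measurable_EFinP; exact: mu_.
- by move=> n x _; rewrite lee_fin.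
rewrite limn_einf_lim; apply: lime_le; first exact: is_cvg_einfs.
apply: nearW => n; apply: le_trans (uM n); apply: ereal_inf_lbound.
by exists n => //=.
Qed.

(** Convergence is asked at every point, so that [g] is measurable as a pointwise limit with no
    exceptional set. *)
Lemma L2_fatou (f_ : nat -> R -> R[i]) g (M : R) : 0 <= M ->
  (forall n, L2 (f_ n)) -> (forall n, nrm (f_ n) <= M) ->
  (forall x, complex.Re (f_ n x) @[n --> \oo] --> complex.Re (g x)) ->
  (forall x, complex.Im (f_ n x) @[n --> \oo] --> complex.Im (g x)) ->
  L2 g /\ nrm g <= M.
Proof.
move=> M0 lf fM fr fi.
have mg : cmeasurable g.
  split; first exact: measurable_fun_cvg (fun n => (L2_measurable (lf n)).1) (fun x _ => fr x).
  exact: measurable_fun_cvg (fun n => (L2_measurable (lf n)).2) (fun x _ => fi x).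
have [||||_ h] := @fatou_le (fun n x => modulus (f_ n x) ^+ 2)
    (fun x => modulus (g x) ^+ 2) (M ^+ 2)%:E.
- by move=> n; apply: measurable_modulus2; exact: L2_measurable.
- by move=> n x; exact: sqr_ge0.
- move=> x; rewrite modulusE2; under eq_fun do rewrite modulusE2.
  by apply: cvgD; rewrite expr2; under eq_fun do rewrite expr2; exact: cvgM.
- move=> n; rewrite -nrm_sqrE// lee_fin ler_pXn2r ?nnegrE ?nrm_ge0//.
have lg : L2 g.
  apply/L2P; split => //; apply/integrableP; split; first exact: emeasurable_modulus2.
  under eq_integral do rewrite abse_EFin ger0_norm ?sqr_ge0//.
  by apply: le_lt_trans h _; rewrite ltry.
split => //; rewrite -(@ler_pXn2r _ 2) ?nnegrE ?nrm_ge0//.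
by move: h; rewrite -nrm_sqrE// lee_fin.
Qed.

Lemma cvg_of_geometric (u : nat -> R) (s : R) :
  (forall k, `|u k.+1 - u k| <= s * 2^-1 ^+ k) -> cvgn u.
Proof.
move=> us.
have s0 : 0 <= s by have := le_trans (normr_ge0 _) (us 0%N); rewrite mulr1.
have h : cvgn (series (telescope u)).
  apply: normed_cvg; apply: (@series_le_cvg _ _ (geometric s 2^-1)) => //.
  - by move=> n /=.
  - by move=> n; apply: mulr_ge0 => //; rewrite exprn_ge0.
  - by apply: is_cvg_geometric_series; rewrite ger0_norm// invf_lt1// ltr1n.
rewrite (_ : u = fun n => u 0%N + series (telescope u) n).
  by apply: is_cvgD => //; exact: is_cvg_cst.
by apply/funext => n; rewrite telescopeK /=; ring.
Qed.

(** The weighted squares [d k] have summable integrals, so their sum is finite almost everywhere and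
    the increments decay geometrically there. The terms are set to zero on the exceptional null set
    to get convergence at every point, as [L2_fatou] asks. *)
Lemma L2_subsequence_cvg (f_ : nat -> R -> R[i]) : (forall n, L2 (f_ n)) ->
  (forall k, nrm (f_ k.+1 \- f_ k) <= 4^-1 ^+ k) ->
  exists g_ : nat -> R -> R[i], exists g,
    [/\ forall n, L2 (g_ n), forall n, {ae mu R, forall x, f_ n x = g_ n x},
       forall x, complex.Re (g_ n x) @[n --> \oo] --> complex.Re (g x) &
       forall x, complex.Im (g_ n x) @[n --> \oo] --> complex.Im (g x)].
Proof.
move=> lf fk.
(* The norm bound gives [d k] an integral of at most [4^k * 16^-k = 4^-k], while [d k <= S] still
   bounds the increment by [sqrt S * 2^-k]. *)
pose d k x := 4 ^+ k * modulus (f_ k.+1 x - f_ k x) ^+ 2.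
have ld k : L2 (f_ k.+1 \- f_ k) by exact: L2B.
have d0 k x : 0 <= d k x by rewrite mulr_ge0 ?sqr_ge0// exprn_ge0.
have md k : measurable_fun setT (fun x => (d k x)%:E).
  apply/measurable_EFinP; apply: measurable_funM => //.
  by apply: (@measurable_modulus2 _ (f_ k.+1 \- f_ k)); exact: L2_measurable.
have id_ k : (\int[mu R]_x (d k x)%:E <= (geometric 1 4^-1 k)%:E)%E.
  under eq_integral do rewrite EFinM.
  rewrite ge0_integralZl//; last 2 first.
    by apply: (@emeasurable_modulus2 _ (f_ k.+1 \- f_ k)); exact: L2_measurable.
    by move=> x _; rewrite lee_fin sqr_ge0.
  rewrite -(nrm_sqrE (ld k)) -EFinM lee_fin /= mul1r.
  apply: (@le_trans _ _ (4 ^+ k * (4^-1 ^+ k) ^+ 2)).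
    by rewrite ler_wpM2l ?exprn_ge0// ler_pXn2r ?nnegrE ?nrm_ge0// exprn_ge0.
  by rewrite expr2 mulrA -exprMn divff// expr1n mul1r.
pose S x := (\sum_(0 <= k <oo) (d k x)%:E)%E.
have iS : (\int[mu R]_x S x < +oo)%E.
  rewrite integral_nneseries//; last by move=> n x _; rewrite lee_fin.
  apply: (@le_lt_trans _ _ ((1 - 4^-1)^-1)%:E); last exact: ltry.
  apply: lime_le.
    by apply: is_cvg_nneseries => n _ _; apply: integral_ge0 => x _; rewrite lee_fin.
  apply: nearW => n; apply: (@le_trans _ _ (\sum_(0 <= k < n) (geometric 1 4^-1 k)%:E)%E).
    exact: lee_sum.
  rewrite sumEFin lee_fin -[leRHS]mul1r.
  by apply: geometric_le_lim => //; rewrite ger0_norm// invf_lt1// ltr1n.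
have S0 x : (0 <= S x)%E by apply: nneseries_ge0 => n _ _; rewrite lee_fin.
have mS : measurable_fun setT S by apply: measurable_nneseries => // n x; rewrite lee_fin.
have : (mu R).-integrable setT S.
  by apply/integrableP; split => //; under eq_integral do rewrite gee0_abs//.
move/integrable_ae => /(_ measurableT) [N [mN N0 SN]].
have Sfin x : ~ N x -> S x \is a fin_num.
  by move=> nN; apply: contrapT => h; apply: nN; apply: SN => /= /(_ I).
have mNc : measurable_fun setT (\1_(~` N) : R -> R).
  by apply: measurable_indic; exact: measurableC.
pose g_ n x := (\1_(~` N) x)%:C%C * f_ n x.
have gE n : {ae mu R, forall x, f_ n x = g_ n x}.
  exists N; split => // x /= h; apply: contrapT => nN; apply: h.
  by rewrite /g_ indicE mem_set// mul1r.
have mg n : cmeasurable (g_ n).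
  apply: cmeasurableM; last exact: L2_measurable.
  exact: cmeasurable_real.
have lg n : L2 (g_ n) by exact: ae_L2 (lf n).
have bd x k : modulus (g_ k.+1 x - g_ k x) <= Num.sqrt (fine (S x)) * 2^-1 ^+ k.
  rewrite /g_ indicE; have [xN|xN] := pselect (N x).
    rewrite memNset; last by move=> /(_ xN).
    by rewrite !mul0r subr0 modulus0 mulr_ge0 ?sqrtr_ge0// exprn_ge0.
  rewrite mem_set// !mul1r.
  have : ((d k x)%:E <= S x)%E.
    rewrite /S (@nneseriesD1 _ _ k)//; last by move=> ? _; rewrite lee_fin.
    by rewrite leeDl// nneseries_ge0// => ? _ _; rewrite lee_fin.
  rewrite -[S x]fineK ?Sfin// lee_fin.
  have : 0 <= fine (S x) by rewrite fine_ge0.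
  move: (fine (S x)) => s s0 ds.
  rewrite -(@ler_pXn2r _ 2) ?nnegrE ?modulus_ge0 ?mulr_ge0 ?sqrtr_ge0 ?exprn_ge0//=.
  rewrite exprMn sqr_sqrtr// (_ : (2^-1 ^+ k) ^+ 2 = (4 ^+ k)^-1); last first.
    by rewrite -exprM mulnC exprM -exprVn; congr (_ ^+ k); field.
  by rewrite ler_pdivlMr ?exprn_gt0// mulrC.
exists g_, (fun x => Complex (limn (fun n => complex.Re (g_ n x)))
                             (limn (fun n => complex.Im (g_ n x)))).
split => // x /=.
  suff: cvgn (fun n => complex.Re (g_ n x)) by [].
  apply: (@cvg_of_geometric _ (Num.sqrt (fine (S x)))) => k.
  by rewrite -ReN -ReD (le_trans (abs_Re_modulus _))//.
suff: cvgn (fun n => complex.Im (g_ n x)) by [].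
apply: (@cvg_of_geometric _ (Num.sqrt (fine (S x)))) => k.
by rewrite -ImN -ImD (le_trans (abs_Im_modulus _))//.
Qed.

Lemma L2_complete (f_ : nat -> R -> R[i]) : (forall n, L2 (f_ n)) ->
  (forall e : R, 0 < e -> exists N, forall m n, (N <= m)%N -> (N <= n)%N ->
     nrm (f_ m \- f_ n) <= e) ->
  exists f, L2 f /\ nrm (f_ n \- f) @[n --> \oo] --> (0 : R).
Proof.
move=> lf cf.
have /choice[N HN] (k : nat) : exists N, forall m n, (N <= m)%N -> (N <= n)%N ->
    nrm (f_ m \- f_ n) <= 4^-1 ^+ k by apply: cf; rewrite exprn_gt0.
(* Partial sums of [N] give nondecreasing indices with [N k <= s k]. *)
pose s k := (\sum_(j < k.+1) N j)%N.
have Ns k : (N k <= s k)%N by rewrite /s big_ord_recr /= leq_addl.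
have sS k : (s k <= s k.+1)%N by rewrite /s [leqRHS]big_ord_recr /= leq_addr.
have sm j k : (s k <= s (j + k))%N.
  by elim: j => // j IH; rewrite addSn (leq_trans IH).
have [||g_ [g [lg fg rg ig]]] := @L2_subsequence_cvg (fun k => f_ (s k)).
- by move=> k; exact: lf.
- by move=> k; apply: HN; rewrite (leq_trans (Ns _)).
(* Fatou in [j] passes the Cauchy bound between [f_ n] and the later subsequence terms to
   [f_ n - g]; this estimates the whole sequence at once. *)
have key k n : (N k <= n)%N -> L2 (f_ n \- g) /\ nrm (f_ n \- g) <= 4^-1 ^+ k.
  move=> kn; apply: (@L2_fatou (fun j => f_ n \- g_ (j + k)%N)).
  - by rewrite exprn_ge0.
  - by move=> j; exact: L2B.
  - move=> j; rewrite -(@ae_nrm _ (f_ n \- f_ (s (j + k)%N))).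
    + by apply: HN => //; exact: leq_trans (Ns k) (sm j k).
    + by apply: cmeasurableB; exact: L2_measurable.
    + by apply: cmeasurableB; exact: L2_measurable.
    + by apply: aeS (fg (j + k)%N) => x /= ->.
  - move=> x; rewrite ReD ReN; under eq_fun do rewrite ReD ReN.
    apply: cvgB; first exact: cvg_cst.
    by move: (rg x); rewrite -(cvg_shiftn k).
  - move=> x; rewrite ImD ImN; under eq_fun do rewrite ImD ImN.
    apply: cvgB; first exact: cvg_cst.
    by move: (ig x); rewrite -(cvg_shiftn k).
exists g; split.
  have [h _] := key 0%N (N 0%N) (leqnn _).
  have := L2B (lf (N 0%N)) h; congr (L2 _).
  by apply/funext => x /=; ring.
apply/cvgr0Pnorm_le => e e0.
have : geometric 1 4^-1 k @[k --> \oo] --> (0 : R).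
  by apply: cvg_geometric; rewrite ger0_norm// invf_lt1// ltr1n.
move=> /cvgr0Pnorm_le /(_ e e0) [k _ /(_ k (leqnn k))] /= ke.
exists (N k) => // n /= kn; rewrite ger0_norm ?nrm_ge0//.
apply: le_trans (key k n kn).2 (le_trans _ ke).
by rewrite mul1r ler_norm.
Qed.

End Completeness.

(** * Unconditional series and projections *)

Section FiniteSums.
Variable R : realType.

Lemma big_fset_split (V : zmodType) (A B : {fset int}) (F : int -> V) :
  (B `<=` A)%fset ->
  \sum_(k <- A) F k = \sum_(k <- B) F k + \sum_(k <- (A `\` B)%fset) F k.
Proof.
move=> BA; rewrite (big_fsetID _ (mem B)) /=; congr (_ + _).
  congr (\sum_(i <- enum_fset _) F i); apply/fsetP => x; rewrite !inE /= andbC.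
  by case xB : (x \in B) => //=; rewrite (fsubsetP BA).
congr (\sum_(i <- enum_fset _) F i); apply/fsetP => x.
by rewrite !inE /= andbC.
Qed.

(** The quadratic is evaluated at its minimum [S / B]. For [B = 0] it is affine, and [S <> 0] would
    allow the value -1 at [(A + 1) / (2 * S)]. *)
Lemma discriminant_le (A B S : R) : 0 <= B ->
  (forall t, 0 <= A - 2 * t * S + t ^+ 2 * B) -> S ^+ 2 <= A * B.
Proof.
rewrite le_eqVlt => /predU1P[<-|B0] H.
  have [->|S0] := eqVneq S 0; first by rewrite expr0n mulr0.
  have := H ((A + 1) / (2 * S)); rewrite mulr0 addr0.
  by rewrite (_ : A - _ = -1) ?ler0N1//; field.
have := H (S / B); rewrite (_ : _ + _ = (A * B - S ^+ 2) / B); last first.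
  by field; rewrite gt_eqF.
by rewrite pmulr_lge0 ?invr_gt0// subr_ge0.
Qed.

Lemma cauchy_schwarz_sum (I : Type) (s : seq I) (a b : I -> R) :
  (\sum_(i <- s) a i * b i) ^+ 2 <=
  (\sum_(i <- s) a i ^+ 2) * (\sum_(i <- s) b i ^+ 2).
Proof.
apply: discriminant_le => [|t]; first by rewrite sumr_ge0// => i _; rewrite sqr_ge0.
rewrite !mulr_sumr -sumrB -big_split /= sumr_ge0// => i _.
by rewrite (_ : _ + _ = (a i - t * b i) ^+ 2) ?sqr_ge0//; ring.
Qed.

Lemma modulus_sum (I : Type) (s : seq I) (F : I -> R[i]) :
  modulus (\sum_(i <- s) F i) <= \sum_(i <- s) modulus (F i).
Proof.
elim: s => [|a s IH]; first by rewrite !big_nil modulus0.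
by rewrite !big_cons; apply: le_trans (modulusD _ _) _; rewrite lerD2l.
Qed.

Lemma cauchy_schwarz_csum (I : Type) (s : seq I) (a b : I -> R[i]) :
  modulus (\sum_(i <- s) a i * b i) ^+ 2 <=
  (\sum_(i <- s) modulus (a i) ^+ 2) * (\sum_(i <- s) modulus (b i) ^+ 2).
Proof.
apply: le_trans (cauchy_schwarz_sum s _ _).
rewrite ler_pXn2r ?nnegrE ?modulus_ge0 ?sumr_ge0//; last first.
  by move=> i _; rewrite mulr_ge0 ?modulus_ge0.
by apply: le_trans (modulus_sum _ _) _; apply: ler_sum => i _; rewrite modulusM.
Qed.

(** A finite set whose sum is within [e] of the supremum of all finite sums leaves at most [e] to
    any set disjoint from it. *)
Lemma tail_sum_small (a : int -> R) (M e : R) : (forall k, 0 <= a k) ->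
  (forall A : {fset int}, \sum_(k <- A) a k <= M) -> 0 < e ->
  exists A0 : {fset int}, forall A B : {fset int}, (A0 `<=` A)%fset ->
    \sum_(k <- (B `\` A)%fset) a k <= e.
Proof.
move=> a0 aM e0; pose E := [set x | exists A : {fset int}, x = \sum_(k <- A) a k].
have supE : has_sup E.
  by split; [exists (\sum_(k <- fset0) a k); exists fset0|exists M => x [A ->]].
have [x [A0 ->] hA0] := sup_adherent e0 supE.
exists A0 => A B A0A.
have : \sum_(k <- (A0 `|` (B `\` A))%fset) a k <= sup E.
  by apply: sup_upper_bound => //; exists (A0 `|` (B `\` A))%fset.
rewrite (@big_fset_split _ _ A0) ?fsubsetUl//.
rewrite (_ : ((A0 `|` (B `\` A)) `\` A0)%fset = (B `\` A)%fset); first lra.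
apply/fsetP => k; rewrite !inE; case k0 : (k \in A0) => //=.
by rewrite (fsubsetP A0A).
Qed.

Lemma esum_le_sumP (a : int -> R) (M : R) : (forall k, 0 <= a k) ->
  (\esum_(k in [set: int]) (a k)%:E <= M%:E)%E <->
  (forall A : {fset int}, \sum_(k <- A) a k <= M).
Proof.
move=> a0; split => [h A|h].
  rewrite -lee_fin; apply: le_trans h; apply: esum_ge; exists [set` A].
    by split => //; exact: finite_fset.
  by rewrite -sumEFin fsbig_finite ?set_fsetK//; exact: finite_fset.
apply: ge_ereal_sup => _ [X [finX _] <-].
by rewrite fsbig_finite// sumEFin lee_fin.
Qed.

End FiniteSums.

(** * Unconditional sums of Bessel systems *)

Section Synthesis.
Variable R : realType.
Implicit Types (f g h s : R -> R[i]) (c : int -> R[i]) (F : int -> R -> R[i]).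

(** The epsilon form of convergence along [summability.totally], in real norms. *)
Definition net_limit F c s := forall e : R, 0 < e -> exists A0 : {fset int},
  forall A : {fset int}, (A0 `<=` A)%fset -> nrm (s \- lincomb A c F) <= e.

Lemma net_limitP F c s : (forall k, L2 (F k)) -> L2 s ->
  (L2norm (s \- lincomb A c F) @[A --> summability.totally] --> 0%E) <->
  net_limit F c s.
Proof.
move=> lF ls.
have E A : L2norm (s \- lincomb A c F) = (nrm (s \- lincomb A c F))%:E.
  by rewrite L2normE//; apply: L2B => //; exact: L2_lincomb.
have FF : Filter (@summability.totally int) by exact: summability.totally_filter.
rewrite (_ : (fun A => L2norm _) = (fun A => (nrm (s \- lincomb A c F))%:E)); last first.
  by apply/funext.
split=> [/fine_cvg /cvgr0Pnorm_le H e e0|H].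
  have [A0 _ hA0] := H e e0; exists A0 => A /hA0 /=.
  by rewrite ger0_norm ?nrm_ge0.
apply: cvg_EFin; first exact: nearW.
apply/cvgr0Pnorm_le => e /H[A0 hA0]; exists A0 => // A /hA0 /=.
by rewrite ger0_norm ?nrm_ge0.
Qed.

(** The synthesis side of the Bessel inequality, equivalent to it with the same constant. It is the
    form that passes to the frequency side, where a finite combination of translates becomes a
    trigonometric polynomial times a transform. *)
Definition riesz_bound F (b : R) := (forall k, L2 (F k)) /\
  forall (A : {fset int}) c,
    nrm (lincomb A c F) ^+ 2 <= b * \sum_(k <- A) modulus (c k) ^+ 2.

(** Duality. For [c k = <f, F k>] the pairing of [f] with the combination is the sum [S] itself, so
    [S^2 <= ||f||^2 b S]. Conversely a combination [h] satisfies [||h||^4 <= (sum |c k|^2) (sum |<h,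
    F k>|^2)]. In both cases one factor cancels. *)
Lemma riesz_boundP F (b : R) : 0 <= b -> (forall k, L2 (F k)) ->
  riesz_bound F b <->
  (forall f, L2 f -> forall A : {fset int},
    \sum_(k <- A) modulus (inner f (F k)) ^+ 2 <= b * nrm f ^+ 2).
Proof.
move=> b0 lF; split=> [[_ H] f lf A|H].
  set S := \sum_(k <- A) _.
  have S0 : 0 <= S by apply: sumr_ge0 => k _; rewrite sqr_ge0.
  pose c k := inner f (F k).
  have E : inner f (lincomb A c F) = S%:C%C.
    rewrite inner_lincombr// /S rmorph_sum; apply: eq_bigr => k _.
    by rewrite mulrC mulc_conjc.
  have : modulus (inner f (lincomb A c F)) ^+ 2 <= (nrm f * nrm (lincomb A c F)) ^+ 2.
    rewrite ler_pXn2r ?nnegrE ?modulus_ge0 ?mulr_ge0 ?nrm_ge0//.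
    by apply: cauchy_schwarz => //; exact: L2_lincomb.
  rewrite E modulus_real ger0_norm// exprMn => h.
  have := le_trans h (ler_wpM2l (sqr_ge0 _) (H A c)).
  rewrite -/S (expr2 S); move: S0; rewrite le_eqVlt => /predU1P[<-|S1] => [_|].
    by rewrite mulr_ge0 ?sqr_ge0.
  by rewrite mulrA ler_pM2r// mulrC.
split => // A c; set h := lincomb A c F; have lh : L2 h by exact: L2_lincomb.
have E : inner h h = \sum_(k <- A) c k * inner (F k) h by rewrite inner_lincombl.
have := cauchy_schwarz_csum (enum_fset A) c (fun k => inner (F k) h).
rewrite -E inner_self// modulus_real ger0_norm ?sqr_ge0//.
have -> : \sum_(i <- A) modulus (inner (F i) h) ^+ 2 =
          \sum_(i <- A) modulus (inner h (F i)) ^+ 2.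
  by apply: eq_bigr => k _; rewrite (innerC lh (lF k)) modulus_conjc.
have := H h lh A; set T := \sum_(i <- A) modulus (inner _ _) ^+ 2.
set S := \sum_(i <- A) _; have S0 : 0 <= S by apply: sumr_ge0 => k _; rewrite sqr_ge0.
move=> Tb h1; have := le_trans h1 (ler_wpM2l S0 Tb).
move: (sqr_ge0 (nrm h)); move: (nrm h ^+ 2) => N.
rewrite le_eqVlt => /predU1P[<-|N0]; first by rewrite mulr_ge0.
by rewrite expr2 mulrA ler_pM2r// mulrC.
Qed.

(** The Riesz bound makes the finite sums a Cauchy net, since square-summable coefficients have
    small tails. *)
Lemma synthesis_exists F (b M : R) c : 0 <= b -> riesz_bound F b ->
  (forall A : {fset int}, \sum_(k <- A) modulus (c k) ^+ 2 <= M) ->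
  exists s, L2 s /\ net_limit F c s.
Proof.
move=> b0 [lF Hb] cM.
have lA A : L2 (lincomb A c F) by exact: L2_lincomb.
have dA A B : (B `<=` A)%fset -> lincomb A c F \- lincomb B c F = lincomb (A `\` B)%fset c F.
  move=> BA; apply/funext => x; rewrite /lincomb /= (big_fset_split _ BA); ring.
have tail (e : R) : 0 < e -> exists A0 : {fset int}, forall A B : {fset int},
    (A0 `<=` A)%fset -> (A `<=` B)%fset ->
    nrm (lincomb B c F \- lincomb A c F) <= e.
  move=> e0.
  (* The [+ 1] keeps the tolerance defined for [b = 0]; [b / (b + 1) <= 1] then leaves [e ^+ 2]. *)
  have [||A0 hA0] := @tail_sum_small _ (fun k => modulus (c k) ^+ 2) M (e ^+ 2 / (b + 1)) _ cM.
  - by move=> k; exact: sqr_ge0.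
  - by rewrite divr_gt0 ?exprn_gt0// ltr_wpDl.
  exists A0 => A B A0A AB; rewrite dA//; apply: sqr_le_le; first exact: ltW.
  apply: le_trans (Hb _ _) _; apply: le_trans (ler_wpM2l b0 (hA0 A B A0A)) _.
  rewrite mulrCA ler_piMr ?sqr_ge0// ler_pdivrMr ?mul1r ?ltr_wpDl//.
  by rewrite lerDl.
have tail2 (e : R) : 0 < e -> exists A0 : {fset int}, forall A B : {fset int},
    (A0 `<=` A)%fset -> (A0 `<=` B)%fset ->
    nrm (lincomb B c F \- lincomb A c F) <= e.
  move=> e0; have [|A0 hA0] := tail (e / 2); first by rewrite divr_gt0.
  exists A0 => A B A0A A0B.
  apply: le_trans (nrm_triangle (lA _) (lA (A `|` B)%fset) (lA _)) _.
  rewrite (splitr e); apply: lerD; last by apply: hA0 => //; exact: fsubsetUl.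
  by rewrite nrmBC; apply: hA0 => //; exact: fsubsetUr.
(* Completeness concerns sequences, so finite sets are chosen beyond which the net oscillates by at
   most [1 / (n + 1)]; the limit along [A_] is then the limit of the net. *)
have /choice[A_ hA] (n : nat) : exists A0 : {fset int}, forall A B : {fset int},
    (A0 `<=` A)%fset -> (A0 `<=` B)%fset ->
    nrm (lincomb B c F \- lincomb A c F) <= n.+1%:R^-1 by apply: tail2; rewrite invr_gt0.
have small (e : R) : 0 < e -> exists N, forall n, (N <= n)%N -> n.+1%:R^-1 <= e.
  move=> e0; have := @cvg_harmonic R => /cvgr0Pnorm_le /(_ e e0) [N _ hN].
  by exists N => n /hN /=; rewrite ger0_norm.
pose A2 n := (\bigcup_(i <- iota 0 n.+1) A_ i)%fset.
have [||s [ls hs]] := @L2_complete _ (fun n => lincomb (A_ n) c F).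
- by move=> n.
- move=> e e0; have [|N hN] := small (e / 2); first by rewrite divr_gt0.
  exists N => m n Nm Nn.
  apply: le_trans (nrm_triangle (lA _) (lA (A_ m `|` A_ n)%fset) (lA _)) _.
  rewrite (splitr e); apply: lerD.
    by rewrite nrmBC; apply: le_trans (hN m Nm); apply: hA => //; exact: fsubsetUl.
  by apply: le_trans (hN n Nn); apply: hA => //; exact: fsubsetUr.
exists s; split => // e e0.
have e2 : 0 < e / 2 by rewrite divr_gt0.
have [N1 _ h1] := (cvgr0Pnorm_le _).1 hs _ e2.
have e4 : 0 < e / 4 by rewrite divr_gt0.
have [N2 h2] := small _ e4.
pose n := maxn N1 N2.
exists (A_ n) => A AnA.
apply: le_trans (nrm_triangle ls (lA (A_ n)) (lA _)) _.
rewrite (splitr e); apply: lerD.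
  rewrite nrmBC; have := h1 n (leq_maxl _ _).
  by rewrite /= ger0_norm ?nrm_ge0.
rewrite nrmBC; apply: le_trans (hA n (A_ n) A _ _) _ => //.
apply: le_trans (h2 n (leq_maxr _ _)) _.
by rewrite ler_pM2l// lef_pV2 ?posrE// ler_nat.
Qed.

Lemma net_limit_near F c s (e : R) : 0 < e -> net_limit F c s ->
  exists A : {fset int}, nrm (s \- lincomb A c F) <= e.
Proof. by move=> e0 /(_ e e0)[A hA]; exists A; exact: hA. Qed.

Lemma le0_all_eps (x : R) : (forall e, 0 < e -> x <= e) -> x <= 0.
Proof. by move=> h; apply/ler_addgt0Pl => e /h; rewrite addr0. Qed.

Lemma net_limit_unique F c s s' : (forall k, L2 (F k)) -> L2 s -> L2 s' ->
  net_limit F c s -> net_limit F c s' -> nrm (s \- s') = 0.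
Proof.
move=> lF ls ls' h h'; apply/eqP; rewrite eq_le nrm_ge0 andbT.
apply: le0_all_eps => e e0; have e2 : 0 < e / 2 by rewrite divr_gt0.
have [A0 hA] := h _ e2; have [A1 hA'] := h' _ e2.
have lA : L2 (lincomb (A0 `|` A1)%fset c F) by exact: L2_lincomb.
apply: le_trans (nrm_triangle ls lA ls') _.
rewrite (splitr e); apply: lerD; first by apply: hA; exact: fsubsetUl.
by rewrite nrmBC; apply: hA'; exact: fsubsetUr.
Qed.

Lemma net_limit_nrm F (b M : R) c s : 0 <= b -> riesz_bound F b -> L2 s ->
  (forall A : {fset int}, \sum_(k <- A) modulus (c k) ^+ 2 <= M) ->
  net_limit F c s -> nrm s ^+ 2 <= b * M.
Proof.
move=> b0 [lF Hb] ls cM h.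
have M0 : 0 <= M by have := cM fset0; rewrite big_nil.
rewrite -[leRHS]sqr_sqrtr ?mulr_ge0// ler_pXn2r ?nnegrE ?nrm_ge0 ?sqrtr_ge0//.
rewrite -subr_le0; apply: le0_all_eps => e e0; rewrite lerBlDl.
have [A hA] := net_limit_near e0 h.
have lA : L2 (lincomb A c F) by exact: L2_lincomb.
apply: le_trans (nrm_le_sub ls lA) _; apply: lerD => //.
apply: sqr_le_le; rewrite ?sqrtr_ge0// sqr_sqrtr ?mulr_ge0//.
by apply: le_trans (Hb _ _) _; rewrite ler_wpM2l.
Qed.

Lemma net_limitB F c c' s s' : (forall k, L2 (F k)) -> L2 s -> L2 s' ->
  net_limit F c s -> net_limit F c' s' ->
  net_limit F (fun k => c k - c' k) (s \- s').
Proof.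
move=> lF ls ls' h h' e e0; have e2 : 0 < e / 2 by rewrite divr_gt0.
have [A0 hA] := h _ e2; have [A1 hA'] := h' _ e2.
exists (A0 `|` A1)%fset => A; rewrite fsubUset => /andP[/hA h1 /hA' h2].
rewrite -lincombB.
rewrite (_ : _ \- _ = (s \- lincomb A c F) \- (s' \- lincomb A c' F)).
  apply: le_trans (nrmB _ _) _; try by apply: L2B => //; exact: L2_lincomb.
  by rewrite (splitr e) lerD.
by apply/funext => x /=; ring.
Qed.

Lemma net_limit_inner F c s g : (forall k, L2 (F k)) -> L2 s -> L2 g ->
  net_limit F c s -> forall e : R, 0 < e -> exists A0 : {fset int},
  forall A : {fset int}, (A0 `<=` A)%fset ->
    modulus (inner s g - \sum_(k <- A) c k * inner (F k) g) <= e.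
Proof.
move=> lF ls lg h e e0.
have e1 : 0 < e / (nrm g + 1) by rewrite divr_gt0// ltr_wpDl ?nrm_ge0.
have [A0 hA] := h _ e1; exists A0 => A /hA hA1.
rewrite -inner_lincombl// -innerBl//; last exact: L2_lincomb.
apply: le_trans (cauchy_schwarz _ lg) _; first by apply: L2B => //; exact: L2_lincomb.
apply: le_trans (ler_wpM2r (nrm_ge0 _) hA1) _.
rewrite mulrAC ler_pdivrMr ?ltr_wpDl ?nrm_ge0//.
by rewrite ler_wpM2l ?lerDl//; exact: ltW.
Qed.

(** Existence is what makes the [xget] in [synthesis] return a limit instead of its default. *)
Lemma synthesisP F (b M : R) c : 0 <= b -> riesz_bound F b ->
  (forall A : {fset int}, \sum_(k <- A) modulus (c k) ^+ 2 <= M) ->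
  L2 (synthesis F c) /\ net_limit F c (synthesis F c).
Proof.
move=> b0 Hb cM.
have [s [ls hs]] := synthesis_exists b0 Hb cM.
have : [set s | L2 s /\ L2norm (s \- lincomb A c F) @[A --> summability.totally] --> 0%E]
    (synthesis F c).
  by apply: xgetPex; exists s; split => //; apply/net_limitP => //; exact: Hb.1.
by move=> [lS] /(net_limitP c Hb.1 lS).
Qed.

End Synthesis.

(** * Closed subspaces and orthogonal projection *)

Section Projection.
Variable R : realType.
Implicit Types (f g h : R -> R[i]) (F : int -> R -> R[i]).

Definition closed_subspace (W : set (R -> R[i])) := [/\ W `<=` @L2 R,
  W (fun=> 0), forall f g, W f -> W g -> W (f \+ g),
  forall c f, W f -> W (fun x => c * f x) &
  forall g, L2 g -> (forall e : R, 0 < e -> exists2 f, W f & nrm (g \- f) <= e) -> W g].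

Lemma closed_spanP F f : (forall k, L2 (F k)) -> closed_span F f <->
  L2 f /\ forall e : R, 0 < e -> exists A c, nrm (f \- lincomb A c F) < e.
Proof.
move=> lF; split=> -[lf H]; split => // e /H [A [c hA]]; exists A, c; move: hA;
  by rewrite L2normE ?lte_fin//; apply: L2B => //; exact: L2_lincomb.
Qed.

Lemma lincombD (A : {fset int}) (c d : int -> R[i]) F :
  lincomb A c F \+ lincomb A d F = lincomb A (fun k => c k + d k) F.
Proof.
apply/funext => x; rewrite /lincomb /= -big_split /=.
by apply: eq_bigr => k _; rewrite mulrDl.
Qed.

Lemma lincombZ (A : {fset int}) (c : int -> R[i]) a F :
  (fun x => a * lincomb A c F x) = lincomb A (fun k => a * c k) F.
Proof.
apply/funext => x; rewrite /lincomb mulr_sumr.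
by apply: eq_bigr => k _; rewrite mulrA.
Qed.

Lemma lincomb_extend (A B : {fset int}) (c : int -> R[i]) F : (A `<=` B)%fset ->
  lincomb A c F = lincomb B (fun k => if k \in A then c k else 0) F.
Proof.
move=> AB; apply/funext => x; rewrite /lincomb (big_fset_split _ AB).
rewrite [X in _ + X]big1_seq ?addr0; last first.
  by move=> k /andP[_]; rewrite !inE => /andP[/negbTE -> _]; rewrite mul0r.
by rewrite big_seq [RHS]big_seq; apply: eq_bigr => k ->.
Qed.

Lemma closed_span_lincomb F A c : (forall k, L2 (F k)) ->
  closed_span F (lincomb A c F).
Proof.
move=> lF; apply/closed_spanP => //; split; first exact: L2_lincomb.
move=> e e0; exists A, c; rewrite lincombB (_ : lincomb _ _ _ = fun=> 0) ?nrm0//.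
by apply/funext => x; rewrite /lincomb big1// => k _; rewrite subrr mul0r.
Qed.

Lemma closed_span_gen F k : (forall k, L2 (F k)) -> closed_span F (F k).
Proof.
move=> lF; rewrite (_ : F k = lincomb [fset k]%fset (fun=> 1) F).
  exact: closed_span_lincomb.
by apply/funext => x; rewrite /lincomb big_seq_fset1 mul1r.
Qed.

Lemma closed_span_subspace F : (forall k, L2 (F k)) ->
  closed_subspace (closed_span F).
Proof.
move=> lF; split.
- by move=> f [].
- rewrite (_ : (fun=> 0) = lincomb fset0 (fun=> 0) F); first exact: closed_span_lincomb.
  by apply/funext => x; rewrite /lincomb big_nil.
- move=> f g /(closed_spanP _ lF)[lf hf] /(closed_spanP _ lF)[lg hg].
  apply/closed_spanP => //; split; first exact: L2D.
  move=> e e0; have e2 : 0 < e / 2 by rewrite divr_gt0.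
  have [A [c hA]] := hf _ e2; have [B [d hB]] := hg _ e2.
  exists (A `|` B)%fset.
  exists (fun k => (if k \in A then c k else 0) + (if k \in B then d k else 0)).
  move: hA hB; rewrite (lincomb_extend c F (fsubsetUl A B)).
  rewrite (lincomb_extend d F (fsubsetUr A B)) => hA hB.
  rewrite -lincombD; move: hA hB; set p := lincomb _ _ _; set q := lincomb _ _ _ => hA hB.
  have lp : L2 p by exact: L2_lincomb.
  have lq : L2 q by exact: L2_lincomb.
  rewrite (_ : _ \- _ = (f \- p) \+ (g \- q)).
    by apply: le_lt_trans (nrmD (L2B lf lp) (L2B lg lq)) _; rewrite (splitr e) ltrD.
  by apply/funext => x /=; ring.
- move=> a f /(closed_spanP _ lF)[lf hf].
  apply/closed_spanP => //; split; first exact: L2Z.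
  move=> e e0; have a1 : 0 < modulus a + 1 by rewrite ltr_wpDl ?modulus_ge0.
  have [|A [c hA]] := hf (e / (modulus a + 1)); first by rewrite divr_gt0.
  exists A, (fun k => a * c k); rewrite -lincombZ.
  have lA : L2 (lincomb A c F) by exact: L2_lincomb.
  rewrite (_ : _ \- _ = fun x => a * (f \- lincomb A c F) x); last first.
    by apply/funext => x /=; ring.
  rewrite nrmZ; last exact: L2B.
  apply: (@le_lt_trans _ _ ((modulus a + 1) * nrm (f \- lincomb A c F))).
    by rewrite ler_wpM2r ?nrm_ge0// lerDl.
  by rewrite mulrC -ltr_pdivlMr.
- move=> g lg hg; apply/closed_spanP => //; split => // e e0.
  have e2 : 0 < e / 2 by rewrite divr_gt0.
  have [f /(closed_spanP _ lF)[lf hf] gf] := hg _ e2.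
  have [A [c hA]] := hf _ e2; exists A, c.
  have lA : L2 (lincomb A c F) by exact: L2_lincomb.
  apply: le_lt_trans (nrm_triangle lg lf lA) _.
  by rewrite (splitr e) ler_ltD.
Qed.

(** The parallelogram law with the midpoint isolated: in a subspace the midpoint is no closer to [f]
    than the infimum, so two almost minimizing points are close to each other. *)
Lemma half_sum_nrm f g g' : L2 f -> L2 g -> L2 g' ->
  nrm (g \- g') ^+ 2 = 2 * (nrm (f \- g) ^+ 2 + nrm (f \- g') ^+ 2)
    - 4 * nrm (f \- (fun x => 2^-1%:C%C * (g \+ g') x)) ^+ 2.
Proof.
move=> lf lg lg'; rewrite -parallelogram; [|exact: L2B..].
rewrite (_ : (f \- g) \- (f \- g') = g' \- g); last by apply/funext => x /=; ring.
rewrite [nrm (g' \- g)]nrmBC.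
set u := f \- (fun x => _ * _).
have lu : L2 u by apply: L2B => //; apply: L2Z; exact: L2D.
rewrite (_ : (f \- g) \+ (f \- g') = fun x => (2 : R)%:C%C * u x); last first.
  apply/funext => x; rewrite /u /= mulrBr mulrA -rmorphM divff// rmorph1 mul1r.
  by rewrite (_ : (2 : R)%:C%C = 2); [ring|rewrite rmorph_nat].
by rewrite nrmZ// modulus_real ger0_norm// exprMn; ring.
Qed.

(** A minimizing sequence for the distance is Cauchy by [half_sum_nrm], and minimality of its limit
    forces orthogonality. *)
Lemma projection_exists (W : set (R -> R[i])) f : closed_subspace W -> L2 f ->
  exists g, W g /\ forall h, W h -> inner (f \- g) h = 0.
Proof.
move=> [WL W0 WD WZ Wcl] lf.
pose E := [set x | exists2 g, W g & x = nrm (f \- g) ^+ 2].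
have infE : has_inf E.
  split; first by exists (nrm (f \- (fun=> 0)) ^+ 2); exists (fun=> 0).
  by exists 0 => x [g _ ->]; rewrite sqr_ge0.
set D := inf E.
have DE g : W g -> D <= nrm (f \- g) ^+ 2.
  by move=> Wg; apply: ge_inf; [exact: infE.2|exists g].
(* With the excess [4^-n / 4], [half_sum_nrm] bounds [||g_m - g_n||^2] by [(4^-m + 4^-n) / 2]. *)
have /choice[g_ hg] (n : nat) :
    exists g, W g /\ nrm (f \- g) ^+ 2 <= D + (4^-1 ^+ n) / 4.
  have [|x [g Wg ->] xD] := @inf_adherent _ E (4^-1 ^+ n / 4) _ infE.
    by rewrite divr_gt0// exprn_gt0.
  by exists g; split => //; rewrite ltW.
have lg n : L2 (g_ n) by apply: WL; exact: (hg n).1.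
have small (e : R) : 0 < e -> exists N, 4^-1 ^+ N <= e.
  move=> e0; have : geometric 1 4^-1 k @[k --> \oo] --> (0 : R).
    by apply: cvg_geometric; rewrite ger0_norm// invf_lt1// ltr1n.
  move=> /cvgr0Pnorm_le /(_ e e0) [k _ /(_ k (leqnn k))] /= ke.
  by exists k; rewrite (le_trans _ ke)// mul1r ler_norm.
have dec m n : (m <= n)%N -> (4^-1 ^+ n : R) <= 4^-1 ^+ m.
  by move=> mn; rewrite ler_wiXn2l// invf_le1// ler1n.
have [|g [lg0 cg]] := @L2_complete _ g_ lg.
  move=> e e0; have [|N hN] := small (e ^+ 2); first by rewrite exprn_gt0.
  exists N => m n Nm Nn; apply: sqr_le_le; first exact: ltW.
  apply: le_trans hN; rewrite (half_sum_nrm lf (lg m) (lg n)).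
  have := DE _ (WZ 2^-1%:C%C _ (WD _ _ (hg m).1 (hg n).1)).
  have := (hg m).2; have := (hg n).2; have := dec _ _ Nm; have := dec _ _ Nn.
  by move: (4^-1 ^+ n) (4^-1 ^+ m) (4^-1 ^+ N) => x y z; lra.
have Wg : W g.
  apply: Wcl => // e e0.
  have [N _ hN] := (cvgr0Pnorm_le _).1 cg _ e0.
  exists (g_ N); first exact: (hg N).1.
  by have := hN N (leqnn N); rewrite /= ger0_norm ?nrm_ge0// nrmBC.
exists g; split => // h Wh; have lh := WL _ Wh.
have gD : nrm (f \- g) ^+ 2 <= D.
  have D0 : 0 <= D by apply: lb_le_inf infE.1 _ => x [u _ ->]; rewrite sqr_ge0.
  rewrite -[leRHS]sqr_sqrtr// ler_pXn2r ?nnegrE ?nrm_ge0 ?sqrtr_ge0//.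
  rewrite -subr_le0; apply: le0_all_eps => e e0; rewrite lerBlDl.
  have e2 : 0 < e / 2 by rewrite divr_gt0.
  have [N _ hN] := (cvgr0Pnorm_le _).1 cg _ e2.
  have [|N' hN'] := small ((e / 2) ^+ 2); first by rewrite exprn_gt0.
  pose n := maxn N N'.
  apply: le_trans (nrm_triangle lf (lg n) lg0) _.
  rewrite (splitr e) addrA; apply: lerD; last first.
    by have := hN n (leq_maxl _ _); rewrite /= ger0_norm ?nrm_ge0.
  apply: sqr_le_le; first by rewrite addr_ge0 ?sqrtr_ge0//; exact: ltW.
  apply: le_trans (hg n).2 _; rewrite sqrrD sqr_sqrtr//.
  have := dec _ _ (leq_maxr N N'); have := mulr_ge0 (sqrtr_ge0 D) (ltW e2).
  have : (0 : R) <= 4^-1 ^+ n by rewrite exprn_ge0.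
  rewrite -/n; move: hN'; move: (4^-1 ^+ N') (4^-1 ^+ n) (Num.sqrt D * _) ((e / 2) ^+ 2).
  by move=> a b c d; rewrite -mulr_natl; lra.
set a := inner (f \- g) h.
(* Minimality against [g + t a h] gives [0 <= - 2 t |a|^2 + t^2 |a|^2 ||h||^2] for every [t], the
   case [A = 0] of [discriminant_le]. *)
suff : (modulus a ^+ 2) ^+ 2 <= 0 * (modulus a ^+ 2 * nrm h ^+ 2).
  rewrite mul0r => h0; apply: modulus_eq0; apply/eqP.
  have : modulus a ^+ 2 ^+ 2 == 0 by rewrite eq_le h0 sqr_ge0.
  by rewrite !expf_eq0 /=.
apply: discriminant_le; first by rewrite mulr_ge0 ?sqr_ge0.
move=> t; pose u := fun x => (t%:C%C * a) * h x.
have Wu : W u by exact: WZ.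
have lu := WL _ Wu.
have := DE _ (WD _ _ Wg Wu).
rewrite (_ : f \- (g \+ u) = (f \- g) \+ (fun x => - u x)); last first.
  by apply/funext => x /=; ring.
rewrite nrm_sqrD ?nrmN//; [|exact: L2B|exact: L2N].
rewrite (innerC (L2N lu) (L2B lf lg0)) innerNl//; last exact: L2B.
rewrite conjcN -(innerC lu (L2B lf lg0)) /u innerZr//; last exact: L2B.
rewrite -/a nrmZ// modulusM modulus_real !exprMn real_normK ?num_real//.
clearbody a; rewrite (_ : conjc _ * a = (t * modulus a ^+ 2)%:C%C) ?ReN; last first.
  by rewrite conjcM conjc_real [LHS]mulrAC -[LHS]mulrA mulc_conjc -rmorphM.
by move: gD; move: (modulus a ^+ 2) => aa /=; nra.
Qed.

Lemma orth_projP (W : set (R -> R[i])) f : closed_subspace W -> L2 f ->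
  W (orth_proj W f) /\ forall h, W h -> inner (f \- orth_proj W f) h = 0.
Proof.
move=> cW lf; have [g hg] := projection_exists cW lf.
have : [set g | W g /\ forall h, W h -> inner (f \- g) h = 0] (orth_proj W f).
  by apply: xgetPex; exists g.
by [].
Qed.

Lemma orth_proj_nrm (W : set (R -> R[i])) f : closed_subspace W -> L2 f ->
  nrm (orth_proj W f) <= nrm f.
Proof.
move=> cW lf; have [Wg hg] := orth_projP cW lf.
have [WL _ _ _ _] := cW; have lg := WL _ Wg.
rewrite -(@ler_pXn2r _ 2) ?nnegrE ?nrm_ge0//.
have {2}-> : f = (f \- orth_proj W f) \+ orth_proj W f.
  by apply/funext => x /=; ring.
rewrite (nrm_sqrD (L2B lf lg) lg).
by rewrite hg// mulr0 addr0 lerDr sqr_ge0.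
Qed.

End Projection.

(** * Translations and periodization *)

Section Translation.
Variable R : realType.
Implicit Types (f g : R -> R[i]).

Lemma measurable_shift (a : R) : measurable_fun setT (fun x : R => x + a).
Proof. by apply: measurable_funD. Qed.

(** Both measures agree on half-open intervals, which determine Lebesgue measure. *)
Lemma lebesgue_measure_shift (a : R) (A : set R) : measurable A ->
  mu R ((fun x => x + a) @^-1` A) = mu R A.
Proof.
move=> mA.
pose s : measurableTypeR R -> measurableTypeR R := fun x => x + a.
have ms : measurable_fun setT s by exact: measurable_shift.
pose s' : {mfun measurableTypeR R >-> measurableTypeR R} :=
  HB.pack s (isMeasurableFun.Build _ _ _ _ s ms).
have := @lebesgue_measure_unique R (pushforward (mu R) s') _ A mA.
rewrite /pushforward => -> // X [[x y] _ <-] /=.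
rewrite /pushforward (_ : s @^-1` _ = `]x - a, y - a]%classic); last first.
  by apply/seteqP; split => z /=; rewrite !in_itv /= ltrBlDr lerBrDr.
rewrite !lebesgue_measure_itv /= !lte_fin ltrD2r; case: ifP => // _.
by rewrite -!EFinB; congr EFin; ring.
Qed.

Lemma ae_shift (P : R -> Prop) (a : R) : {ae mu R, forall x, P x} ->
  {ae mu R, forall x, P (x + a)}.
Proof.
move=> [N [mN N0 PN]]; exists ((fun x => x + a) @^-1` N); split.
- by rewrite -[X in measurable X]setTI; exact: measurable_shift.
- by rewrite -N0; exact: lebesgue_measure_shift.
- by move=> x /= Px; exact: PN.
Qed.

Lemma integral_shift (a : R) (f : R -> \bar R) : measurable_fun setT f ->
  (forall x, 0 <= f x)%E ->
  (\int[mu R]_x f (x + a)%R = \int[mu R]_x f x)%E.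
Proof.
move=> mf f0.
pose s : measurableTypeR R -> measurableTypeR R := fun x => x + a.
have ms : measurable_fun setT s by exact: measurable_shift.
pose s' : {mfun measurableTypeR R >-> measurableTypeR R} :=
  HB.pack s (isMeasurableFun.Build _ _ _ _ s ms).
have := @ge0_integral_pushforward _ _ (measurableTypeR R) (measurableTypeR R) R s ms
  (mu R) setT f measurableT mf (fun x _ => f0 x).
rewrite preimage_setT => <-.
apply: (@eq_measure_integral _ _ _ setT (mu R) (pushforward (mu R) s')) => A mA _.
exact: lebesgue_measure_shift.
Qed.

Lemma Rintegral_shift (a : R) (u : R -> R) : measurable_fun setT u ->
  \int[mu R]_x u (x + a) = \int[mu R]_x u x.
Proof.
move=> mu_; rewrite /Rintegral [in LHS]integralE [in RHS]integralE.
congr (fine (_ - _)%E).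
  apply: etrans (integral_shift a (f := ((EFin \o u)^\+)%E) _ _) => //.
    by apply: eq_integral => x _; rewrite !funeposE.
  by apply: measurable_funepos; exact/measurable_EFinP.
apply: etrans (integral_shift a (f := ((EFin \o u)^\-)%E) _ _) => //.
  by apply: eq_integral => x _; rewrite !funenegE.
by apply: measurable_funeneg; exact/measurable_EFinP.
Qed.

Lemma integrableR_shift (a : R) (u : R -> R) : integrableR (fun x => (u x)%:E) ->
  integrableR (fun x => (u (x + a))%:E).
Proof.
move=> iu; have mu_ := integrableR_EFin iu; move/integrableP : iu => [_ iu].
apply/integrableP; split.
  apply/measurable_EFinP; exact: (measurableT_comp mu_ (measurable_shift a)).
rewrite (integral_shift a (f := fun x => `|(u x)%:E|%E))//.
by apply: measurableT_comp => //; exact/measurable_EFinP.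
Qed.

Lemma cmeasurable_shift (a : R) f : cmeasurable f -> cmeasurable (fun x => f (x + a)).
Proof. exact: (cmeasurable_comp (measurable_shift a)). Qed.

Lemma cintegral_shift (a : R) f : cmeasurable f ->
  cintegral (fun x => f (x + a)) = cintegral f.
Proof.
move=> [f1 f2]; apply: complex_eqP => /=.
  exact: (Rintegral_shift a f1).
exact: (Rintegral_shift a f2).
Qed.

Lemma cintegrable_shift (a : R) f : cintegrable f -> cintegrable (fun x => f (x + a)).
Proof.
move=> [f1 f2]; split; first exact: (integrableR_shift a f1).
exact: (integrableR_shift a f2).
Qed.

Lemma L2_shift (a : R) f : L2 f ->
  L2 (fun x => f (x + a)) /\ nrm (fun x => f (x + a)) = nrm f.
Proof.
move=> /L2P[mf if_]; split.
  by apply/L2P; split; [exact: cmeasurable_shift|exact: (integrableR_shift a if_)].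
rewrite !nrmE; congr Num.sqrt.
by apply: (Rintegral_shift a (u := fun x => modulus (f x) ^+ 2)); exact: measurable_modulus2.
Qed.

Lemma inner_shift (a : R) f g : L2 f -> L2 g ->
  inner (fun x => f (x + a)) (fun x => g (x + a)) = inner f g.
Proof.
move=> lf lg; apply: (cintegral_shift a (f := fun x => f x * conjc (g x))).
by apply: cintegrable_measurable; exact: L2M_cintegrable.
Qed.

Lemma L2_translates f k : L2 f -> L2 (translates f k).
Proof. by move=> lf; exact: (L2_shift _ lf).1. Qed.

End Translation.

(** * Folding the line onto one period *)

Section Periodization.
Variable R : realType.
Implicit Types (f g : R -> R[i]).

Definition U : set R := `[0, 1[%classic.

Lemma measurable_U : measurable U. Proof. exact: measurable_itv. Qed.

(** The enumeration 0, -1, 1, -2, 2, ..., by which a sum over the integers becomes a series that is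
    measurable and integrable termwise. *)
Definition int_of_nat (n : nat) : int := if odd n then Negz n./2 else Posz n./2.
Definition nat_of_int (k : int) : nat :=
  match k with Posz n => n.*2 | Negz n => n.*2.+1 end.

Lemma int_of_natK : cancel int_of_nat nat_of_int.
Proof.
move=> n; rewrite /int_of_nat; case: ifP => on /=; last by rewrite even_halfK// on.
by rewrite odd_halfK// prednK//; case: n on.
Qed.

Lemma nat_of_intK : cancel nat_of_int int_of_nat.
Proof.
case=> n; rewrite /int_of_nat /= odd_double /=; first by rewrite doubleK.
by rewrite uphalf_double.
Qed.

Lemma esum_int_nat (a : int -> \bar R) : (forall k, 0 <= a k)%E ->
  (\esum_(k in [set: int]) a k = \sum_(0 <= n <oo) a (int_of_nat n))%E.
Proof.
move=> a0; rewrite nneseries_esumT// (@reindex_esum _ _ _ [set: nat] _ int_of_nat)//.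
split => // [m n _ _|k _]; first exact: (can_inj int_of_natK).
by exists (nat_of_int k) => //; rewrite nat_of_intK.
Qed.

Lemma measurable_esum_int (u : int -> R -> \bar R) :
  (forall k, measurable_fun setT (u k)) -> (forall k x, 0 <= u k x)%E ->
  measurable_fun setT (fun x => \esum_(k in [set: int]) u k x)%E.
Proof.
move=> mu_ u0; under eq_fun do rewrite esum_int_nat//.
exact: measurable_nneseries.
Qed.

Lemma integral_esum_int (D : set R) (u : int -> R -> \bar R) : measurable D ->
  (forall k, measurable_fun setT (u k)) -> (forall k x, 0 <= u k x)%E ->
  (\int[mu R]_(x in D) (\esum_(k in [set: int]) u k x) =
   \esum_(k in [set: int]) (\int[mu R]_(x in D) u k x))%E.
Proof.
move=> mD mu_ u0; under eq_integral do rewrite esum_int_nat//.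
rewrite integral_nneseries//; last by move=> n; apply: measurable_funTS; exact: mu_.
by rewrite [RHS]esum_int_nat// => k; exact: integral_ge0.
Qed.

Lemma bigcup_unit_intervals :
  \bigcup_n [set x : R | U (x - (int_of_nat n)%:~R)] = setT.
Proof.
apply/seteqP; split => // x _; exists (nat_of_int (Num.floor x)) => //=.
rewrite nat_of_intK /U /= in_itv /= subr_ge0 ltrBlDl.
by have /andP[-> ] := floor_itv x; rewrite rmorphD /= addrC.
Qed.

Lemma measurable_U_shift (a : R) : measurable [set x : R | U (x - a)].
Proof.
by rewrite -[X in measurable X]setTI; exact: (measurable_shift (- a)) measurable_U.
Qed.

Lemma integral_U_shift (a : R) (f : R -> \bar R) : measurable_fun setT f ->
  (forall x, 0 <= f x)%E ->
  (\int[mu R]_(x in [set x : R | U (x - a)%R]) f x = \int[mu R]_(x in U) f (x + a)%R)%E.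
Proof.
move=> mf f0; rewrite integral_mkcond [RHS]integral_mkcond.
rewrite -(integral_shift a); last 2 first.
- by apply/(measurable_restrictT _ (measurable_U_shift a)); exact: measurable_funTS.
- by move=> x; rewrite patchE; case: ifP.
apply: eq_integral => x _; rewrite !patchE; congr (if _ then _ else _).
by apply/idP/idP; rewrite !inE /= addrK.
Qed.

(** The line is the disjoint union of the integer translates of [0, 1[; each piece is moved back,
    and nonnegative sums integrate termwise. *)
Lemma integral_periodize (f : R -> \bar R) : measurable_fun setT f ->
  (forall x, 0 <= f x)%E ->
  (\int[mu R]_x f x = \int[mu R]_(x in U) (\esum_(k in [set: int]) f (x + k%:~R)%R))%E.
Proof.
move=> mf f0; rewrite -bigcup_unit_intervals ge0_integral_bigcup//; last 3 first.
- by move=> n; exact: measurable_U_shift.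
- by rewrite bigcup_unit_intervals.
- apply/trivIsetP => m n _ _ mn; apply/seteqP; split => // x [] /=.
  rewrite /U /= !in_itv /= !subr_ge0 !ltrBlDl => /andP[m1 m2] /andP[n1 n2].
  have /floor_def Em : (int_of_nat m)%:~R <= x < (int_of_nat m + 1)%:~R.
    by rewrite m1 rmorphD /=.
  have /floor_def En : (int_of_nat n)%:~R <= x < (int_of_nat n + 1)%:~R.
    by rewrite n1 rmorphD /=.
  by case/eqP: mn; apply: (can_inj int_of_natK); rewrite -Em -En.
rewrite integral_esum_int//; last 2 first.
- exact: measurable_U.
- by move=> k; exact: (measurableT_comp mf (measurable_shift _)).
rewrite esum_int_nat; last by move=> k; exact: integral_ge0.
by apply: eq_eseriesr => n _; exact: integral_U_shift.
Qed.

(** Countably many translates of a null set are null. It extends what [weight_ge0] yields on one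
    period to the line. *)
Lemma ae_periodic (P : R -> Prop) :
  (forall x (k : int), P x -> P (x + k%:~R)) ->
  {ae mu R, forall x, U x -> P x} -> {ae mu R, forall x, P x}.
Proof.
move=> perP aeP.
have : {ae mu R, forall x, forall n, U (x - (int_of_nat n)%:~R) -> P (x - (int_of_nat n)%:~R)}.
  by apply: ae_foralln => n; exact: (ae_shift (- (int_of_nat n)%:~R) aeP).
apply: aeS => x h.
have : (\bigcup_n [set x : R | U (x - (int_of_nat n)%:~R)]) x.
  by rewrite bigcup_unit_intervals.
by move=> [n _ /= /h /(perP _ (int_of_nat n))]; rewrite subrK.
Qed.

End Periodization.

(** * Characters of the circle and their orthogonality *)

Section Characters.
Variable R : realType.
Implicit Types (f g : R -> R[i]).

Lemma cisD (a b : R) : cis (a + b) = cis a * cis b.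
Proof. by apply: complex_eqP; rewrite ?ReM ?ImM /= ?cosD ?sinD//; ring. Qed.

Lemma cis0 : cis (0 : R) = 1.
Proof. by rewrite /cis cos0 sin0. Qed.

Lemma conjc_cis (a : R) : conjc (cis a) = cis (- a).
Proof. by rewrite /cis /= cosN sinN. Qed.

Lemma modulus_cis (a : R) : modulus (cis a) = 1.
Proof. by rewrite /= cos2Dsin2 sqrtr1. Qed.

Lemma cisN (a : R) : cis a * cis (- a) = 1.
Proof. by rewrite -cisD subrr cis0. Qed.

Lemma cis_2pi_nat (n : nat) : cis (2 * pi * n%:R : R) = 1.
Proof.
elim: n => [|n IH]; first by rewrite mulr0 cis0.
rewrite -[n.+1%:R]natr1 mulrDr cisD IH mul1r mulr1 mulr_natl.
by rewrite /cis cos2pi sin2pi.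
Qed.

Lemma cis_2pi_int (k : int) : cis (2 * pi * k%:~R : R) = 1.
Proof.
case: k => n; first exact: cis_2pi_nat.
by rewrite NegzE rmorphN /= mulrN -conjc_cis cis_2pi_nat conjc1.
Qed.

Lemma cmeasurable_cis (u : R -> R) : measurable_fun setT u ->
  cmeasurable (fun x => cis (u x)).
Proof.
move=> mu_; split => /=.
  by apply: (measurableT_comp _ mu_); apply: continuous_measurable_fun; exact: continuous_cos.
by apply: (measurableT_comp _ mu_); apply: continuous_measurable_fun; exact: continuous_sin.
Qed.

Definition char (k : int) (x : R) : R[i] := cis (2 * pi * k%:~R * x).

Lemma cmeasurable_char k : cmeasurable (char k).
Proof. by apply: cmeasurable_cis; exact: measurable_funM. Qed.

Lemma charD j k x : char (j + k) x = char j x * char k x.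
Proof. by rewrite /char -cisD; congr cis; rewrite rmorphD /=; ring. Qed.

Lemma conjc_char k x : conjc (char k x) = char (- k) x.
Proof. by rewrite /char conjc_cis; congr cis; rewrite rmorphN /=; ring. Qed.

Lemma modulus_char k x : modulus (char k x) = 1.
Proof. exact: modulus_cis. Qed.

Lemma char_periodic k x (j : int) : char k (x + j%:~R) = char k x.
Proof.
rewrite /char mulrDr cisD (_ : 2 * pi * k%:~R * j%:~R = 2 * pi * (k * j)%:~R); last first.
  by rewrite rmorphM /=; ring.
by rewrite cis_2pi_int mulr1.
Qed.

Lemma char0 x : char 0 x = 1.
Proof. by rewrite /char mulr0 mul0r cis0. Qed.

Lemma integral_01_derive (f F : R -> R) : continuous f ->
  (forall x : R, is_derive x 1 F (f x)) -> F 1 = F 0 ->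
  \int[mu R]_(x in @U R) f x = 0.
Proof.
move=> cf dF F10.
have cF : continuous F.
  by move=> x; apply: differentiable_continuous; apply/derivable1_diffP; exact: ex_derive.
rewrite Rintegral_itv_bndo_bndc; last first.
  apply: (@integrableS _ _ R (mu R) `[0, 1]%classic `[0, 1[%classic (EFin \o f)).
  - exact: measurable_itv.
  - exact: measurable_itv.
  - by move=> x /=; rewrite !in_itv /= => /andP[-> /ltW ->].
  - apply: continuous_compact_integrable; first exact: segment_compact.
    exact: continuous_subspaceT.
rewrite /Rintegral (@continuous_FTC2 _ f F)//.
- by rewrite F10 -EFinB subrr.
- exact: continuous_subspaceT.
- split => [x _||]; first exact: ex_derive.
  + by apply: cvg_at_right_filter; exact: cF.
  + by apply: cvg_at_left_filter; exact: cF.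
- by move=> x _; rewrite derive1E; exact: derive_val.
Qed.

Lemma is_derive_scale (g dg : R -> R) (c x : R) :
  (forall y : R, is_derive y 1 g (dg y)) -> is_derive x 1 (fun y => g (c * y)) (c * dg (c * x)).
Proof.
move=> dg_.
have d1 : is_derive x 1 (fun y : R => c * y) c.
  have := @is_deriveZ _ _ _ id c x 1 1 (is_derive_id x 1).
  by rewrite /GRing.scale /= mulr1.
by rewrite mulrC; exact: (is_derive1_comp (dg_ (c * x)) d1).
Qed.

Lemma integral_char (k : int) : k != 0 ->
  (\int[mu R]_(x in @U R) complex.Re (char k x) = 0) /\
  (\int[mu R]_(x in @U R) complex.Im (char k x) = 0).
Proof.
move=> k0; pose c : R := 2 * pi * k%:~R.
have c0 : c != 0 by rewrite !mulf_neq0// ?intr_eq0// gt_eqF// pi_gt0.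
have cc : cis c = 1 by exact: cis_2pi_int.
have cos1 : cos c = 1 by move: cc => [].
have sin1 : sin c = 0 by move: cc => [].
split.
- apply: (@integral_01_derive _ (fun x => c^-1 * sin (c * x))).
  + by move=> x /=; apply: continuous_comp; [exact: mulrl_continuous|exact: continuous_cos].
  + move=> x; have h := @is_derive_scale (@sin R) (@cos R) c x (@is_derive_sin R).
    have := @is_deriveZ _ _ _ _ c^-1 x 1 _ h.
    by rewrite /GRing.scale /= mulrA mulVf// mul1r.
  + by rewrite mulr1 mulr0 sin0 sin1.
- apply: (@integral_01_derive _ (fun x => - c^-1 * cos (c * x))).
  + by move=> x /=; apply: continuous_comp; [exact: mulrl_continuous|exact: continuous_sin].
  + move=> x; have h := @is_derive_scale (@cos R) (fun y => - sin y) c x (@is_derive_cos R).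
    have := @is_deriveZ _ _ _ _ (- c^-1) x 1 _ h.
    by rewrite /GRing.scale /= mulrN mulrNN mulKf.
  + by rewrite mulr1 mulr0 cos0 cos1.
Qed.

End Characters.
Arguments U {R}.
Arguments char {R} k x.

(** * Trigonometric polynomials and Fourier series *)

Section TrigonometricDensity.
Variable R : realType.

Lemma bernoulli_ineq (t : R) (m : nat) : -1 <= t -> 1 + m%:R * t <= (1 + t) ^+ m.
Proof.
move=> t1; elim: m => [|m IH]; first by rewrite mul0r addr0 expr0.
rewrite exprS; apply: le_trans (ler_wpM2l _ IH); last lra.
rewrite -[m.+1%:R]natr1; have := mulr_ge0 (ler0n R m) (sqr_ge0 t); nra.
Qed.

(* Stone's approximation of the indicator of [0, 1/k[ by polynomials. *)
Definition stone (k n : nat) (y : R) : R := (1 - y ^+ n) ^+ (k ^ n).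

Lemma stone_bounds k n y : 0 <= y <= 1 -> 0 <= stone k n y <= 1.
Proof.
move=> /andP[y0 y1]; have h : 0 <= 1 - y ^+ n <= 1.
  by rewrite subr_ge0 exprn_ile1//= lerBlDl lerDr exprn_ge0.
by rewrite exprn_ge0 ?exprn_ile1//; case/andP: h.
Qed.

Lemma cvg_exprn0 (y : R) : 0 <= y < 1 -> y ^+ n @[n --> \oo] --> (0 : R).
Proof.
move=> /andP[y0 y1]; have := @cvg_geometric R 1 y.
by rewrite ger0_norm// => /(_ y1); apply: cvg_trans; apply: near_eq_cvg;
  apply: nearW => n /=; rewrite mul1r.
Qed.

(** Bernoulli's inequality places the value between [1 - (k y)^n] and 1. *)
Lemma cvg_stone_lt k y : 0 <= y <= 1 -> k%:R * y < 1 ->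
  stone k n y @[n --> \oo] --> (1 : R).
Proof.
move=> y01 ky; have /andP[y0 y1] := y01.
have ky0 : 0 <= k%:R * y by rewrite mulr_ge0.
have h : (fun n => 1 - (k%:R * y) ^+ n) @ \oo --> (1 : R).
  rewrite -[X in _ --> X]subr0; apply: cvgB; first exact: cvg_cst.
  by apply: cvg_exprn0; rewrite ky0.
suff H : \forall n \near \oo, 1 - (k%:R * y) ^+ n <= stone k n y <= 1.
  by apply: (squeeze_cvgr H h); exact: cvg_cst.
apply: nearW => n; have /andP[_ ->] := stone_bounds k n y01; rewrite andbT.
rewrite /stone; apply: le_trans (bernoulli_ineq _ _); last first.
  by rewrite lerN2 exprn_ile1.
by rewrite exprMn natrX mulrN.
Qed.

(** Multiplied by [(1 + y^n)^(k^n)], which is at least [(k y)^n] by Bernoulli, the value becomes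
    [(1 - y^(2n))^(k^n) <= 1]; so it is at most [(k y)^-n]. *)
Lemma cvg_stone_gt k y : 0 <= y <= 1 -> 1 < k%:R * y ->
  stone k n y @[n --> \oo] --> (0 : R).
Proof.
move=> y01 ky; have /andP[y0 y1] := y01.
have ky0 : 0 < k%:R * y by exact: lt_trans ky.
have h : (fun n => ((k%:R * y)^-1) ^+ n) @ \oo --> (0 : R).
  by apply: cvg_exprn0; rewrite invr_ge0 ltW//= invf_lt1.
apply: (squeeze_cvgr _ (cvg_cst 0) h).
apply: nearW => n; have /andP[-> _] := stone_bounds k n y01 => /=.
rewrite exprVn -[leRHS]mul1r ler_pdivlMr ?exprn_gt0//.
have yn : 0 <= y ^+ n <= 1 by rewrite exprn_ge0//= exprn_ile1.
apply: (@le_trans _ _ (stone k n y * (1 + y ^+ n) ^+ (k ^ n))).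
  apply: ler_wpM2l; first by case/andP: (stone_bounds k n y01).
  apply: le_trans (bernoulli_ineq _ _); last by case/andP: yn; lra.
  by rewrite exprMn natrX lerDr.
rewrite /stone -exprMn -subr_sqr expr1n exprn_ile1//; case/andP: yn => a b.
  by rewrite subr_ge0 exprn_ile1.
by rewrite lerBlDl lerDr sqr_ge0.
Qed.

(** Only the modulus matters, so a unimodular factor may remove the negative powers. With
    [z = e^{-i v}] and [y = lambda (1 - cos v) / 2] one has [- (lambda / 4) (z - 1)^2 = z y], hence
    [z^n - (c (z - 1)^2)^n = z^n (1 - y^n)]. *)
Lemma stone_poly (x0 lambda : R) (k n : nat) : exists P : {poly R[i]}, forall x,
  modulus P.[char (-1) x] =
  `|stone k n (lambda * ((1 - cos (2 * pi * (x - x0))) / 2))|.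
Proof.
pose a : R[i] := cis (2 * pi * x0).
pose c : R[i] := (- (lambda / 4))%:C%C.
exists (((a%:P * 'X) ^+ n - (c%:P * (a%:P * 'X - 1) ^+ 2) ^+ n) ^+ (k ^ n)) => x.
have -> z m : (((a%:P * 'X) ^+ n - (c%:P * (a%:P * 'X - 1) ^+ 2) ^+ n) ^+ m).[z] =
    ((a * z) ^+ n - (c * (a * z - 1) ^+ 2) ^+ n) ^+ m :> R[i].
  by rewrite !(hornerE, horner_exp).
rewrite modulusX /stone normrX; congr (_ ^+ _).
set v : R := 2 * pi * (x - x0).
have -> : a * char (-1) x = cis (- v).
  by rewrite /a /char -cisD; congr cis; rewrite /v rmorphN /=; ring.
set y := lambda * _.
have -> : c * (cis (- v) - 1) ^+ 2 = cis (- v) * y%:C%C.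
  have e : cis (- v) + cis v = 2 * (cos v)%:C%C.
    by apply: complex_eqP; rewrite ?ReD ?ImD ?ReM ?ImM /= ?cosN ?sinN; ring.
  have e1 := cisN v.
  have -> : (cis (- v) - 1) ^+ 2 = cis (- v) * (2 * (cos v)%:C%C - 2).
    rewrite -e mulrBr mulrDr [cis (- v) * cis v]mulrC e1; ring.
  have -> : 2 * (cos v)%:C%C - 2 = (2 * cos v - 2)%:C%C :> R[i].
    by apply: complex_eqP; rewrite ?ReD ?ImD ?ReN ?ImN ?ReM ?ImM /=; ring.
  rewrite mulrCA /c -rmorphM; by congr (_ * _%:C%C); rewrite /y; field.
rewrite [X in _ - X]exprMn -{1}[cis (- v) ^+ n]mulr1 -mulrBr modulusM modulusX.
rewrite modulus_cis expr1n mul1r -rmorphXn -[1 in LHS](rmorph1 (real_complex R)).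
by rewrite -rmorphB modulus_real.
Qed.

Lemma two_pi_itv (v : R) : 0 <= v -> v <= 1 / 2 -> 2 * pi * v \in `[0, pi].
Proof.
move=> v0 v1; have p0 := pi_ge0 R; rewrite in_itv /= !mulr_ge0//=.
rewrite -[leRHS]mulr1 mulrAC mulrC; apply: ler_wpM2l => //; lra.
Qed.

Lemma cos_lt_near (u r : R) : 0 < r -> r <= 1 / 2 -> `|u| < r ->
  cos (2 * pi * r) < cos (2 * pi * u).
Proof.
move=> r0 r1 ur; have p0 := pi_gt0 R.
have p2 : 0 < 2 * pi :> R by rewrite mulr_gt0.
rewrite -[ltRHS]cos_norm normrM (gtr0_norm p2) ltr_cos ?ltr_pM2l//; apply: two_pi_itv => //; lra.
Qed.

(** Beyond 1/2 the cosine grows again; reflecting to [1 - |u|] measures the distance on the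
    circle. *)
Lemma cos_lt_far (u r : R) : 0 < r -> r < `|u| -> `|u| < 1 - r ->
  cos (2 * pi * u) < cos (2 * pi * r).
Proof.
move=> r0 ur ur1; have p0 := pi_gt0 R.
have p2 : 0 < 2 * pi :> R by rewrite mulr_gt0.
rewrite -[ltLHS]cos_norm normrM (gtr0_norm p2).
have [h|h] := leP `|u| (1 / 2).
  rewrite ltr_cos ?ltr_pM2l//; apply: two_pi_itv => //; lra.
have -> : 2 * pi * `|u| = - (2 * pi * (1 - `|u|)) + pi *+ 2 by rewrite -mulr_natl; ring.
rewrite cosD2pi cosN ltr_cos ?ltr_pM2l//; first lra.
- apply: two_pi_itv; lra.
- apply: two_pi_itv; lra.
Qed.

Lemma ae_neq (a : R) : {ae mu R, forall x, x <> a}.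
Proof.
exists [set a]; split; [exact: measurable_set1|exact: lebesgue_measure_set1|].
by move=> x /= /contrapT.
Qed.

(** * Positivity of a weight tested against squared moduli of polynomials *)

Section Weight.
Variable w : R -> R.
Hypothesis iw : integrableR (fun x => (w x)%:E).
Hypothesis w0 : forall x, ~ U x -> w x = 0.
Hypothesis wP : forall P : {poly R[i]},
  0 <= \int[mu R]_x (modulus P.[char (-1) x] ^+ 2 * w x).

Lemma measurable_w : measurable_fun setT w. Proof. exact: integrableR_EFin. Qed.

(** Dominated convergence along the bumps [q n], squared moduli of polynomials tending to the
    indicator of the ball. The ball has to lie in [0, 1] because the bumps only see distances on the
    circle. *)
Lemma ball_weight_ge0 (x0 r : R) : 0 < r -> r <= x0 -> x0 + r <= 1 ->
  (0 <= \int[mu R]_x (\1_(ball x0 r) x * w x)%:E)%E.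
Proof.
move=> r0 rx0 xr1; have r12 : r <= 1 / 2 by lra.
pose s x := (1 - cos (2 * pi * (x - x0))) / 2.
pose sg : R := (1 - cos (2 * pi * r)) / 2.
have sg0 : 0 < sg.
  have := @cos_lt_near 0 r r0 r12; rewrite normr0 mulr0 cos0 => /(_ r0).
  by rewrite /sg; lra.
(* The scaling gives [k * (l * s x) = s x / sg], so the threshold 1 of the Stone polynomials is met
   exactly at distance [r]; taking [k] above [sg^-1] keeps [l <= 1], hence [l * s x] in [0, 1]. *)
pose k := Num.bound sg^-1.
have kb : sg^-1 < k%:R by apply: archi_boundP; rewrite invr_ge0 ltW.
have k0 : 0 < k%:R :> R by apply: lt_trans kb; rewrite invr_gt0.
pose l := (k%:R * sg)^-1.
have l0 : 0 < l by rewrite invr_gt0 mulr_gt0.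
have l1 : l <= 1.
  have ks : 1 < k%:R * sg by rewrite -ltr_pdivrMr// div1r.
  by rewrite /l invf_le1 ?(lt_trans _ ks)// ltW.
have kl : k%:R * l = sg^-1 by rewrite /l invfM mulrA divff ?mul1r// gt_eqF.
have s01 x : 0 <= l * s x <= 1.
  have h1 := cos_geN1 (2 * pi * (x - x0)); have h2 := cos_le1 (2 * pi * (x - x0)).
  have h : 0 <= s x <= 1 by rewrite /s; apply/andP; split; lra.
  case/andP: h => h3 h4; apply/andP; split; first by rewrite mulr_ge0// ltW.
  by rewrite mulr_ile1// ltW.
pose q n x := stone k n (l * s x) ^+ 2.
have q01 n x : 0 <= q n x <= 1.
  have /andP[a b] := stone_bounds k n (s01 x).
  by rewrite /q exprn_ge0// exprn_ile1.
have qE n : exists P : {poly R[i]}, forall x, q n x = modulus P.[char (-1) x] ^+ 2.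
  have [P hP] := stone_poly x0 l k n; exists P => x.
  by rewrite hP real_normK ?num_real.
have ms : measurable_fun setT s.
  apply: measurable_funM => //; apply: measurable_funB => //.
  apply: measurableT_comp; first by apply: continuous_measurable_fun; exact: continuous_cos.
  by apply: measurable_funM => //; exact: measurable_funB.
have mq n : measurable_fun setT (q n).
  apply: measurable_funX; apply: measurable_funX; apply: measurable_funB => //.
  by apply: measurable_funX; exact: measurable_funM.
have iqw n : integrableR (fun x => (q n x * w x)%:E).
  apply: (@integrableR_le _ _ (fun x => `|w x|)); last exact: integrable_norm.
    by apply: measurable_funM => //; exact: measurable_w.
  move=> x; have /andP[a b] := q01 n x.
  by rewrite normrM (ger0_norm a) ler_piMl.
have mb : measurable_fun setT (\1_(ball x0 r) : R -> R).
  by apply: measurable_indic; exact: measurable_ball.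
(* The excluded points are the ends of the ball and their translates by one period: there
   [s x = sg], and the bumps need not converge to the indicator. *)
have lim x : x <> x0 + r -> x <> x0 - r -> x <> x0 + (1 - r) -> x <> x0 - (1 - r) ->
    (q n x * w x)%:E @[n --> \oo] --> (\1_(ball x0 r) x * w x)%:E.
  move=> d1 d2 d3 d4.
  have [xU|xU] := pselect (U x); last first.
    by rewrite w0// mulr0; under eq_fun do rewrite mulr0; exact: cvg_cst.
  apply: cvg_EFin; first exact: nearW.
  apply: cvgM; last exact: cvg_cst.
  move: xU; rewrite /U /= in_itv /= => /andP[x0' x1'].
  rewrite indicE; have [xr|xr] := ltP `|x - x0| r.
    rewrite mem_set; last by rewrite /ball /= distrC.
    have h := cos_lt_near r0 r12 xr.
    have sx : k%:R * (l * s x) < 1.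
      rewrite mulrA kl mulrC ltr_pdivrMr// mul1r.
      by rewrite /s /sg ltr_pM2r//; lra.
    rewrite /q -[X in _ --> X](expr1n _ 2) expr2; under eq_fun do rewrite expr2.
    by apply: cvgM; exact: cvg_stone_lt.
  rewrite memNset; last by rewrite /ball /= distrC; apply/negP; rewrite -leNgt.
  have xr' : r < `|x - x0|.
    rewrite lt_neqAle xr andbT; apply/eqP => e.
    have [h|h] := leP 0 (x - x0).
      by move: e; rewrite ger0_norm// => e; apply: d1; lra.
    by move: e; rewrite ltr0_norm// => e; apply: d2; lra.
  have xr2 : `|x - x0| < 1 - r.
    rewrite lt_neqAle; apply/andP; split; last by rewrite ler_norml; apply/andP; split; lra.
    apply/eqP => e.
    have [h|h] := leP 0 (x - x0).
      by move: e; rewrite ger0_norm// => e; apply: d3; lra.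
    by move: e; rewrite ltr0_norm// => e; apply: d4; lra.
  have h := cos_lt_far r0 xr' xr2.
  have sx : 1 < k%:R * (l * s x).
    rewrite mulrA kl mulrC ltr_pdivlMr// mul1r.
    by rewrite /s /sg ltr_pM2r//; lra.
  rewrite /q -[X in _ --> X](expr0n _ 2) expr2; under eq_fun do rewrite expr2.
  by apply: cvgM; exact: cvg_stone_gt.
have a12 : {ae mu R, forall x, x <> x0 + r /\ x <> x0 - r}.
  by apply: aeS2 (ae_neq (x0 + r)) (ae_neq (x0 - r)).
have a34 : {ae mu R, forall x, x <> x0 + (1 - r) /\ x <> x0 - (1 - r)}.
  by apply: aeS2 (ae_neq (x0 + (1 - r))) (ae_neq (x0 - (1 - r))).
have [|||||_ _ H] := @dominated_convergence _ _ R (mu R) setT measurableT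
    (fun n x => (q n x * w x)%:E) (fun x => (\1_(ball x0 r) x * w x)%:E)
    (fun x => `|w x|%:E).
- by move=> n; exact: (measurable_int _ (iqw n)).
- by apply/measurable_EFinP; apply: measurable_funM => //; exact: measurable_w.
- by apply: aeS2 a12 a34 => x [x1 x2] [x3 x4] _; exact: lim.
- exact: integrable_norm.
- apply: aeT => x n _; rewrite abse_EFin lee_fin normrM.
  by have /andP[a b] := q01 n x; rewrite (ger0_norm a) ler_piMl.
apply: (@cvge_ge _ _ _ _ _ _ _ _ H).
apply: nearW => n /=.
have := integrable_fin_num measurableT (iqw n).
have [P hP] := qE n; have := wP P.
rewrite /Rintegral; under eq_integral do rewrite -hP.
by case: (integral _ _ _).
Qed.

(* The bumps |P|^2 tend boundedly to the indicator of any ball, and Lebesgue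
   differentiation recovers [w] from its integrals over balls. *)
Lemma weight_ge0 : {ae mu R, forall x, 0 <= w x}.
Proof.
have lw : locally_integrable setT w.
  split; [exact: measurable_w|exact: openT|move=> K _ cK].
  move/integrableP : iw => [_]; apply: le_lt_trans.
  apply: ge0_subset_integral => //; first exact: compact_measurable.
  by apply/measurable_EFinP; apply: measurableT_comp => //; exact: measurable_w.
have := lebesgue_differentiation lw.
apply: aeS2 (ae_neq 0) => x x0 lx.
rewrite leNgt; apply/negP => wx.
have [xU|xU] := pselect (U x); last by move: wx; rewrite w0// ltxx.
move: xU; rewrite /U /= in_itv /= => /andP[x0' x1'].
have {}x0' : 0 < x by rewrite lt_neqAle x0' andbT; apply/eqP => e; exact: x0.
have w2 : 0 < - w x by rewrite oppr_gt0.
(* At a Lebesgue point with [w x < 0] the mean of [|w - w x|] over small balls drops below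
   [- w x]. *)
have [e /= e0 he] : \forall r \near (0 : R)^'+, (davg w x r < (- w x)%:E)%E.
  move: lx => /(_ [set y | (y < (- w x)%:E)%E]); apply.
  apply: open_nbhs_nbhs; split; first exact: open_ereal_lt_ereal.
  by rewrite /= lte_fin.
pose r := Num.min (e / 2) (Num.min x (1 - x)).
have r0 : 0 < r.
  by rewrite !lt_min divr_gt0//= x0' subr_gt0.
have rx : r <= x by rewrite /r !ge_min lexx orbT.
have rx1 : x + r <= 1.
  by rewrite -lerBrDl /r !ge_min lexx !orbT.
have re : r < e.
  by apply: (@le_lt_trans _ _ (e / 2)); [rewrite /r !ge_min lexx|rewrite ltr_pdivrMr// ltr_pMr// ltr1n].
have := he r; rewrite /ball /= sub0r normrN (gtr0_norm r0) => /(_ re r0).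
have bw := ball_weight_ge0 r0 rx rx1.
have mB : measurable (ball x r) by exact: measurable_ball.
have iwB : (mu R).-integrable (ball x r) (EFin \o w).
  by apply: (@integrableS _ _ R (mu R) setT (ball x r)).
have muB : mu R (ball x r) = (r *+ 2)%:E by rewrite lebesgue_measure_ball ?ltW.
have r2 : 0 < r *+ 2 by rewrite mulrn_wgt0.
rewrite /davg /iavg muB inver gt_eqF//.
have -> : (\int[mu R]_(y in ball x r) `|((center (w x) \o w) y)%:E| =
           \int[mu R]_(y in ball x r) `|(w y - w x)%:E|)%E by [].
have icst : (mu R).-integrable (ball x r) (EFin \o cst (w x)).
  apply: measurable_bounded_integrable => //; first by apply: (@le_lt_trans _ _ (r *+ 2)%:E); [rewrite -muB|exact: ltry].
  by exists `|w x|; split; [exact: num_real|move=> M hM y _ /=; exact: ltW].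
have c2 : (\int[mu R]_(y in ball x r) (w x)%:E = (w x * (r *+ 2))%:E)%E.
  by rewrite integral_cst// EFinM; congr (_ * _)%E.
have h1 : (\int[mu R]_(y in ball x r) (w y - w x)%:E <=
           \int[mu R]_(y in ball x r) `|(w y - w x)%:E|)%E.
  apply: le_integral => //.
  - by under eq_fun do rewrite EFinB; exact: integrableB.
  - by apply: integrable_abse; under eq_fun do rewrite EFinB; exact: integrableB.
  - by move=> y _; rewrite abse_EFin lee_fin ler_norm.
(* A nonnegative integral of [w] over the ball makes that mean at least [- w x], a contradiction. *)
have h2 : ((- w x * (r *+ 2))%:E <= \int[mu R]_(y in ball x r) (w y - w x)%:E)%E.
  under eq_integral do rewrite EFinB.
  rewrite integralB_EFin// c2 mulNr EFinN.
  rewrite leeDr// integral_mkcond.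
  apply: le_trans bw _; rewrite le_eqVlt; apply/orP; left; apply/eqP.
  apply: eq_integral => y _; rewrite patchE indicE.
  by case: ifP => h; rewrite ?mul1r ?mul0r.
have h3 := le_trans h2 h1.
rewrite ltNge => /negP; apply.
have r3 : (0 <= ((r *+ 2)^-1)%:E :> \bar R)%E by rewrite lee_fin invr_ge0 ltW.
have := lee_wpmul2l r3 h3.
by rewrite -EFinM mulrCA mulVf ?gt_eqF// mulr1.
Qed.

End Weight.
End TrigonometricDensity.

(** * Fourier series on the circle *)

Section CircleFourier.
Variable R : realType.
Implicit Types (f g : R -> R[i]) (c : int -> R[i]).

(* The Fourier multiplier of the translation by [k]; hence the sign. *)
Definition chi (k : int) (x : R) : R[i] := char (- k) x.

(** The Hilbert space of the circle is realized inside L2 of the line, as the functions vanishing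
    off [0, 1[, so that norms, inner products and completeness carry over. *)
Definition circ (k : int) (x : R) : R[i] := (\1_(@U R) x)%:C%C * char k x.

Lemma conjc_indicU x : conjc ((\1_(@U R) x)%:C%C : R[i]) = (\1_(@U R) x)%:C%C.
Proof. exact: conjc_real. Qed.

Lemma measurable_indicU : measurable_fun setT (\1_(@U R) : R -> R).
Proof. by apply: measurable_indic; exact: measurable_U. Qed.

Lemma integrable_indicU : integrableR (fun x => (\1_(@U R) x)%:E).
Proof. exact: integrable_indic_itv. Qed.

Lemma indicU_ge0 x : 0 <= (\1_(@U R) x : R).
Proof. by rewrite indicE. Qed.

Lemma sqr_indicU x : (\1_(@U R) x : R) ^+ 2 = \1_(@U R) x.
Proof. by rewrite indicE; case: (x \in _); rewrite ?expr1n ?expr0n. Qed.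

Lemma integral_indicU : \int[mu R]_x (\1_(@U R) x) = 1.
Proof.
rewrite /Rintegral integral_indic//; last exact: measurable_U.
have h : mu R U = 1%E by rewrite lebesgue_measure_itv /= lte_fin ltr01 -EFinB subr0.
by rewrite setIT; exact: (congr1 fine h).
Qed.

Lemma cmeasurable_circ k : cmeasurable (circ k).
Proof.
apply: cmeasurableM; last exact: cmeasurable_char.
by apply: cmeasurable_real; exact: measurable_indicU.
Qed.

Lemma L2_circ k : L2 (circ k).
Proof.
apply: (@L2_le _ _ (\1_(@U R))).
- exact: cmeasurable_circ.
- by move=> x; rewrite modulusM modulus_char modulus_real mulr1 real_normK ?num_real// sqr_indicU.
- exact: integrable_indicU.
Qed.

Lemma Rintegral_indicU (u : R -> R) :
  \int[mu R]_x (\1_(@U R) x * u x) = \int[mu R]_(x in @U R) u x.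
Proof.
rewrite [RHS]Rintegral_mkcond; apply: eq_Rintegral => x _.
by rewrite patchE indicE; case: (x \in _); rewrite ?mul1r ?mul0r.
Qed.

Lemma cintegral_circ k : cintegral (circ k) = (k == 0)%:R.
Proof.
have [->|k0] := eqVneq k 0.
  rewrite (_ : circ 0 = fun x => (\1_(@U R) x)%:C%C); last first.
    by apply/funext => x; rewrite /circ char0 mulr1.
  apply: complex_eqP => /=; first exact: integral_indicU.
  by rewrite /Rintegral integral0.
have [h1 h2] := @integral_char R k k0.
apply: complex_eqP => /=.
  rewrite -[RHS]h1 -Rintegral_indicU; apply: eq_Rintegral => x _.
  by rewrite mul0r subr0.
rewrite -[RHS]h2 -Rintegral_indicU; apply: eq_Rintegral => x _.
by rewrite mul0r addr0.
Qed.

Lemma inner_circ j k : inner (circ j) (circ k) = (j == k)%:R.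
Proof.
rewrite -subr_eq0 -cintegral_circ /inner; congr cintegral; apply/funext => x.
rewrite /circ conjcM conjc_indicU conjc_char mulrACA -charD -rmorphM.
by rewrite -expr2 sqr_indicU.
Qed.

Lemma nrm_lincomb_circ (A : {fset int}) c :
  nrm (lincomb A c circ) ^+ 2 = \sum_(k <- A) modulus (c k) ^+ 2.
Proof.
apply: complexI; rewrite -inner_self; last by apply: L2_lincomb; exact: L2_circ.
rewrite inner_lincombl; [|exact: L2_circ|by apply: L2_lincomb; exact: L2_circ].
rewrite rmorph_sum big_seq [RHS]big_seq; apply: eq_bigr => k kA.
rewrite inner_lincombr; [|exact: L2_circ|exact: L2_circ].
rewrite (bigD1_seq k)//=.
rewrite big1 ?addr0; last first.
  by move=> j jk; rewrite inner_circ eq_sym (negbTE jk) mulr0.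
by rewrite inner_circ eqxx mulr1 mulc_conjc.
Qed.

Lemma riesz_bound_circ : riesz_bound circ 1.
Proof. by split; [exact: L2_circ|move=> A c; rewrite nrm_lincomb_circ mul1r]. Qed.

Lemma lincomb_circ (A : {fset int}) c x :
  lincomb A c circ x = (\1_(@U R) x)%:C%C * lincomb A c char x.
Proof. by rewrite /lincomb mulr_sumr; apply: eq_bigr => k _; rewrite /circ mulrCA. Qed.

Lemma big_seq_fset (V : nmodType) (s : seq int) (F : int -> V) : uniq s ->
  \sum_(k <- seq_fset tt s) F k = \sum_(k <- s) F k.
Proof.
move=> us; rewrite (perm_big (undup s)); last exact: seq_fset_perm.
by rewrite undup_id.
Qed.

Lemma lincomb_charN (A : {fset int}) c : exists (B : {fset int}) d,
  lincomb A c chi = lincomb B d char /\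
  \sum_(k <- A) modulus (c k) ^+ 2 = \sum_(k <- B) modulus (d k) ^+ 2.
Proof.
have uA : uniq [seq - k | k <- enum_fset A].
  by rewrite map_inj_uniq ?fset_uniq//; exact: oppr_inj.
exists (seq_fset tt [seq - k | k <- enum_fset A]), (fun k => c (- k)).
split.
  apply/funext => x; rewrite /lincomb big_seq_fset// big_map.
  by apply: eq_bigr => k _; rewrite opprK.
rewrite big_seq_fset// big_map.
by apply: eq_bigr => k _; rewrite opprK.
Qed.

Lemma integral_trig_sqr (A : {fset int}) c :
  \int[mu R]_x (\1_(@U R) x * modulus (lincomb A c chi x) ^+ 2) =
  \sum_(k <- A) modulus (c k) ^+ 2.
Proof.
have [B [d [-> ->]]] := lincomb_charN A c.
rewrite -nrm_lincomb_circ nrm_sqr; apply: eq_Rintegral => x _.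
rewrite lincomb_circ modulusM modulus_real exprMn real_normK ?num_real//.
by rewrite sqr_indicU.
Qed.

(** [chi k] is the [k]-th power of [char (-1)]; the test functions of [weight_ge0] are thus
    multipliers of finite combinations of translates. *)
Lemma poly_chi (P : {poly R[i]}) : exists (A : {fset int}) c,
  forall x, P.[char (-1) x] = lincomb A c chi x.
Proof.
have uA : uniq [seq Posz k | k <- iota 0 (size P)].
  by rewrite map_inj_uniq ?iota_uniq// => m n [].
exists (seq_fset tt [seq Posz k | k <- iota 0 (size P)]), (fun k => P`_(absz k)) => x.
rewrite /lincomb big_seq_fset// big_map.
rewrite horner_coef -[X in iota 0 X]subn0 -/(index_iota _ _) big_mkord.
apply: eq_bigr => k _; congr (_ * _); rewrite /chi /=.
elim: (k : nat) => [|n IH]; first by rewrite expr0 char0.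
rewrite exprS IH -charD; congr (char _ _).
by rewrite -opprD -PoszD.
Qed.

Lemma cmeasurable_trig (A : {fset int}) c : cmeasurable (lincomb A c chi).
Proof.
rewrite /lincomb; apply: cmeasurable_sum => k; apply: cmeasurableZ.
exact: cmeasurable_char.
Qed.

Lemma trig_periodic (A : {fset int}) c x (j : int) :
  lincomb A c chi (x + j%:~R) = lincomb A c chi x.
Proof. by apply: eq_bigr => k _; rewrite /chi char_periodic. Qed.

Lemma trig_bounded (A : {fset int}) c x :
  modulus (lincomb A c chi x) <= \sum_(k <- A) modulus (c k).
Proof.
apply: le_trans (modulus_sum _ _) _; apply: ler_sum => k _.
by rewrite modulusM modulus_char mulr1.
Qed.

Lemma cintegrable_char k g : cintegrable g -> cintegrable (fun x => char k x * g x).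
Proof.
move=> ig; apply: (@cintegrable_le _ _ (fun x => modulus (g x))).
- by apply: cmeasurableM; [exact: cmeasurable_char|exact: cintegrable_measurable].
- by move=> x; rewrite modulusM modulus_char mul1r.
- exact: cintegrable_modulus.
Qed.

Lemma cintegrable_circ k : cintegrable (circ k).
Proof.
apply: (@cintegrable_le _ _ (\1_U)).
- exact: cmeasurable_circ.
- by move=> x; rewrite modulusM modulus_char mulr1 modulus_real ger0_norm ?indicU_ge0.
- exact: integrable_indicU.
Qed.

(** Each |P|^2 is a trigonometric polynomial, so its integral against [g] vanishes. Hence
    [weight_ge0] applies to the real part of [a * g] for [a] equal to 1, -1, i and -i, and both
    parts of [g] vanish. *)
Lemma circle_uniqueness g : cintegrable g -> (forall x, ~ U x -> g x = 0) ->
  (forall k, cintegral (fun x => char k x * g x) = 0) ->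
  {ae mu R, forall x, g x = 0}.
Proof.
move=> ig g0 gk.
have E (P : {poly R[i]}) : exists (A : {fset int}) c, forall x,
    (modulus P.[char (-1) x] ^+ 2)%:C%C * g x =
    \sum_(j <- A) \sum_(k <- A) (c j * conjc (c k)) * (char (k - j) x * g x).
  have [A [c hP]] := poly_chi P; exists A, c => x.
  rewrite hP -mulc_conjc /lincomb conjc_sum !mulr_suml; apply: eq_bigr => j _.
  rewrite mulr_sumr mulr_suml; apply: eq_bigr => k _.
  by rewrite conjcM /chi conjc_char opprK charD; ring.
have key (P : {poly R[i]}) :
    cintegrable (fun x => (modulus P.[char (-1) x] ^+ 2)%:C%C * g x) /\
    cintegral (fun x => (modulus P.[char (-1) x] ^+ 2)%:C%C * g x) = 0.
  have [A [c hE]] := E P; under eq_fun do rewrite hE.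
  have i1 j k : cintegrable (fun x => (c j * conjc (c k)) * (char (k - j) x * g x)).
    by apply: cintegrableZ; exact: cintegrable_char.
  have i2 j := @cintegral_sum _ _ (enum_fset A) _ (i1 j).
  have [i3 ->] := @cintegral_sum _ _ (enum_fset A) _ (fun j => (i2 j).1).
  split => //; rewrite big1// => j _; rewrite (i2 j).2 big1// => k _.
  by rewrite cintegralZ ?gk ?mulr0//; exact: cintegrable_char.
have pos (a : R[i]) : {ae mu R, forall x, 0 <= complex.Re (a * g x)}.
  apply: weight_ge0; first exact: (cintegrableZ a ig).1.
    by move=> x /g0 ->; rewrite mulr0.
  move=> P; have [iP zP] := key P.
  have -> : \int[mu R]_x (modulus P.[char (-1) x] ^+ 2 * complex.Re (a * g x)) =
      complex.Re (cintegral (fun x => a * ((modulus P.[char (-1) x] ^+ 2)%:C%C * g x))).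
    apply: eq_Rintegral => x _; rewrite mulrCA [in RHS]ReM /=; ring.
  by rewrite cintegralZ// zP mulr0.
have h1 := pos 1; have h2 := pos (-1).
have h3 := pos (Complex 0 1); have h4 := pos (Complex 0 (-1)).
apply: aeS2 (aeS2 _ h1 h2) (aeS2 _ h3 h4); last 2 first.
- by move=> x a b; exact: (conj a b).
- by move=> x a b; exact: (conj a b).
move=> x /= [a1 a2] [a3 a4].
move: a1 a2 a3 a4; rewrite !ReM /= => a1 a2 a3 a4.
apply: complex_eqP => /=; apply/eqP; rewrite eq_le; apply/andP; split; lra.
Qed.

Lemma circle_L2_uniqueness g : L2 g -> (forall x, ~ U x -> g x = 0) ->
  (forall k, inner g (circ k) = 0) -> {ae mu R, forall x, g x = 0}.
Proof.
move=> lg g0 gk.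
have gU x : (\1_(@U R) x)%:C%C * g x = g x.
  rewrite indicE; have [xU|xU] := pselect (U x); first by rewrite mem_set// mul1r.
  by rewrite (g0 _ xU) mulr0.
have gE k : (fun x => char k x * g x) = (fun x => g x * conjc (circ (- k) x)).
  apply/funext => x; rewrite /circ conjcM conjc_indicU conjc_char opprK.
  by rewrite mulrA [g x * _]mulrC gU mulrC.
apply: circle_uniqueness => //; last by move=> k; rewrite gE; exact: gk.
have -> : g = fun x => char 0 x * g x by apply/funext => x; rewrite char0 mul1r.
by rewrite gE; apply: L2M_cintegrable => //; exact: L2_circ.
Qed.

(** Bessel's inequality provides the sum [s] of the Fourier series; it has the coefficients of [g],
    and uniqueness identifies the two. *)
Lemma circle_parseval g : L2 g -> (forall x, ~ U x -> g x = 0) ->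
  net_limit circ (fun k => inner g (circ k)) g /\
  (nrm g ^+ 2)%:E = (\esum_(k in [set: int]) (modulus (inner g (circ k)) ^+ 2)%:E)%E.
Proof.
move=> lg g0; set c := fun k => inner g (circ k).
have cM : forall A : {fset int}, \sum_(k <- A) modulus (c k) ^+ 2 <= nrm g ^+ 2.
  move=> A; rewrite -[leRHS]mul1r.
  exact: ((riesz_boundP ler01 L2_circ).1 riesz_bound_circ g lg A).
have [s [ls hs]] := synthesis_exists ler01 riesz_bound_circ cM.
have cs k : inner s (circ k) = c k.
  apply/eqP; rewrite -subr_eq0; apply/eqP; apply: modulus_eq0.
  apply/eqP; rewrite eq_le modulus_ge0 andbT; apply: le0_all_eps => e e0.
  have [A0 hA] := net_limit_inner L2_circ ls (L2_circ k) hs e0.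
  have := hA (A0 `|` [fset k])%fset (fsubsetUl _ _).
  have kA : k \in (A0 `|` [fset k])%fset by rewrite !inE eqxx orbT.
  rewrite (bigD1_seq k kA (fset_uniq _)) /= big1 ?addr0.
    by rewrite inner_circ eqxx mulr1.
  by move=> j jk; rewrite inner_circ (negbTE jk) mulr0.
(* An L2 limit is only known up to a null set, whereas uniqueness asks for vanishing at every point
   off [0, 1[. *)
pose s' x := (\1_(@U R) x)%:C%C * s x.
have s's : forall x, modulus (s' x) <= 1 * modulus (s x).
  move=> x; rewrite /s' modulusM modulus_real ler_wpM2r ?modulus_ge0//.
  by rewrite indicE; case: (_ \in _); rewrite ?normr0 ?normr1.
have ms' : cmeasurable s'.
  apply: cmeasurableM; last exact: L2_measurable.
  by apply: cmeasurable_real; exact: measurable_indicU.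
have [ls' _] := L2_le_nrm ler01 ls ms' (aeT s's).
have cs' k : inner s' (circ k) = c k.
  rewrite -cs /inner; congr cintegral; apply/funext => x.
  rewrite /circ conjcM conjc_indicU /s' mulrACA -rmorphM -expr2 sqr_indicU.
  by rewrite [in RHS]mulrCA mulrA.
have gs : {ae mu R, forall x, (g \- s') x = 0}.
  apply: circle_L2_uniqueness; first exact: L2B.
    by move=> x xU /=; rewrite g0// /s' indicE memNset// mul0r subr0.
  by move=> k; rewrite innerBl//; [rewrite cs' subrr|exact: L2_circ].
have lim : net_limit circ c g.
  move=> e /hs [A0 hA]; exists A0 => A /hA; apply: le_trans.
  have lA : L2 (lincomb A c circ) by apply: L2_lincomb; exact: L2_circ.
  rewrite (@ae_nrm _ (g \- lincomb A c circ) (s' \- lincomb A c circ)).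
  - rewrite -[leRHS]mul1r.
    apply: (L2_le_nrm ler01 (L2B ls lA) _ _).2.
      by apply: cmeasurableB => //; exact: L2_measurable.
    apply: aeT => x /=; rewrite lincomb_circ /s' mul1r.
    rewrite indicE; case: (_ \in _); rewrite ?mul1r// !mul0r subr0 modulus0.
    exact: modulus_ge0.
  - by apply: cmeasurableB; exact: L2_measurable.
  - by apply: cmeasurableB => //; exact: L2_measurable.
  - by apply: aeS gs => x /= /eqP; rewrite subr_eq0 => /eqP ->.
split => //; apply/eqP; rewrite eq_le; apply/andP; split; last first.
  by apply/esum_le_sumP => // k; rewrite sqr_ge0.
have Sle : (\esum_(k in [set: int]) (modulus (c k) ^+ 2)%:E <= (nrm g ^+ 2)%:E)%E.
  by apply/esum_le_sumP => // k; rewrite sqr_ge0.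
have Sge : (0 <= \esum_(k in [set: int]) (modulus (c k) ^+ 2)%:E :> \bar R)%E.
  by apply: esum_ge0 => k _; rewrite lee_fin sqr_ge0.
have Sfin : (\esum_(k in [set: int]) (modulus (c k) ^+ 2)%:E)%E \is a fin_num.
  by rewrite ge0_fin_numE//; apply: le_lt_trans Sle _; rewrite ltry.
rewrite -(fineK Sfin) lee_fin -[leRHS]mul1r.
apply: (net_limit_nrm ler01 riesz_bound_circ lg _ lim).
apply/esum_le_sumP; first by move=> k; rewrite sqr_ge0.
by rewrite fineK.
Qed.

End CircleFourier.
Arguments chi {R} k x.
Arguments circ {R} k x.

(** * The Fourier transform on L2 *)

Section Plancherel.
Variable R : realType.
Implicit Types (f g : R -> R[i]) (c : int -> R[i]).

Lemma L1P f : Lp 1%:E f <-> cintegrable f.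
Proof.
have E : Lpnorm 1%:E f = (\int[mu R]_x (modulus (f x))%:E)%E.
  rewrite /Lpnorm Lnorm1; apply: eq_integral => x _.
  by rewrite abse_EFin ger0_norm ?modulus_ge0.
rewrite /Lp /= E; split=> [[mf h]|if_].
  apply: (@cintegrable_le _ _ (fun x => modulus (f x))) => //.
  apply/integrableP; split; first by apply/measurable_EFinP; exact: measurable_modulus.
  by under eq_integral do rewrite abse_EFin ger0_norm ?modulus_ge0//.
split; first exact: cintegrable_measurable.
by apply: integrable_lty => //; exact: cintegrable_modulus.
Qed.

Definition kernel (xi x : R) : R[i] := cis (- (2 * pi * x * xi)).

Lemma cmeasurable_kernel xi : cmeasurable (kernel xi).
Proof.
apply: cmeasurable_cis; apply: measurable_funN.
by apply: measurable_funM => //; exact: measurable_funM.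
Qed.

Lemma cintegrable_kernel f xi : cintegrable f ->
  cintegrable (fun x => f x * kernel xi x).
Proof.
move=> if_; apply: (@cintegrable_le _ _ (fun x => modulus (f x))).
- by apply: cmeasurableM; [exact: cintegrable_measurable|exact: cmeasurable_kernel].
- by move=> x; rewrite modulusM modulus_cis mulr1.
- exact: cintegrable_modulus.
Qed.

Lemma fourierL1E f xi : fourierL1 f xi = cintegral (fun x => f x * kernel xi x).
Proof. by []. Qed.

Lemma fourierL1D f g xi : cintegrable f -> cintegrable g ->
  fourierL1 (f \+ g) xi = fourierL1 f xi + fourierL1 g xi.
Proof.
move=> if_ ig; rewrite !fourierL1E -cintegralD; try exact: cintegrable_kernel.
by congr cintegral; apply/funext => x /=; rewrite mulrDl.
Qed.

Lemma fourierL1Z a f xi : cintegrable f ->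
  fourierL1 (fun x => a * f x) xi = a * fourierL1 f xi.
Proof.
move=> if_; rewrite !fourierL1E -cintegralZ; last exact: cintegrable_kernel.
by congr cintegral; apply/funext => x /=; rewrite mulrA.
Qed.

Lemma fourierL1B f g xi : cintegrable f -> cintegrable g ->
  fourierL1 (f \- g) xi = fourierL1 f xi - fourierL1 g xi.
Proof.
move=> if_ ig; have -> : f \- g = f \+ (fun x => -1 * g x).
  by apply/funext => x /=; rewrite mulN1r.
by rewrite fourierL1D ?fourierL1Z ?mulN1r//; exact: cintegrableZ.
Qed.

Lemma fourierL1_translates f k xi : cintegrable f ->
  fourierL1 (translates f k) xi = chi k xi * fourierL1 f xi.
Proof.
move=> if_; rewrite !fourierL1E -(cintegral_shift k%:~R); last first.
  apply: cintegrable_measurable; apply: cintegrable_kernel.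
  exact: (cintegrable_shift (- k%:~R) if_).
rewrite -cintegralZ; last exact: cintegrable_kernel.
congr cintegral; apply/funext => x; rewrite /translates /translate addrK.
rewrite mulrCA; congr (_ * _); rewrite /kernel /chi /char -cisD.
by congr cis; rewrite rmorphN /=; ring.
Qed.

Lemma continuous_kernel_Re (a b x : R) :
  continuous (fun xi : R => a * cos (- (2 * pi * x * xi)) - b * sin (- (2 * pi * x * xi))).
Proof.
move=> xi; apply: cvgB; apply: cvgM; try exact: cvg_cst.
  apply: continuous_comp; last exact: continuous_cos.
  by apply: cvgN; apply: cvgM; [exact: cvg_cst|exact: cvg_id].
apply: continuous_comp; last exact: continuous_sin.
by apply: cvgN; apply: cvgM; [exact: cvg_cst|exact: cvg_id].
Qed.

Lemma continuous_param_integral (h : R -> R -> R) (v : R -> R) :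
  (forall xi, measurable_fun setT (h xi)) -> (forall x, continuous (h^~ x)) ->
  (forall xi x, `|h xi x| <= v x) -> integrableR (fun x => (v x)%:E) ->
  continuous (fun xi => \int[mu R]_x h xi x).
Proof.
move=> mh ch hv iv xi.
apply: (@continuity_under_integral R _ _ (mu R) h setT measurableT (xi - 1) (xi + 1) _ _ v iv).
- by move=> l _; exact: integrableR_le (mh l) (hv l) iv.
- by apply: aeT => x _ l _; exact: ch.
- by move=> l _; apply: aeT => x _; exact: hv.
- by rewrite inE /= in_itv /=; apply/andP; split; lra.
Qed.

(** Dominated by [|f|], the integral is continuous in the frequency, hence measurable. *)
Lemma cmeasurable_fourierL1 f : cintegrable f -> cmeasurable (fourierL1 f).
Proof.
move=> if_; have mf := cintegrable_measurable if_.
have mk xi := cmeasurableM mf (cmeasurable_kernel xi).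
have iv := cintegrable_modulus if_.
split; apply: continuous_measurable_fun;
  apply: (@continuous_param_integral _ (fun x => modulus (f x))) iv.
- by move=> xi; exact: (mk xi).1.
- move=> x; under eq_fun do rewrite ReM; exact: continuous_kernel_Re.
- move=> xi x; apply: le_trans (abs_Re_modulus _) _.
  by rewrite modulusM modulus_cis mulr1.
- by move=> xi; exact: (mk xi).2.
- move=> x; under eq_fun do rewrite ImM.
  have := @continuous_kernel_Re (complex.Im (f x)) (- complex.Re (f x)) x.
  rewrite (_ : (fun xi : R => _) = fun xi : R => complex.Re (f x) *
     complex.Im (kernel xi x) + complex.Im (f x) * complex.Re (kernel xi x))//.
  by apply/funext => xi /=; ring.
- move=> xi x; apply: le_trans (abs_Im_modulus _) _.
  by rewrite modulusM modulus_cis mulr1.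
Qed.

Lemma indicU_floor (k : int) x : \1_(@U R) (x - k%:~R) = (Num.floor x == k)%:R :> R.
Proof.
rewrite floor_eq indicE; congr (nat_of_bool _)%:R.
apply/idP/idP; rewrite inE /U /= in_itv /= subr_ge0 ltrBlDl rmorphD /= => /andP[a b];
  by apply/andP.
Qed.

Definition slice f (j : int) (x : R) : R[i] := (\1_(@U R) x)%:C%C * f (x + j%:~R).

Lemma L2_slice f j : L2 f -> L2 (slice f j).
Proof.
move=> lf; have [l1 _] := L2_shift j%:~R lf.
apply: (L2_le_nrm ler01 l1 _ _).1.
  apply: cmeasurableM; last exact: L2_measurable.
  by apply: cmeasurable_real; exact: measurable_indicU.
apply: aeT => x; rewrite /slice modulusM modulus_real ler_wpM2r ?modulus_ge0//.
by rewrite indicE; case: (_ \in _); rewrite ?normr0 ?normr1.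
Qed.

Lemma slice_out f j x : ~ U x -> slice f j x = 0.
Proof. by move=> xU; rewrite /slice indicE memNset// mul0r. Qed.

Lemma slice_shift f j x : slice f j (x - j%:~R) = (Num.floor x == j)%:R%:C%C * f x.
Proof. by rewrite /slice indicU_floor subrK. Qed.

Lemma L2_slice_cintegrable f j : L2 f -> cintegrable (slice f j).
Proof.
move=> lf; have -> : slice f j = fun x => slice f j x * conjc (circ 0 x).
  apply/funext => x; rewrite /circ char0 mulr1 conjc_indicU /slice mulrAC -rmorphM.
  by rewrite -expr2 sqr_indicU.
by apply: L2M_cintegrable; [exact: L2_slice|exact: L2_circ].
Qed.

Section CompactSupport.
Variables (f : R -> R[i]) (A : {fset int}).
Hypotheses (lf : L2 f) (fA : forall x, Num.floor x \notin A -> f x = 0).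

Lemma slices_sum x : f x = \sum_(j <- A) slice f j (x - j%:~R).
Proof.
under eq_bigr do rewrite slice_shift.
have [xA|xA] := boolP (Num.floor x \in A); last first.
  by rewrite big1 fA// => j _; rewrite mulr0.
rewrite (bigD1_seq _ xA (fset_uniq _)) /= eqxx mul1r big1 ?addr0// => j.
by rewrite eq_sym => /negbTE ->; rewrite mul0r.
Qed.

Lemma slices_nrm : nrm f ^+ 2 = \sum_(j <- A) nrm (slice f j) ^+ 2.
Proof.
apply: EFin_inj; rewrite nrm_sqrE// -sumEFin.
transitivity (\sum_(j <- A) \int[mu R]_x (modulus (slice f j (x - j%:~R)) ^+ 2)%:E)%E.
  rewrite -ge0_integral_sum//; last 2 first.
  - move=> j; apply: emeasurable_modulus2.
    by apply: (cmeasurable_shift (- j%:~R)); apply: L2_measurable; exact: L2_slice.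
  - by move=> j x _; rewrite lee_fin sqr_ge0.
  apply: eq_integral => x _; rewrite sumEFin; congr EFin.
  under eq_bigr do rewrite slice_shift.
  have [xA|xA] := boolP (Num.floor x \in A); last first.
    by rewrite fA// modulus0 big1 ?expr0n// => j _; rewrite mulr0 modulus0 expr0n.
  rewrite (bigD1_seq _ xA (fset_uniq _)) /= eqxx mul1r big1 ?addr0// => j.
  by rewrite eq_sym => /negbTE ->; rewrite mul0r modulus0 expr0n.
apply: eq_bigr => j _; rewrite nrm_sqrE; last exact: L2_slice.
apply: (@integral_shift R (- j%:~R) (fun x => (modulus (slice f j x) ^+ 2)%:E)).
  by apply: emeasurable_modulus2; apply: L2_measurable; exact: L2_slice.
by move=> x; rewrite lee_fin sqr_ge0.
Qed.

Lemma compact_cintegrable : cintegrable f.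
Proof.
have -> : f = fun x => \sum_(j <- A) slice f j (x - j%:~R).
  by apply/funext => x; exact: slices_sum.
apply: (@cintegral_sum _ _ _ (fun j x => slice f j (x - j%:~R)) _).1 => j.
by apply: (cintegrable_shift (- j%:~R)); exact: L2_slice_cintegrable.
Qed.

(* The Zak transform of [f], up to a unimodular factor in [x]. *)
Definition zak (xi x : R) : R[i] := \sum_(j <- A) chi j xi * slice f j x.

Lemma zakE xi : zak xi = lincomb A (chi^~ xi) (slice f).
Proof. by []. Qed.

Lemma L2_zak xi : L2 (zak xi).
Proof. by rewrite zakE; apply: L2_lincomb => j; exact: L2_slice. Qed.

(** Moving the slice over [j, j + 1[ back to [0, 1[ multiplies the kernel by
    [e^{-2 pi i j (xi + k)} = chi j xi], as [j k] is an integer; the remaining [e^{-2 pi i k x}]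
    makes the integral a Fourier coefficient in [x]. *)
Lemma fourierL1_zak xi k :
  fourierL1 f (xi + k%:~R) = inner (fun x => kernel xi x * zak xi x) (circ k).
Proof.
have E : fourierL1 f (xi + k%:~R) = \sum_(j <- A)
    fourierL1 (fun x => slice f j (x - j%:~R)) (xi + k%:~R).
  have i1 j : cintegrable (fun x => slice f j (x - j%:~R)).
    by apply: (cintegrable_shift (- j%:~R)); exact: L2_slice_cintegrable.
  have := @cintegral_sum _ _ (enum_fset A)
     (fun j x => slice f j (x - j%:~R) * kernel (xi + k%:~R) x)
     (fun j => cintegrable_kernel _ (i1 j)).
  move=> [_]; rewrite fourierL1E => <-; congr cintegral; apply/funext => x.
  by rewrite [in LHS]slices_sum mulr_suml.
rewrite E; under eq_bigr => j _.
  rewrite (@fourierL1_translates (slice f j)); last exact: L2_slice_cintegrable.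
  over.
rewrite /inner /zak.
have i1 j : cintegrable (fun x => slice f j x * kernel (xi + k%:~R) x).
  by apply: cintegrable_kernel; exact: L2_slice_cintegrable.
have i2 j : cintegrable (fun x => chi j (xi + k%:~R) * (slice f j x * kernel (xi + k%:~R) x)).
  exact: cintegrableZ.
transitivity (\sum_(j <- A) cintegral
   (fun x => chi j (xi + k%:~R) * (slice f j x * kernel (xi + k%:~R) x))).
  by apply: eq_bigr => j _; rewrite cintegralZ.
rewrite -(@cintegral_sum _ _ (enum_fset A) _ i2).2; congr cintegral; apply/funext => x.
rewrite mulr_sumr mulr_suml; apply: eq_bigr => j _.
rewrite /chi char_periodic /circ conjcM conjc_indicU conjc_char.
rewrite (_ : kernel (xi + k%:~R) x = kernel xi x * char (- k) x); last first.
  by rewrite /kernel /char -cisD; congr cis; rewrite rmorphN /=; ring.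
rewrite /slice; have := sqr_indicU x => /(congr1 (real_complex R)).
rewrite expr2 rmorphM /=; set u := (\1_U x)%:C%C => uu.
by rewrite -[in LHS]uu; ring.
Qed.

Lemma zak_parseval xi : (\esum_(k in [set: int])
  (modulus (fourierL1 f (xi + k%:~R)) ^+ 2)%:E = (nrm (zak xi) ^+ 2)%:E)%E.
Proof.
have mk : cmeasurable (fun x => kernel xi x * zak xi x).
  apply: cmeasurableM; first exact: cmeasurable_kernel.
  by apply: L2_measurable; exact: L2_zak.
have mE x : modulus (kernel xi x * zak xi x) = modulus (zak xi x).
  by rewrite modulusM modulus_cis mul1r.
have lk : L2 (fun x => kernel xi x * zak xi x).
  apply: (L2_le_nrm ler01 (L2_zak xi) mk _).1.
  by apply: aeT => x; rewrite mE mul1r.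
have [|_] := circle_parseval lk.
  by move=> x xU; rewrite /zak big1 ?mulr0// => j _; rewrite slice_out ?mulr0.
under [X in _ = X]eq_esum do rewrite -fourierL1_zak.
by move=> <-; rewrite !nrm_sqr; under eq_Rintegral do rewrite mE.
Qed.

(** As a function of [xi] the squared norm is a trigonometric polynomial whose coefficients are
    inner products of slices; over one period only the diagonal survives. *)
Lemma zak_integral :
  (\int[mu R]_(xi in U) (nrm (zak xi) ^+ 2)%:E = (nrm f ^+ 2)%:E)%E.
Proof.
pose G j l := inner (slice f j) (slice f l).
have E xi : (nrm (zak xi) ^+ 2)%:C%C =
    \sum_(j <- A) \sum_(l <- A) G j l * char (l - j) xi.
  rewrite -inner_self; last exact: L2_zak.
  rewrite zakE inner_lincombl; [|by move=> j; exact: L2_slice|exact: L2_zak].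
  apply: eq_bigr => j _; rewrite inner_lincombr; [|by move=> l; exact: L2_slice|exact: L2_slice].
  rewrite mulr_sumr; apply: eq_bigr => l _.
  by rewrite /chi conjc_char opprK addrC charD -/(G j l); ring.
have i1 j l : cintegrable (fun xi => G j l * circ (l - j) xi).
  by apply: cintegrableZ; exact: cintegrable_circ.
have i2 j := @cintegral_sum _ _ (enum_fset A) _ (i1 j).
have [i3 e3] := @cintegral_sum _ _ (enum_fset A) _ (fun j => (i2 j).1).
have E2 : (fun xi => \sum_(j <- A) \sum_(l <- A) G j l * circ (l - j) xi) =
          (fun xi => (\1_U xi * nrm (zak xi) ^+ 2)%:C%C).
  apply/funext => xi; rewrite rmorphM /= E mulr_sumr; apply: eq_bigr => j _.
  by rewrite mulr_sumr; apply: eq_bigr => l _; rewrite /circ mulrCA.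
have iN : integrableR (fun xi => (\1_U xi * nrm (zak xi) ^+ 2)%:E).
  by have := i3; rewrite E2 => -[].
have : \int[mu R]_xi (\1_U xi * nrm (zak xi) ^+ 2) = nrm f ^+ 2.
  move: e3; rewrite E2 => /(congr1 (@complex.Re R)) /= ->.
  rewrite slices_nrm (ReIm_sum _ _).1 big_seq [RHS]big_seq; apply: eq_bigr => j jA.
  rewrite (i2 j).2 (bigD1_seq _ jA (fset_uniq _)) /= big1 ?addr0; last first.
    move=> l lj; rewrite cintegralZ; last exact: cintegrable_circ.
    by rewrite cintegral_circ subr_eq0 (negbTE lj) mulr0.
  rewrite cintegralZ; last exact: cintegrable_circ.
  by rewrite cintegral_circ subrr eqxx mulr1 /G inner_self//; exact: L2_slice.
move=> <-; rewrite /Rintegral fineK; last exact: integrable_fin_num.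
rewrite [LHS]integral_mkcond; apply: eq_integral => x _.
by rewrite patchE indicE; case: (x \in _); rewrite ?mul1r ?mul0r.
Qed.

(** Folding the frequency line leaves, at each [xi], the sum over [xi + k], which [zak_parseval]
    evaluates; [zak_integral] then integrates over [xi]. *)
Lemma plancherel_compact : L2 (fourierL1 f) /\ nrm (fourierL1 f) = nrm f.
Proof.
have if_ := compact_cintegrable.
have mf := cmeasurable_fourierL1 if_.
have E : (\int[mu R]_x (modulus (fourierL1 f x) ^+ 2)%:E = (nrm f ^+ 2)%:E)%E.
  rewrite integral_periodize; last 2 first.
  - exact: emeasurable_modulus2.
  - by move=> x; rewrite lee_fin sqr_ge0.
  rewrite -zak_integral; apply: eq_integral => xi _; exact: zak_parseval.
have lF : L2 (fourierL1 f).
  apply/L2P; split => //; apply/integrableP; split; first exact: emeasurable_modulus2.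
  under eq_integral do rewrite abse_EFin ger0_norm ?sqr_ge0//.
  by rewrite E ltry.
split => //; apply/eqP; rewrite -(@eqrXn2 _ 2) ?nrm_ge0//; apply/eqP.
by apply: EFin_inj; rewrite nrm_sqrE.
Qed.

End CompactSupport.
End Plancherel.

(** * Extension of the Fourier transform to L2 *)

Section FourierL2.
Variable R : realType.
Implicit Types (f g : R -> R[i]) (u : nat -> R -> R[i]).

Definition nlim u f := nrm (u n \- f) @[n --> \oo] --> (0 : R).

Lemma cvg_nrm0P (h : nat -> R -> R[i]) : nrm (h n) @[n --> \oo] --> (0 : R) <->
  forall e : R, 0 < e -> exists N, forall n, (N <= n)%N -> nrm (h n) <= e.
Proof.
split=> [/cvgr0Pnorm_le H e e0|H].
  have [N _ hN] := H e e0; exists N => n /hN /=.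
  by rewrite ger0_norm ?nrm_ge0.
apply/cvgr0Pnorm_le => e /H[N hN]; exists N => // n /hN /=.
by rewrite ger0_norm ?nrm_ge0.
Qed.

Lemma L2norm_cvg0P (h : nat -> R -> R[i]) : (forall n, L2 (h n)) ->
  (L2norm (h n) @[n --> \oo] --> 0%E) <-> (nrm (h n) @[n --> \oo] --> (0 : R)).
Proof.
move=> lh; have E n : L2norm (h n) = (nrm (h n))%:E by rewrite L2normE.
rewrite (_ : (fun n => L2norm (h n)) = (fun n => (nrm (h n))%:E)); last exact/funext.
split=> [/fine_cvg//|H]; apply: cvg_EFin; first exact: nearW.
exact: H.
Qed.

Lemma nlim_le (h k : nat -> R -> R[i]) (C : R) : (forall n, nrm (h n) <= C * nrm (k n)) ->
  nrm (k n) @[n --> \oo] --> (0 : R) -> nrm (h n) @[n --> \oo] --> (0 : R).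
Proof.
move=> hk k0; have Ck : C * nrm (k n) @[n --> \oo] --> (0 : R).
  by rewrite -(mulr0 C); apply: cvgM => //; exact: cvg_cst.
have H : \forall n \near \oo, 0 <= nrm (h n) <= C * nrm (k n).
  by apply: nearW => n; rewrite nrm_ge0 hk.
by apply: (squeeze_cvgr H) Ck; exact: cvg_cst.
Qed.

Lemma nlimD u u' f f' : (forall n, L2 (u n)) -> (forall n, L2 (u' n)) ->
  L2 f -> L2 f' -> nlim u f -> nlim u' f' -> nlim (fun n => u n \+ u' n) (f \+ f').
Proof.
move=> lu lu' lf lf' h h'.
have H : \forall n \near \oo, 0 <= nrm ((u n \+ u' n) \- (f \+ f')) <=
    nrm (u n \- f) + nrm (u' n \- f').
  apply: nearW => n; rewrite nrm_ge0 /=.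
  rewrite (_ : _ \- _ = (u n \- f) \+ (u' n \- f')).
    by apply: nrmD; exact: L2B.
  by apply/funext => x /=; ring.
apply: (squeeze_cvgr H); first exact: cvg_cst.
by rewrite -(addr0 (0 : R)); exact: cvgD.
Qed.

Lemma nlimZ u f a : (forall n, L2 (u n)) -> L2 f -> nlim u f ->
  nlim (fun n x => a * u n x) (fun x => a * f x).
Proof.
move=> lu lf; apply: (@nlim_le _ _ (modulus a)) => n.
rewrite -nrmZ; last exact: L2B.
by rewrite (_ : _ \- _ = fun x => a * (u n \- f) x)//; apply/funext => x /=; ring.
Qed.

Lemma nlim_translates u f k : (forall n, L2 (u n)) -> L2 f -> nlim u f ->
  nlim (fun n => translates (u n) k) (translates f k).
Proof.
move=> lu lf; apply: (@nlim_le _ _ 1) => n; rewrite mul1r.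
by have [_ <-] := L2_shift (- k%:~R) (L2B (lu n) lf).
Qed.

Lemma nlim_nrm u f : (forall n, L2 (u n)) -> L2 f -> nlim u f ->
  nrm (u n) @[n --> \oo] --> nrm f.
Proof.
move=> lu lf h; apply/cvgrPdist_le => e e0.
have [N hN] := (cvg_nrm0P _).1 h e e0; exists N => // n /hN /= Hn.
rewrite ler_norml; apply/andP; split.
  by have := nrm_le_sub (lu n) lf; lra.
by have := nrm_le_sub lf (lu n); rewrite nrmBC; lra.
Qed.

(** The first [n] unit intervals in the enumeration of the integers: a finite union of unit
    intervals, as the slices require, and increasing to the line. *)
Definition cut_indic (n : nat) (x : R) : R := (nat_of_int (Num.floor x) < n)%:R.

Lemma measurable_cut_indic n : measurable_fun setT (cut_indic n).
Proof.
elim: n => [|n IH].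
  by rewrite (_ : cut_indic 0 = cst 0); [exact: measurable_cst|exact/funext].
have E x : cut_indic n.+1 x = cut_indic n x + \1_(@U R) (x - (int_of_nat n)%:~R).
  rewrite indicU_floor /cut_indic ltnS leq_eqVlt.
  rewrite (_ : (Num.floor x == int_of_nat n) = (nat_of_int (Num.floor x) == n)).
    by case: eqP => [->|_]; rewrite ?ltnn/= ?add0r ?addr0.
  by apply/eqP/eqP => [->|<-]; rewrite ?int_of_natK ?nat_of_intK.
rewrite (_ : cut_indic n.+1 =
    fun x => cut_indic n x + \1_(@U R) (x - (int_of_nat n)%:~R)); last exact/funext.
apply: measurable_funD => //.
rewrite (_ : (fun x : R => _) = \1_[set x : R | @U R (x - (int_of_nat n)%:~R)]).
  by apply: measurable_indic; exact: measurable_U_shift.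
by apply/funext => x; rewrite !indicE; congr (nat_of_bool _)%:R; apply/idP/idP; rewrite !inE.
Qed.

Definition cut (n : nat) f (x : R) : R[i] := (cut_indic n x)%:C%C * f x.

Lemma cutE n f x : cut n f x = if (nat_of_int (Num.floor x) < n)%N then f x else 0.
Proof. by rewrite /cut /cut_indic; case: ifP => _; rewrite ?mul1r ?mul0r. Qed.

Lemma cut_le n f x : modulus (cut n f x) <= modulus (f x).
Proof. by rewrite cutE; case: ifP; rewrite ?modulus0 ?modulus_ge0. Qed.

Lemma cmeasurable_cut n f : cmeasurable f -> cmeasurable (cut n f).
Proof.
move=> mf; apply: cmeasurableM => //.
by apply: cmeasurable_real; exact: measurable_cut_indic.
Qed.

Lemma L2_cut n f : L2 f -> L2 (cut n f) /\ nrm (cut n f) <= nrm f.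
Proof.
move=> lf; rewrite -[leRHS]mul1r; apply: L2_le_nrm => //.
  by apply: cmeasurable_cut; exact: L2_measurable.
by apply: aeT => x; rewrite mul1r cut_le.
Qed.

Lemma cut_eventually f x n : (nat_of_int (Num.floor x) < n)%N -> cut n f x = f x.
Proof. by rewrite cutE => ->. Qed.

Definition cut_set (n : nat) : {fset int} :=
  seq_fset tt [seq int_of_nat i | i <- iota 0 n].

Lemma cut_setP n f x : Num.floor x \notin cut_set n -> cut n f x = 0.
Proof.
rewrite cutE; case: ifP => // h /negP[]; rewrite seq_fsetE; apply/mapP.
by exists (nat_of_int (Num.floor x)); rewrite ?mem_iota ?nat_of_intK.
Qed.

Lemma nlim_cut f : L2 f -> nlim (fun n => cut n f) f.
Proof.
move=> lf; have lc n := (L2_cut n lf).1.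
have mf := L2_measurable lf.
have [|||||_ _ H] := @dominated_convergence _ _ R (mu R) setT measurableT
    (fun n x => (modulus ((cut n f \- f) x) ^+ 2)%:E) (fun=> 0%E)
    (fun x => (modulus (f x) ^+ 2)%:E).
- by move=> n; apply: emeasurable_modulus2; apply: cmeasurableB => //; exact: cmeasurable_cut.
- exact: measurable_cst.
- apply: aeT => x _; apply: cvg_near_cst.
  exists (nat_of_int (Num.floor x)).+1 => // n /= xn.
  by rewrite cut_eventually// subrr modulus0 expr0n.
- exact: L2_integrable.
- apply: aeT => x n _; rewrite abse_EFin lee_fin ger0_norm ?sqr_ge0//= cutE.
  by case: ifP => _; rewrite ?subrr ?modulus0 ?expr0n ?sqr_ge0//= sub0r modulusN.
apply/cvg_nrm0P => e e0; move: H; rewrite integral0 => H.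
have {}H : (nrm (cut n f \- f) ^+ 2)%:E @[n --> \oo] --> 0%E.
  by apply: cvg_trans H; apply: near_eq_cvg; apply: nearW => n /=; rewrite nrm_sqrE//; exact: L2B.
have e2 : 0 < e ^+ 2 by rewrite exprn_gt0.
have [N _ hN] := (cvgr0Pnorm_le _).1 (fine_cvg H) _ e2.
exists N => n /hN /=; rewrite ger0_norm ?sqr_ge0// => h.
by apply: sqr_le_le => //; exact: ltW.
Qed.

Lemma dominated_cintegral (h : nat -> R -> R[i]) f (v : R -> R) :
  (forall n, cmeasurable (h n)) -> cmeasurable f ->
  (forall n x, modulus (h n x) <= v x) -> integrableR (fun x => (v x)%:E) ->
  (forall x, exists N, forall n, (N <= n)%N -> h n x = f x) ->
  (complex.Re (cintegral (h n)) @[n --> \oo] --> complex.Re (cintegral f)) /\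
  (complex.Im (cintegral (h n)) @[n --> \oo] --> complex.Im (cintegral f)).
Proof.
move=> mh mf hv iv hf.
have key (p : R[i] -> R) : (forall n, measurable_fun setT (fun x => p (h n x))) ->
    measurable_fun setT (fun x => p (f x)) -> (forall z, `|p z| <= modulus z) ->
    \int[mu R]_x p (h n x) @[n --> \oo] --> \int[mu R]_x p (f x).
  move=> m1 m2 pm.
  have [|||||i1 _ H] := @dominated_convergence _ _ R (mu R) setT measurableT
      (fun n x => (p (h n x))%:E) (fun x => (p (f x))%:E) (fun x => (v x)%:E).
  - by move=> n; apply/measurable_EFinP; exact: m1.
  - exact/measurable_EFinP.
  - apply: aeT => x _; apply: cvg_near_cst.
    by have [N hN] := hf x; exists N => // n /= /hN ->.
  - exact: iv.
  - by apply: aeT => x n _; rewrite abse_EFin lee_fin (le_trans (pm _)).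
  rewrite /Rintegral; apply: fine_cvg; rewrite fineK; first exact: H.
  exact: integrable_fin_num.
split; apply: key.
- by move=> n; exact: (mh n).1.
- exact: mf.1.
- exact: abs_Re_modulus.
- by move=> n; exact: (mh n).2.
- exact: mf.2.
- exact: abs_Im_modulus.
Qed.

Lemma cut_fourierL1 n f : L2 f ->
  L2 (fourierL1 (cut n f)) /\ nrm (fourierL1 (cut n f)) = nrm (cut n f).
Proof.
by move=> lf; apply: (@plancherel_compact _ _ (cut_set n)) (L2_cut n lf).1 _ => x; exact: cut_setP.
Qed.

Lemma cut_cintegrable n f : L2 f -> cintegrable (cut n f).
Proof.
by move=> lf; apply: (@compact_cintegrable _ _ (cut_set n)) (L2_cut n lf).1 _ => x; exact: cut_setP.
Qed.

(** The truncations converge under the dominating function [|f|], so their transforms converge at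
    every frequency, and Fatou applies to Plancherel for the truncations. The inequality already
    yields uniqueness of the extension. *)
Lemma fourierL1_contraction f : cintegrable f -> L2 f ->
  L2 (fourierL1 f) /\ nrm (fourierL1 f) <= nrm f.
Proof.
move=> if_ lf.
have D xi := @dominated_cintegral (fun n x => cut n f x * kernel xi x)
  (fun x => f x * kernel xi x) (fun x => modulus (f x)).
have mf := L2_measurable lf.
have {}D xi : (complex.Re (fourierL1 (cut n f) xi) @[n --> \oo] --> complex.Re (fourierL1 f xi)) /\
    (complex.Im (fourierL1 (cut n f) xi) @[n --> \oo] --> complex.Im (fourierL1 f xi)).
  apply: D.
  - by move=> n; apply: cmeasurableM; [exact: cmeasurable_cut|exact: cmeasurable_kernel].
  - by apply: cmeasurableM => //; exact: cmeasurable_kernel.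
  - by move=> n x; rewrite modulusM modulus_cis mulr1 cut_le.
  - exact: cintegrable_modulus.
  - move=> x; exists (nat_of_int (Num.floor x)).+1 => n xn.
    by rewrite cut_eventually.
apply: (@L2_fatou _ (fun n => fourierL1 (cut n f))).
- exact: nrm_ge0.
- by move=> n; exact: (cut_fourierL1 n lf).1.
- by move=> n; rewrite (cut_fourierL1 n lf).2; exact: (L2_cut n lf).2.
- by move=> xi; exact: (D xi).1.
- by move=> xi; exact: (D xi).2.
Qed.

Lemma is_fourierP f g : is_fourier f g <-> [/\ L2 f, L2 g & exists u,
  [/\ forall n, cintegrable (u n) /\ L2 (u n), nlim u f &
      nlim (fun n => fourierL1 (u n)) g]].
Proof.
have E1 u : L2 f -> (forall n, cintegrable (u n) /\ L2 (u n)) ->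
   (L2norm (u n \- f) @[n --> \oo] --> 0%E) <-> nlim u f.
  by move=> lf hu; apply: L2norm_cvg0P => n; apply: L2B => //; exact: (hu n).2.
have E2 u : L2 g -> (forall n, cintegrable (u n) /\ L2 (u n)) ->
   (L2norm (fourierL1 (u n) \- g) @[n --> \oo] --> 0%E) <-> nlim (fun n => fourierL1 (u n)) g.
  move=> lg hu; apply: L2norm_cvg0P => n; apply: L2B => //.
  exact: (fourierL1_contraction (hu n).1 (hu n).2).1.
split=> -[lf lg [u [hu uf ug]]]; split => //; exists u.
  have hu' n : cintegrable (u n) /\ L2 (u n).
    by split; [exact/L1P/(hu n).1|exact: (hu n).2].
  by split => //; [exact/E1|exact/E2].
split; first by move=> n; split; [exact/L1P/(hu n).1|exact: (hu n).2].
  exact/(E1 u lf hu).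
exact/(E2 u lg hu).
Qed.

Lemma is_fourierD f g f' g' : is_fourier f g -> is_fourier f' g' ->
  is_fourier (f \+ f') (g \+ g').
Proof.
move=> /is_fourierP[lf lg [u [hu uf ug]]] /is_fourierP[lf' lg' [v [hv vf vg]]].
have lF (w : nat -> R -> R[i]) : (forall n, cintegrable (w n) /\ L2 (w n)) -> forall n, L2 (fourierL1 (w n)).
  by move=> hw n; exact: (fourierL1_contraction (hw n).1 (hw n).2).1.
apply/is_fourierP; split; [exact: L2D|exact: L2D|exists (fun n => u n \+ v n); split].
- by move=> n; split; [apply: cintegrableD; [exact: (hu n).1|exact: (hv n).1]|
    apply: L2D; [exact: (hu n).2|exact: (hv n).2]].
- by apply: nlimD => // n; [exact: (hu n).2|exact: (hv n).2].
- rewrite (_ : (fun n => _) = fun n => fourierL1 (u n) \+ fourierL1 (v n)).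
    by apply: nlimD => //; exact: lF.
  apply/funext => n; apply/funext => xi /=.
  by rewrite fourierL1D//; [exact: (hu n).1|exact: (hv n).1].
Qed.

Lemma is_fourierZ f g a : is_fourier f g ->
  is_fourier (fun x => a * f x) (fun x => a * g x).
Proof.
move=> /is_fourierP[lf lg [u [hu uf ug]]].
apply/is_fourierP; split; [exact: L2Z|exact: L2Z|exists (fun n x => a * u n x); split].
- by move=> n; split; [apply: cintegrableZ; exact: (hu n).1|apply: L2Z; exact: (hu n).2].
- by apply: nlimZ => // n; exact: (hu n).2.
- rewrite (_ : (fun n => _) = fun n xi => a * fourierL1 (u n) xi).
    apply: nlimZ => // n; exact: (fourierL1_contraction (hu n).1 (hu n).2).1.
  apply/funext => n; apply/funext => xi.
  by rewrite fourierL1Z//; exact: (hu n).1.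
Qed.

Lemma L2_chiM k f : L2 f -> L2 (fun x => chi k x * f x) /\ nrm (fun x => chi k x * f x) = nrm f.
Proof.
move=> lf; have E x : modulus (chi k x * f x) = modulus (f x).
  by rewrite modulusM modulus_char mul1r.
split; last by rewrite !nrmE; under eq_Rintegral do rewrite E.
apply: (L2_le_nrm ler01 lf _ _).1; last by apply: aeT => x; rewrite E mul1r.
by apply: cmeasurableM; [exact: cmeasurable_char|exact: L2_measurable].
Qed.

Lemma is_fourier_translates f g k : is_fourier f g ->
  is_fourier (translates f k) (fun xi => chi k xi * g xi).
Proof.
move=> /is_fourierP[lf lg [u [hu uf ug]]].
apply/is_fourierP; split; [exact: L2_translates|exact: (L2_chiM k lg).1|].
exists (fun n => translates (u n) k); split.
- move=> n; split; [|by apply: L2_translates; exact: (hu n).2].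
  exact: (cintegrable_shift (- k%:~R) (hu n).1).
- by apply: nlim_translates => // n; exact: (hu n).2.
- apply: (@nlim_le _ _ 1) ug => n; rewrite mul1r.
  have lF : L2 (fourierL1 (u n)) by exact: (fourierL1_contraction (hu n).1 (hu n).2).1.
  rewrite (_ : _ \- _ = fun xi => chi k xi * (fourierL1 (u n) \- g) xi).
    by rewrite (L2_chiM k (L2B lF lg)).2.
  apply/funext => xi /=; rewrite fourierL1_translates; last exact: (hu n).1.
  by rewrite mulrBr.
Qed.

Lemma is_fourier_le f g : is_fourier f g -> nrm g <= nrm f.
Proof.
move=> /is_fourierP[lf lg [u [hu uf ug]]].
have h1 := nlim_nrm (fun n => (hu n).2) lf uf.
have h2 := nlim_nrm (fun n => (fourierL1_contraction (hu n).1 (hu n).2).1) lg ug.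
apply: (ler_cvg_to h2 h1).
by apply: nearW => n; exact: (fourierL1_contraction (hu n).1 (hu n).2).2.
Qed.

Lemma is_fourierB f g f' g' : is_fourier f g -> is_fourier f' g' ->
  is_fourier (f \- f') (g \- g').
Proof.
move=> h /(is_fourierZ (-1)) h'.
rewrite (_ : f \- f' = f \+ (fun x => -1 * f' x)); last first.
  by apply/funext => x /=; rewrite mulN1r.
rewrite (_ : g \- g' = g \+ (fun x => -1 * g' x)); last first.
  by apply/funext => x /=; rewrite mulN1r.
exact: is_fourierD.
Qed.

Lemma is_fourier_unique f g g' : is_fourier f g -> is_fourier f g' ->
  {ae mu R, forall x, g x = g' x}.
Proof.
move=> h h'; have lg : L2 g by case: h.
have lg' : L2 g' by case: h'.
have := is_fourier_le (is_fourierB h h').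
rewrite (_ : f \- f = fun=> 0); last by apply/funext => x /=; rewrite subrr.
rewrite nrm0 => g0.
have : nrm (g \- g') = 0 by apply/eqP; rewrite eq_le g0 nrm_ge0.
move/(nrm_eq0_ae (L2B lg lg')); apply: aeS => x /eqP.
by rewrite subr_eq0 => /eqP.
Qed.

(** The transforms of the truncations form a Cauchy sequence by the contraction; equality of norms
    holds for each of them and passes to the limit. *)
Lemma is_fourier_exists f : L2 f -> exists g, is_fourier f g /\ nrm g = nrm f.
Proof.
move=> lf.
have lc n := (L2_cut n lf).1.
have lF n := (cut_fourierL1 n lf).1.
have [||g [lg hg]] := @L2_complete R (fun n => fourierL1 (cut n f)).
- exact: lF.
- move=> e e0; have e2 : 0 < e / 2 by rewrite divr_gt0.
  have [N hN] := (cvg_nrm0P _).1 (nlim_cut lf) _ e2.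
  exists N => m n Nm Nn.
  have -> : fourierL1 (cut m f) \- fourierL1 (cut n f) = fourierL1 (cut m f \- cut n f).
    by apply/funext => xi /=; rewrite fourierL1B//; exact: cut_cintegrable.
  have i1 : cintegrable (cut m f \- cut n f).
    rewrite (_ : _ \- _ = cut m f \+ (fun x => -1 * cut n f x)); last first.
      by apply/funext => x /=; rewrite mulN1r.
    by apply: cintegrableD; [|apply: cintegrableZ]; exact: cut_cintegrable.
  apply: le_trans (fourierL1_contraction i1 (L2B (lc m) (lc n))).2 _.
  apply: le_trans (nrm_triangle (lc m) lf (lc n)) _.
  by rewrite (splitr e); apply: lerD; [exact: hN|rewrite nrmBC; exact: hN].
exists g; split.
  apply/is_fourierP; split => //; exists (fun n => cut n f); split => //.
    by move=> n; split => //; exact: cut_cintegrable.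
  exact: nlim_cut.
have h1 := nlim_nrm lF lg hg.
have h2 := nlim_nrm lc lf (nlim_cut lf).
have E : (fun n => nrm (fourierL1 (cut n f))) = (fun n => nrm (cut n f)).
  by apply/funext => n; exact: (cut_fourierL1 n lf).2.
rewrite E in h1.
exact: (cvg_unique _ h1 h2).
Qed.

Lemma fourierP f : L2 f -> is_fourier f (fourier f) /\ nrm (fourier f) = nrm f.
Proof.
move=> lf; have [g [hg Eg]] := is_fourier_exists lf.
have H : is_fourier f (fourier f) by apply: xgetPex; exists g.
split => //; rewrite -Eg.
have [_ lg _] := hg; have [_ lF _] := H.
by apply: ae_nrm; [exact: L2_measurable..|exact: is_fourier_unique H hg].
Qed.

Lemma L2_fourier f : L2 f -> L2 (fourier f).
Proof. by move=> /fourierP[[]]. Qed.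

Lemma fourierD f g : L2 f -> L2 g ->
  {ae mu R, forall xi, fourier (f \+ g) xi = fourier f xi + fourier g xi}.
Proof.
move=> lf lg; apply: (is_fourier_unique (fourierP (L2D lf lg)).1).
exact: is_fourierD (fourierP lf).1 (fourierP lg).1.
Qed.

Lemma fourierZ a f : L2 f ->
  {ae mu R, forall xi, fourier (fun x => a * f x) xi = a * fourier f xi}.
Proof.
move=> lf; apply: (is_fourier_unique (fourierP (L2Z a lf)).1).
exact: is_fourierZ (fourierP lf).1.
Qed.

(** Polarization: preservation of norms gives the real part, and replacing [g] by [i g] gives the
    imaginary part. *)
Lemma inner_fourier f g : L2 f -> L2 g -> inner (fourier f) (fourier g) = inner f g.
Proof.
move=> lf lg; have lF := L2_fourier lf; have lG := L2_fourier lg.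
have key h : L2 h -> complex.Re (inner (fourier f) (fourier h)) = complex.Re (inner f h).
  move=> lh; have lH := L2_fourier lh.
  have := nrm_sqrD lf lh; have := nrm_sqrD lF lH.
  rewrite (fourierP lf).2 (fourierP lh).2 -(fourierP (L2D lf lh)).2.
  rewrite (@ae_nrm _ (fourier (f \+ h)) (fourier f \+ fourier h)).
  - lra.
  - by apply: L2_measurable; apply: L2_fourier; exact: L2D.
  - by apply: L2_measurable; exact: L2D.
  - exact: fourierD.
apply: complex_eqP; first exact: key.
have := key (fun x => Complex 0 1 * g x) (L2Z _ lg).
rewrite (@ae_inner _ (fourier f) (fourier f) (fourier (fun x => Complex 0 1 * g x))
   (fun x => Complex 0 1 * fourier g x)).
- rewrite !innerZr// !ReM /= !mul0r; lra.
- exact: L2_measurable.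
- exact: L2_measurable.
- by apply: L2_measurable; apply: L2_fourier; exact: L2Z.
- by apply: L2_measurable; exact: L2Z.
- exact: aeT.
- exact: fourierZ.
Qed.

Lemma fourier_lincomb (A : {fset int}) (c : int -> R[i]) f : L2 f ->
  {ae mu R, forall xi, fourier (lincomb A c (translates f)) xi =
     lincomb A c chi xi * fourier f xi}.
Proof.
move=> lf; apply: (is_fourier_unique (fourierP (L2_lincomb A c (fun k => L2_translates k lf))).1).
rewrite /lincomb; elim: (enum_fset A) => [|k s IH].
  have := is_fourierZ 0 (fourierP lf).1.
  rewrite (_ : (fun x => 0 * f x) = fun x => \sum_(k <- [::]) c k * translates f k x).
    rewrite (_ : (fun x => 0 * fourier f x) = fun x => (\sum_(k <- [::]) c k * chi k x) * fourier f x)//.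
    by apply/funext => x; rewrite big_nil.
  by apply/funext => x; rewrite big_nil mul0r.
have := is_fourierD (is_fourierZ (c k) (is_fourier_translates k (fourierP lf).1)) IH.
rewrite (_ : (fun x => c k * translates f k x) \+ _ =
    fun x => \sum_(k <- k :: s) c k * translates f k x).
  rewrite (_ : (fun x => c k * (chi k x * fourier f x)) \+ _ =
     fun x => (\sum_(k <- k :: s) c k * chi k x) * fourier f x)//.
  by apply/funext => x /=; rewrite big_cons mulrDl mulrA.
by apply/funext => x /=; rewrite big_cons.
Qed.

End FourierL2.

(** * Periodized products and the bracket *)

Section IntegerSums.
Variable R : realType.
Implicit Types (s : int -> R[i]).

(** Convergence with its limit as an argument, so that scaling and uniqueness do not go through the
    chosen limit in [Zsum]. *)
Definition zsum s z := forall e : R, 0 < e -> exists A0 : {fset int},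
  forall A : {fset int}, (A0 `<=` A)%fset -> modulus (\sum_(k <- A) s k - z) <= e.

Lemma zsum_unique s z z' : zsum s z -> zsum s z' -> z = z'.
Proof.
move=> h h'; apply/eqP; rewrite -subr_eq0; apply/eqP; apply: modulus_eq0.
apply/eqP; rewrite eq_le modulus_ge0 andbT; apply: le0_all_eps => e e0.
have e2 : 0 < e / 2 by rewrite divr_gt0.
have [A hA] := h _ e2; have [A' hA'] := h' _ e2.
rewrite (_ : z - z' = - (\sum_(k <- (A `|` A')%fset) s k - z) +
   (\sum_(k <- (A `|` A')%fset) s k - z')); last by ring.
apply: le_trans (modulusD _ _) _; rewrite modulusN (splitr e).
by apply: lerD; [apply: hA; exact: fsubsetUl|apply: hA'; exact: fsubsetUr].
Qed.

Lemma zsumZ s z a : zsum s z -> zsum (fun k => a * s k) (a * z).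
Proof.
move=> h e e0; have a0 := modulus_ge0 a.
have ea : 0 < e / (modulus a + 1) by rewrite divr_gt0//; lra.
have [A0 hA0] := h _ ea; exists A0 => A /hA0 hA.
rewrite -mulr_sumr -mulrBr modulusM.
have : (modulus a + 1) * modulus (\sum_(k <- A) s k - z) <= e.
  by rewrite mulrC -ler_pdivlMr//; lra.
by have := modulus_ge0 (\sum_(k <- A) s k - z); nra.
Qed.

Lemma zsum_le s z (M : R) : zsum s z ->
  (forall A : {fset int}, \sum_(k <- A) modulus (s k) <= M) -> modulus z <= M.
Proof.
move=> h hM; rewrite -subr_le0; apply: le0_all_eps => e e0.
have [A hA] := h _ e0; have {}hA := hA A (fsubset_refl _).
have h1 := modulus_sum A s; have h2 := hM A.
have : modulus z <= modulus (\sum_(k <- A) s k) + modulus (\sum_(k <- A) s k - z).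
  rewrite -[X in _ + X]modulusN; apply: le_trans (modulusD _ _).
  by rewrite opprB addrC subrK.
by move: h1 h2 hA; lra.
Qed.

Lemma Zsum_zsum s z : zsum s z -> Zsum s = z.
Proof.
move=> h.
have FF : ProperFilter (@summability.totally int) by exact: summability.totally_filter.
have E (u : int -> R) (A : {fset int}) :
    summability.partial_sum (u : int -> R^o) A = \sum_(k <- A) u k.
  by rewrite /summability.partial_sum -(big_seq_fsetE _ _ predT u).
have key (p : R[i] -> R) : (forall z w, p (z - w) = p z - p w) ->
    (forall A : {fset int}, p (\sum_(k <- A) s k) = \sum_(k <- A) p (s k)) ->
    (forall z, `|p z| <= modulus z) ->
    summability.sum (fun k => p (s k) : R^o) = p z.
  move=> pB pS pm; apply: cvg_lim => //; apply/cvgrPdist_le => e e0.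
  have [A0 hA0] := h e e0; exists A0 => // A /hA0 /= hA.
  by rewrite E -pS -pB; apply: le_trans (pm _) _; rewrite -modulusN opprB.
apply: complex_eqP => /=; apply: key.
- by move=> w w'; rewrite ReD ReN.
- by move=> A; rewrite (ReIm_sum A s).1.
- exact: abs_Re_modulus.
- by move=> w w'; rewrite ImD ImN.
- by move=> A; rewrite (ReIm_sum A s).2.
- exact: abs_Im_modulus.
Qed.

Lemma esum_approx (a : int -> R) (e : R) : (forall k, 0 <= a k) ->
  (\esum_(k in [set: int]) (a k)%:E < +oo)%E -> 0 < e ->
  exists A0 : {fset int}, forall A : {fset int}, (A0 `<=` A)%fset ->
  `|\sum_(k <- A) a k - fine (\esum_(k in [set: int]) (a k)%:E)%E| <= e.
Proof.
move=> a0 aoo e0; set M := fine _.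
have EM : (\esum_(k in [set: int]) (a k)%:E = M%:E)%E.
  by rewrite fineK// ge0_fin_numE// esum_ge0// => k _; rewrite lee_fin.
have aM : forall A : {fset int}, \sum_(k <- A) a k <= M.
  by apply/esum_le_sumP => //; rewrite EM.
have [A0 hA0] : exists A0 : {fset int}, M - e <= \sum_(k <- A0) a k.
  apply: contrapT => /forallNP h.
  have : (\esum_(k in [set: int]) (a k)%:E <= (M - e)%:E)%E.
    by apply/esum_le_sumP => // A; have /negP := h A; rewrite -ltNge => /ltW.
  by rewrite EM lee_fin; lra.
exists A0 => A A0A; have := aM A.
have : \sum_(k <- A0) a k <= \sum_(k <- A) a k.
  by rewrite (big_fset_split _ A0A) lerDl sumr_ge0.
by rewrite ler_norml; lra.
Qed.

(* Unlike the limit defining [Zsum], a difference of two [\esum] is visibly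
   measurable in a parameter and invariant under reindexing. *)
Definition esumR (u : int -> R) : R :=
  fine (\esum_(k in [set: int]) (Num.max (u k) 0)%:E)%E -
  fine (\esum_(k in [set: int]) (Num.max (- u k) 0)%:E)%E.

Definition psum s : R[i] :=
  Complex (esumR (fun k => complex.Re (s k))) (esumR (fun k => complex.Im (s k))).

Lemma max0_le (x y : R) : 0 <= y -> x <= y -> 0 <= Num.max x 0 <= y.
Proof. by move=> y0 xy; rewrite le_max lexx orbT ge_max xy y0. Qed.

Lemma max0B (x : R) : x = Num.max x 0 - Num.max (- x) 0.
Proof.
by have [h|h] := leP 0 x; have [h'|h'] := leP (- x) 0; lra.
Qed.

Lemma esumR_approx (u b : int -> R) (e : R) : (forall k, `|u k| <= b k) ->
  (\esum_(k in [set: int]) (b k)%:E < +oo)%E -> 0 < e ->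
  exists A0 : {fset int}, forall A : {fset int}, (A0 `<=` A)%fset ->
  `|\sum_(k <- A) u k - esumR u| <= e.
Proof.
move=> ub boo e0; have e2 : 0 < e / 2 by rewrite divr_gt0.
have b0 k : 0 <= b k by exact: le_trans (ub k).
have hp k : 0 <= Num.max (u k) 0 <= b k.
  by apply: max0_le => //; apply: le_trans (ub k); exact: ler_norm.
have hn k : 0 <= Num.max (- u k) 0 <= b k.
  by apply: max0_le => //; apply: le_trans (ub k); rewrite -normrN; exact: ler_norm.
have fin v : (forall k, 0 <= v k <= b k) -> (\esum_(k in [set: int]) (v k)%:E < +oo)%E.
  move=> hv; apply: le_lt_trans boo; apply: le_esum => k _.
  by rewrite lee_fin; case/andP: (hv k).
have [A1 h1] := esum_approx (fun k => (andP (hp k)).1) (fin _ hp) e2.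
have [A2 h2] := esum_approx (fun k => (andP (hn k)).1) (fin _ hn) e2.
exists (A1 `|` A2)%fset => A hA; move: hA; rewrite fsubUset => /andP[/h1 {}h1 /h2 {}h2].
rewrite (eq_bigr (fun k => Num.max (u k) 0 - Num.max (- u k) 0)); last by move=> k _; exact: max0B.
rewrite sumrB /esumR; move: h1 h2; rewrite !ler_norml.
by move: (fine _) (fine _) (\sum_(_ <- _) _) (\sum_(_ <- _) _) => x y z t; lra.
Qed.

(** Absolute summability keeps the four sums of positive and negative parts finite; at an infinite
    one [fine] would return 0. *)
Lemma zsum_psum s : (\esum_(k in [set: int]) (modulus (s k))%:E < +oo)%E ->
  zsum s (psum s).
Proof.
move=> soo e e0; have e2 : 0 < e / 2 by rewrite divr_gt0.
have [A1 h1] := esumR_approx (fun k => abs_Re_modulus (s k)) soo e2.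
have [A2 h2] := esumR_approx (fun k => abs_Im_modulus (s k)) soo e2.
exists (A1 `|` A2)%fset => A; rewrite fsubUset => /andP[/h1 {}h1 /h2 {}h2].
apply: le_trans (modulus_le_ReIm _) _.
rewrite ReD ImD ReN ImN (ReIm_sum A s).1 (ReIm_sum A s).2 (splitr e).
exact: lerD.
Qed.

Lemma esum_shift (a : int -> \bar R) (j : int) : (forall k, 0 <= a k)%E ->
  (\esum_(k in [set: int]) a (k + j)%R = \esum_(k in [set: int]) a k)%E.
Proof.
move=> a0; rewrite [RHS](@reindex_esum _ _ _ [set: int] _ (fun k => k + j))//.
split => // [m n _ _|k _]; first exact: addIr.
by exists (k - j) => //; rewrite subrK.
Qed.

Lemma esumR_shift (u : int -> R) j : esumR (fun k => u (k + j)) = esumR u.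
Proof.
congr (fine _ - fine _).
  by apply: (@esum_shift (fun k => (Num.max (u k) 0)%:E)) => k; rewrite lee_fin le_max lexx orbT.
by apply: (@esum_shift (fun k => (Num.max (- u k) 0)%:E)) => k; rewrite lee_fin le_max lexx orbT.
Qed.

Lemma psum_shift s j : psum (fun k => s (k + j)) = psum s.
Proof.
apply: complex_eqP => /=.
  exact: (esumR_shift (fun k => complex.Re (s k))).
exact: (esumR_shift (fun k => complex.Im (s k))).
Qed.

Lemma esumRN (u : int -> R) : esumR (fun k => - u k) = - esumR u.
Proof. by rewrite /esumR opprB; congr (_ - _); apply: congr1; apply: eq_esum => k _; rewrite opprK. Qed.

Lemma psum_conjc s : psum (fun k => conjc (s k)) = conjc (psum s).
Proof.
apply: complex_eqP; rewrite ?Re_conjc ?Im_conjc /=.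
  by congr esumR; apply/funext => k; rewrite Re_conjc.
by rewrite -esumRN; congr esumR; apply/funext => k; rewrite Im_conjc.
Qed.

Lemma measurable_esumR (u : int -> R -> R) : (forall k, measurable_fun setT (u k)) ->
  measurable_fun setT (fun x => esumR (u^~ x)).
Proof.
move=> mu_.
have key (v : int -> R -> R) : (forall k, measurable_fun setT (v k)) ->
    measurable_fun setT (fun x => fine (\esum_(k in [set: int]) (Num.max (v k x) 0)%:E)%E).
  move=> mv; apply: measurableT_comp => //; apply: measurable_esum_int.
    move=> k; apply/measurable_EFinP; apply: measurable_maxr => //.
  by move=> k x; rewrite lee_fin le_max lexx orbT.
apply: measurable_funB; first exact: key.
by apply: (key (fun k x => - u k x)) => k; exact: measurableT_comp.
Qed.

Lemma cmeasurable_psum (f_ : int -> R -> R[i]) : (forall k, cmeasurable (f_ k)) ->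
  cmeasurable (fun x => psum (f_^~ x)).
Proof.
move=> mf; split.
  by apply: (@measurable_esumR (fun k x => complex.Re (f_ k x))) => k; exact: (mf k).1.
by apply: (@measurable_esumR (fun k x => complex.Im (f_ k x))) => k; exact: (mf k).2.
Qed.

End IntegerSums.

(** * Periodized functions and their integrals over one period *)

Section Periodize.
Variable R : realType.
Implicit Types (v u : R -> R).

Definition esum_translates (v : R -> R) (x : R) : \bar R :=
  (\esum_(k in [set: int]) (v (x + k%:~R))%:E)%E.

Lemma esum_translates_ge0 v x : (forall x, 0 <= v x) -> (0 <= esum_translates v x)%E.
Proof. by move=> v0; apply: esum_ge0 => k _; rewrite lee_fin. Qed.

Lemma esum_translates_periodic v x (j : int) : (forall x, 0 <= v x) ->
  esum_translates v (x + j%:~R) = esum_translates v x.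
Proof.
move=> v0; rewrite -[RHS](@esum_shift _ (fun k => (v (x + k%:~R))%:E) j).
  by apply: eq_esum => k _; rewrite rmorphD /= addrA addrAC.
by move=> k; rewrite lee_fin.
Qed.

Lemma measurable_esum_translates v : measurable_fun setT v -> (forall x, 0 <= v x) ->
  measurable_fun setT (esum_translates v).
Proof.
move=> mv v0; apply: measurable_esum_int => k; last by move=> x; rewrite lee_fin.
apply/measurable_EFinP; exact: (measurableT_comp mv (measurable_shift _)).
Qed.

Lemma integral_esum_translates v : measurable_fun setT v -> (forall x, 0 <= v x) ->
  (\int[mu R]_x (v x)%:E = \int[mu R]_(x in @U R) esum_translates v x)%E.
Proof.
move=> mv v0; rewrite integral_periodize//; first exact/measurable_EFinP.
Qed.

Lemma esum_translates_fin v : integrableR (fun x => (v x)%:E) -> (forall x, 0 <= v x) ->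
  {ae mu R, forall x, (esum_translates v x < +oo)%E}.
Proof.
move=> iv v0; have mv : measurable_fun setT v by exact: integrableR_EFin.
have mP := measurable_esum_translates mv v0.
apply: ae_periodic; first by move=> x k; rewrite esum_translates_periodic.
have : (mu R).-integrable (@U R) (esum_translates v).
  apply/integrableP; split; first exact: measurable_funTS.
  under eq_integral => x _ do rewrite gee0_abs ?esum_translates_ge0//.
  rewrite -integral_esum_translates//; move/integrableP: iv => [_].
  by under eq_integral => x _ do rewrite gee0_abs ?lee_fin//.
move/integrable_ae => /(_ (@measurable_U R)); apply: aeS => x h /h.
by rewrite ge0_fin_numE// esum_translates_ge0.
Qed.

Lemma Rintegral_esum_translates v : integrableR (fun x => (v x)%:E) -> (forall x, 0 <= v x) ->
  integrableR (fun x => (\1_(@U R) x * fine (esum_translates v x))%:E) /\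
  \int[mu R]_x (\1_(@U R) x * fine (esum_translates v x)) = \int[mu R]_x v x.
Proof.
move=> iv v0; have mv : measurable_fun setT v by exact: integrableR_EFin.
have mP := measurable_esum_translates mv v0.
have mw : measurable_fun setT (fun x => \1_(@U R) x * fine (esum_translates v x)).
  by apply: measurable_funM; [exact: measurable_indicU|exact: measurableT_comp].
have w0 x : 0 <= \1_(@U R) x * fine (esum_translates v x).
  by rewrite mulr_ge0 ?indicU_ge0 ?fine_ge0 ?esum_translates_ge0.
have E : (\int[mu R]_x (\1_(@U R) x * fine (esum_translates v x))%:E = \int[mu R]_x (v x)%:E)%E.
  rewrite integral_esum_translates// [RHS]integral_mkcond; apply: ae_eq_integral => //.
  - exact/measurable_EFinP.
  - by apply/(measurable_restrictT _ (@measurable_U R)); exact: measurable_funTS.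
  - apply: aeS (esum_translates_fin iv v0) => x h _.
    rewrite patchE indicE; case: (x \in _); rewrite ?mul0r// mul1r fineK//.
    by rewrite ge0_fin_numE// esum_translates_ge0.
split; last by rewrite /Rintegral E.
apply/integrableP; split; first exact/measurable_EFinP.
under eq_integral => x _ do rewrite gee0_abs ?lee_fin//.
rewrite E; move/integrableP: iv => [_].
by under eq_integral => x _ do rewrite gee0_abs ?lee_fin//.
Qed.

Lemma Rintegral_esumR (u : R -> R) : integrableR (fun x => (u x)%:E) ->
  integrableR (fun x => (\1_(@U R) x * esumR (fun k => u (x + k%:~R)))%:E) /\
  \int[mu R]_x (\1_(@U R) x * esumR (fun k => u (x + k%:~R))) = \int[mu R]_x u x.
Proof.
move=> iu; have mu_ : measurable_fun setT u by exact: integrableR_EFin.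
pose up x := Num.max (u x) 0; pose un x := Num.max (- u x) 0.
have up0 x : 0 <= up x by rewrite /up le_max lexx orbT.
have un0 x : 0 <= un x by rewrite /un le_max lexx orbT.
have iabs : integrableR (fun x => `|u x|%:E).
  by have := integrable_abse iu.
have ip : integrableR (fun x => (up x)%:E).
  apply: (@integrableR_le _ up (fun x => `|u x|)) => //.
    exact: measurable_maxr.
  by move=> x; rewrite ger0_norm// /up ge_max ler_norm normr_ge0.
have in_ : integrableR (fun x => (un x)%:E).
  apply: (@integrableR_le _ un (fun x => `|u x|)) => //.
    by apply: measurable_maxr => //; exact: measurableT_comp.
  by move=> x; rewrite ger0_norm// /un ge_max -normrN ler_norm normr_ge0.
have [jp Ep] := Rintegral_esum_translates ip up0.
have [jn En] := Rintegral_esum_translates in_ un0.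
have E x : \1_(@U R) x * esumR (fun k => u (x + k%:~R)) =
    \1_(@U R) x * fine (esum_translates up x) - \1_(@U R) x * fine (esum_translates un x).
  by rewrite -mulrBr.
split; first by under eq_fun do rewrite E; exact: integrableRB.
under eq_Rintegral do rewrite E.
rewrite RintegralB// Ep En -RintegralB//.
by apply: eq_Rintegral => x _; rewrite /up /un -max0B.
Qed.

Definition per (f : R -> R[i]) (x : R) : R[i] := psum (fun k => f (x + k%:~R)).

Lemma cmeasurable_per f : cmeasurable f -> cmeasurable (per f).
Proof. by move=> mf; apply: cmeasurable_psum => k; exact: cmeasurable_shift. Qed.

Lemma per_periodic f x (j : int) : per f (x + j%:~R) = per f x.
Proof.
rewrite /per -(psum_shift (fun k => f (x + k%:~R)) j); congr psum.
by apply/funext => k; rewrite rmorphD /= addrA addrAC.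
Qed.

Lemma cintegral_per f : cintegrable f ->
  cintegral (fun x => (\1_(@U R) x)%:C%C * per f x) = cintegral f.
Proof.
move=> [f1 f2]; apply: complex_eqP => /=.
  rewrite -(Rintegral_esumR f1).2; apply: eq_Rintegral => x _.
  by rewrite /= mul0r subr0.
rewrite -(Rintegral_esumR f2).2; apply: eq_Rintegral => x _.
by rewrite /= mul0r addr0.
Qed.

Lemma per_zsum f : cintegrable f ->
  {ae mu R, forall x, zsum (fun k => f (x + k%:~R)) (per f x)}.
Proof.
move=> if_.
have := esum_translates_fin (cintegrable_modulus if_) (fun x => modulus_ge0 (f x)).
by apply: aeS => x; exact: zsum_psum.
Qed.

Lemma perM f nu : (forall x (j : int), nu (x + j%:~R) = nu x) -> cintegrable f ->
  cintegrable (fun x => nu x * f x) ->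
  {ae mu R, forall x, per (fun x => nu x * f x) x = nu x * per f x}.
Proof.
move=> nuP if_ inf; apply: aeS2 (per_zsum if_) (per_zsum inf) => x h1 h2.
apply: zsum_unique h2 _.
rewrite (_ : (fun k => _) = fun k => nu x * f (x + k%:~R)); first exact: zsumZ.
by apply/funext => k; rewrite nuP.
Qed.

End Periodize.

(** * Periodic multipliers and weighted norms *)

Section PeriodicMultipliers.
Variable R : realType.
Implicit Types (a b nu : R -> R[i]).

Definition periodic nu := forall x (k : int), nu (x + k%:~R) = nu x.

Lemma periodic_int nu : (forall x, nu (x + 1) = nu x) -> periodic nu.
Proof.
move=> h; have hn x (n : nat) : nu (x + n%:R) = nu x.
  by elim: n => [|n IH]; rewrite ?addr0// -natr1 addrA h IH.
move=> x [n|n]; first exact: hn.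
by rewrite NegzE rmorphN /= -[LHS](hn _ n.+1) subrK.
Qed.

Definition ae_bounded nu (C : R) := {ae mu R, forall x, modulus (nu x) <= C}.

Lemma L2_ae_bounded_mul a nu (C : R) : 0 <= C -> cmeasurable nu -> ae_bounded nu C -> L2 a ->
  L2 (fun x => nu x * a x) /\ nrm (fun x => nu x * a x) <= C * nrm a.
Proof.
move=> C0 mn hn la; apply: (L2_le_nrm C0 la).
  by apply: cmeasurableM => //; exact: L2_measurable.
by apply: aeS hn => x h; rewrite modulusM ler_wpM2r ?modulus_ge0.
Qed.

Lemma L2_indicU : L2 (fun x : R => (\1_(@U R) x)%:C%C).
Proof. by have := L2_circ R 0; congr L2; apply/funext => x; rewrite /circ char0 mulr1. Qed.

Lemma ae_bounded_mul nu nu' C C' : 0 <= C -> ae_bounded nu C -> ae_bounded nu' C' ->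
  ae_bounded (fun x => nu x * nu' x) (C * C').
Proof.
by move=> C0; apply: aeS2 => x h h'; rewrite modulusM ler_pM ?modulus_ge0.
Qed.

Lemma Cper_ae_bounded nu : Cper +oo%E nu -> [/\ cmeasurable nu, periodic nu &
  exists2 C, 0 <= C & ae_bounded nu C].
Proof.
move=> [mnu /periodic_int pnu]; rewrite unlock /= => h.
split => //.
have [C hC] : exists C : R, {ae mu R, forall x, @U R x -> modulus (nu x) <= C}.
  (* The norm at exponent [+oo] is an essential supremum when the total mass is positive; here it is
     1. *)
  move: h; case: ifPn => [_|/negP[]]; last first.
    rewrite /mrestr setTI.
    have -> : (mu R `[0%R, 1%R[ = 1)%E by rewrite lebesgue_measure_itv /= lte_fin ltr01 -EFinB subr0.
    by rewrite lte_fin ltr01.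
  rewrite (_ : abse \o _ = EFin \o (fun x => `|modulus (nu x)|)); last exact/funext.
  move=> /ess_sup_inf.ess_supr_bounded[C [N [mN N0 hN]]]; exists C.
  exists (N `&` @U R); split; first by apply: measurableI => //; exact: measurable_U.
    exact: N0.
  move=> x /= /not_implyP[Ux hx]; split => //; apply: hN => /= h; apply: hx.
  by rewrite -[leLHS]ger0_norm ?modulus_ge0.
exists (Num.max C 0); first by rewrite le_max lexx orbT.
apply: ae_periodic; first by move=> x k; rewrite pnu.
by apply: aeS hC => x hx Ux; rewrite le_max hx.
Qed.

Lemma esumZ (r : R) (u : int -> R) : 0 <= r -> (forall k, 0 <= u k) ->
  (\esum_(k in [set: int]) (r * u k)%:E = r%:E * \esum_(k in [set: int]) (u k)%:E)%E.
Proof.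
move=> r0 u0; rewrite !esum_int_nat; last 2 first.
- by move=> k; rewrite lee_fin.
- by move=> k; rewrite lee_fin mulr_ge0.
rewrite -nneseriesZl//; last by move=> n _; rewrite lee_fin.
Qed.

Lemma fine_ZM (r : R) (x : \bar R) : (0 <= x)%E -> 0 <= r -> fine (r%:E * x)%E = r * fine x.
Proof.
case: x => [y _ _ //|_|//]; rewrite le_eqVlt => /orP[/eqP<-|r0].
  by rewrite mul0e mul0r.
by rewrite gt0_muley ?lte_fin//= mulr0.
Qed.

Lemma periodization_mul a nu x : periodic nu ->
  periodization (fun y => nu y * a y) x =
  ((modulus (nu x) ^+ 2)%:E * periodization a x)%E.
Proof.
move=> pnu; rewrite -esumZ ?sqr_ge0//; last by move=> k; exact: sqr_ge0.
by apply: eq_esum => k _; rewrite pnu modulusM exprMn.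
Qed.

Lemma periodization_ge0 a x : (0 <= periodization a x)%E.
Proof. by apply: esum_ge0 => k _; rewrite lee_fin sqr_ge0. Qed.

Lemma periodization_periodic a x (j : int) : periodization a (x + j%:~R) = periodization a x.
Proof. exact: (@esum_translates_periodic _ (fun y => modulus (a y) ^+ 2) x j (fun y => sqr_ge0 _)). Qed.

(** A periodic factor comes out of the sum over translates, so the norm on the line is a norm over
    one period with weight the periodization of [|a|^2]. *)
Lemma nrm_periodic_mul a nu : periodic nu -> L2 (fun x => nu x * a x) ->
  integrableR (fun x => (\1_(@U R) x * (modulus (nu x) ^+ 2 * fine (periodization a x)))%:E) /\
  nrm (fun x => nu x * a x) ^+ 2 =
  \int[mu R]_x (\1_(@U R) x * (modulus (nu x) ^+ 2 * fine (periodization a x))).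
Proof.
move=> pnu l; have [i E] := Rintegral_esum_translates (L2_integrable l) (fun x => sqr_ge0 _).
have F x : fine (esum_translates (fun x => modulus (nu x * a x) ^+ 2) x) =
    modulus (nu x) ^+ 2 * fine (periodization a x).
  have := periodization_mul a x pnu; rewrite /periodization /esum_translates => ->.
  by rewrite fine_ZM ?sqr_ge0//; exact: periodization_ge0.
split; first by under eq_fun do rewrite -F.
by rewrite nrm_sqr -E; under eq_Rintegral do rewrite F.
Qed.

Lemma periodization_fin a : L2 a -> {ae mu R, forall x, (periodization a x < +oo)%E}.
Proof. by move=> la; exact: (esum_translates_fin (L2_integrable la) (fun x => sqr_ge0 _)). Qed.

Lemma Rintegral_ge0_ae (u : R -> R) : measurable_fun setT u ->
  {ae mu R, forall x, 0 <= u x} -> 0 <= \int[mu R]_x u x.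
Proof.
move=> mu_ u0; rewrite (@ae_eq_Rintegral _ u (fun x => `|u x|))//.
- by apply: Rintegral_ge0.
- exact: measurableT_comp.
- by apply: aeS u0 => x h; rewrite ger0_norm.
Qed.

Lemma nrm_indicU_mul nu (C : R) : 0 <= C -> cmeasurable nu -> ae_bounded nu C ->
  integrableR (fun x => (\1_(@U R) x * modulus (nu x) ^+ 2)%:E) /\
  nrm (fun x => (\1_(@U R) x)%:C%C * nu x) ^+ 2 =
    \int[mu R]_x (\1_(@U R) x * modulus (nu x) ^+ 2).
Proof.
move=> C0 mnu bnu; split; last first.
  rewrite nrm_sqr; apply: eq_Rintegral => x _.
  by rewrite modulusM modulus_real exprMn real_normK ?num_real// sqr_indicU.
have := L2_integrable (L2_ae_bounded_mul C0 mnu bnu L2_indicU).1.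
congr (integrable _ _ _); apply/funext => x; congr EFin.
by rewrite modulusM modulus_real exprMn real_normK ?num_real// sqr_indicU mulrC.
Qed.

(** This is how smallness of a multiplier on the circle becomes smallness of its product with a
    transform on the line. *)
Lemma nrm_periodic_mul_le a nu (beta C : R) : 0 <= C -> L2 a ->
  {ae mu R, forall x, (periodization a x <= beta%:E)%E} -> periodic nu ->
  cmeasurable nu -> ae_bounded nu C ->
  nrm (fun x => nu x * a x) ^+ 2 <=
  beta * nrm (fun x => (\1_(@U R) x)%:C%C * nu x) ^+ 2.
Proof.
move=> C0 la hb pnu mnu bnu.
have [i ->] := nrm_periodic_mul pnu (L2_ae_bounded_mul C0 mnu bnu la).1.
have [ic Ec] := nrm_indicU_mul C0 mnu bnu.
rewrite Ec -RintegralZl// -subr_ge0 -RintegralB//; last exact: integrableRZ.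
apply: Rintegral_ge0_ae.
  by apply: integrableR_EFin; apply: integrableRB => //; exact: integrableRZ.
apply: aeS hb => x h.
have {}h : fine (periodization a x) <= beta.
  move: h (periodization_ge0 a x); case: (periodization a x) => //= h _.
rewrite (_ : _ - _ = \1_(@U R) x * modulus (nu x) ^+ 2 * (beta - fine (periodization a x))).
  by apply: mulr_ge0; [rewrite mulr_ge0 ?indicU_ge0 ?sqr_ge0|rewrite subr_ge0].
by ring.
Qed.

End PeriodicMultipliers.

(** * The bracket and the Bessel bound on the frequency side *)

Section Bracket.
Variable R : realType.
Implicit Types (a b f phi psi nu : R -> R[i]).

Lemma trig_ae_bounded (A : {fset int}) c :
  0 <= \sum_(k <- A) modulus (c k) /\
  ae_bounded (lincomb A c (@chi R)) (\sum_(k <- A) modulus (c k)).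
Proof.
split; first by apply: sumr_ge0 => k _; exact: modulus_ge0.
by apply: aeT => x; exact: trig_bounded.
Qed.

Lemma L2_trig_mul (A : {fset int}) c a : L2 a -> L2 (fun x => lincomb A c chi x * a x).
Proof.
have [C0 bp] := trig_ae_bounded A c.
by move=> /(L2_ae_bounded_mul C0 (cmeasurable_trig A c) bp) [].
Qed.

Lemma nrm_lincomb_translates (A : {fset int}) c phi : L2 phi ->
  nrm (lincomb A c (translates phi)) = nrm (fun x => lincomb A c chi x * fourier phi x).
Proof.
move=> lphi; have lF := L2_fourier lphi.
have ll : L2 (lincomb A c (translates phi)) by apply: L2_lincomb => k; exact: L2_translates.
rewrite -(fourierP ll).2; apply: ae_nrm.
- by apply: L2_measurable; exact: L2_fourier.
- by apply: L2_measurable; exact: L2_trig_mul.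
- exact: fourier_lincomb.
Qed.

(** Against [|p|^2] the weight [w] integrates to [beta * sum |c k|^2] minus the squared norm of the
    combination of translates, which the Riesz bound makes nonnegative; [weight_ge0] does the
    rest. *)
Lemma bessel_periodization_le phi (beta : R) : 0 <= beta -> L2 phi ->
  riesz_bound (translates phi) beta ->
  {ae mu R, forall x, (periodization (fourier phi) x <= beta%:E)%E}.
Proof.
move=> beta0 lphi [_ hb]; have lF := L2_fourier lphi; set a := fourier phi in lF *.
pose w x := beta * \1_(@U R) x - \1_(@U R) x * fine (periodization a x).
have key (A : {fset int}) c :
    integrableR (fun x => (modulus (lincomb A c (@chi R) x) ^+ 2 * w x)%:E) /\
    0 <= \int[mu R]_x (modulus (lincomb A c (@chi R) x) ^+ 2 * w x).
  have [C0 bp] := trig_ae_bounded A c.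
  have [i1 E1] := nrm_indicU_mul C0 (cmeasurable_trig A c) bp.
  have [i2 E2] := @nrm_periodic_mul _ a _ (trig_periodic A c) (L2_trig_mul A c lF).
  have E x : modulus (lincomb A c (@chi R) x) ^+ 2 * w x =
      beta * (\1_(@U R) x * modulus (lincomb A c (@chi R) x) ^+ 2) -
      \1_(@U R) x * (modulus (lincomb A c (@chi R) x) ^+ 2 * fine (periodization a x)).
    by rewrite /w; ring.
  split; first by under eq_fun do rewrite E; apply: integrableRB => //; exact: integrableRZ.
  under eq_Rintegral do rewrite E.
  rewrite RintegralB//; last exact: integrableRZ.
  rewrite RintegralZl// integral_trig_sqr -E2 -nrm_lincomb_translates// subr_ge0.
  exact: hb.
have iw : integrableR (fun x => (w x)%:E).
  (* The constant polynomial 1 gives integrability of the weight itself. *)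
  have [+ _] := key [fset 0]%fset (fun=> 1).
  congr (integrable _ _ _); apply/funext => x; congr EFin.
  by rewrite /lincomb big_seq_fset1 mul1r modulus_char expr1n mul1r.
have : {ae mu R, forall x, 0 <= w x}.
  apply: weight_ge0 => //.
    by move=> x Ux; rewrite /w indicE memNset// mulr0 mul0r subr0.
  move=> P; have [A [c E]] := poly_chi P.
  by under eq_Rintegral do rewrite E; exact: (key A c).2.
move=> w0; apply: ae_periodic; first by move=> x k; rewrite periodization_periodic.
apply: aeS2 w0 (periodization_fin lF) => x.
rewrite /w => h Pfin Ux; move: h; rewrite indicE mem_set//= mulr1 mul1r subr_ge0 => h.
rewrite -[leLHS]fineK ?lee_fin//.
by rewrite ge0_fin_numE// periodization_ge0.
Qed.

(* A representative of [bracket a b] that is periodic and measurable everywhere. *)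
Definition pbracket a b : R -> R[i] := per (fun x => a x * conjc (b x)).

Lemma cmeasurable_pbracket a b : L2 a -> L2 b -> cmeasurable (pbracket a b).
Proof.
move=> /L2_measurable ma /L2_measurable mb; apply: cmeasurable_per.
by apply: cmeasurableM => //; exact: cmeasurable_conjc.
Qed.

Lemma pbracket_periodic a b : periodic (pbracket a b).
Proof. by move=> x k; exact: per_periodic. Qed.

Lemma pbracketC a b x : pbracket b a x = conjc (pbracket a b x).
Proof.
rewrite /pbracket /per -psum_conjc; congr psum; apply/funext => k.
by rewrite conjcM conjcK mulrC.
Qed.

Lemma bracket_pbracket a b : L2 a -> L2 b ->
  {ae mu R, forall x, bracket a b x = pbracket a b x}.
Proof.
move=> la lb; apply: aeS (per_zsum (L2M_cintegrable la lb)) => x.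
exact: Zsum_zsum.
Qed.

(** Any finite bound serves; [s t <= s^2 + t^2] spares the square roots of Cauchy-Schwarz. *)
Lemma pbracket_bounded a b (beta beta' : R) : L2 a -> L2 b ->
  {ae mu R, forall x, (periodization a x <= beta%:E)%E} ->
  {ae mu R, forall x, (periodization b x <= beta'%:E)%E} ->
  ae_bounded (pbracket a b) (beta + beta').
Proof.
move=> la lb ha hb.
have hA : {ae mu R, forall x, forall A : {fset int}, \sum_(k <- A)
    modulus (a (x + k%:~R) * conjc (b (x + k%:~R))) <= beta + beta'}.
  2: by apply: aeS2 (per_zsum (L2M_cintegrable la lb)) hA => x; exact: zsum_le.
apply: aeS2 ha hb => x /esum_le_sumP h1 /esum_le_sumP h2 A.
have {}h1 := h1 (fun k => sqr_ge0 _) A; have {}h2 := h2 (fun k => sqr_ge0 _) A.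
apply: le_trans (lerD h1 h2); rewrite -big_split /=; apply: ler_sum => k _.
rewrite modulusM modulus_conjc.
have := modulus_ge0 (a (x + k%:~R)); have := modulus_ge0 (b (x + k%:~R)).
by move: (modulus _) (modulus _) => s t; nra.
Qed.

Lemma cintegral_pbracket a b nu (C : R) : 0 <= C -> L2 a -> L2 b -> periodic nu ->
  cmeasurable nu -> ae_bounded nu C ->
  cintegral (fun x => nu x * (a x * conjc (b x))) =
  cintegral (fun x => (\1_(@U R) x)%:C%C * (nu x * pbracket a b x)).
Proof.
move=> C0 la lb pnu mnu bnu.
have i1 := L2M_cintegrable la lb.
have i2 : cintegrable (fun x => nu x * (a x * conjc (b x))).
  rewrite (_ : (fun x => _) = fun x => (nu x * a x) * conjc (b x)).
    exact: L2M_cintegrable (L2_ae_bounded_mul C0 mnu bnu la).1 lb.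
  by apply/funext => x; rewrite mulrA.
rewrite -cintegral_per//.
have mU : cmeasurable (fun x => (\1_(@U R) x)%:C%C : R[i]).
  by apply: L2_measurable; exact: L2_indicU.
apply: ae_eq_cintegral.
- by apply: cmeasurableM => //; apply: cmeasurable_per; exact: cintegrable_measurable.
- by apply: cmeasurableM => //; apply: cmeasurableM => //; exact: cmeasurable_pbracket.
- by apply: aeS (perM pnu i1 i2) => x ->.
Qed.

Lemma fourier_translates f k : L2 f ->
  {ae mu R, forall xi, fourier (translates f k) xi = chi k xi * fourier f xi}.
Proof.
move=> lf; apply: is_fourier_unique (fourierP (L2_translates k lf)).1 _.
exact: is_fourier_translates (fourierP lf).1.
Qed.

(** On the frequency side [nu] commutes with the trigonometric polynomial, so it costs at most the
    factor [C] in norm. *)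
Lemma riesz_bound_multiplier phi psi nu (beta C : R) : 0 <= C -> L2 phi -> L2 psi ->
  riesz_bound (translates phi) beta -> cmeasurable nu -> ae_bounded nu C ->
  {ae mu R, forall x, fourier psi x = nu x * fourier phi x} ->
  riesz_bound (translates psi) (C ^+ 2 * beta).
Proof.
move=> C0 lphi lpsi [_ hb] mnu bnu E; split; first by move=> k; exact: L2_translates.
move=> A c; have lF := L2_fourier lphi; have lP := L2_fourier lpsi.
have lt := L2_trig_mul A c lF.
have [l2 h] := L2_ae_bounded_mul C0 mnu bnu lt.
rewrite nrm_lincomb_translates// (@ae_nrm _ _ (fun x => nu x * (lincomb A c chi x * fourier phi x))).
- rewrite -mulrA; apply: le_trans (ler_wpM2l (sqr_ge0 C) (hb A c)).
  rewrite nrm_lincomb_translates// -exprMn.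
  by rewrite ler_pXn2r// nnegrE ?mulr_ge0 ?nrm_ge0.
- by apply: L2_measurable; exact: L2_trig_mul.
- exact: L2_measurable.
- by apply: aeS E => x ->; ring.
Qed.

End Bracket.

(** * Translation-invariant systems *)

Section BesselFamilies.
Variable R : realType.
Implicit Types (f phi : R -> R[i]) (F : int -> R -> R[i]).

Lemma bessel_of_riesz F (b : R) (W : set (R -> R[i])) : 0 <= b -> riesz_bound F b ->
  W `<=` @L2 R -> (forall k, W (F k)) -> bessel W F.
Proof.
move=> b0 hb WL WF; split => //; exists b => f /WL lf.
rewrite L2normE// -EFin_expe -EFinM.
apply/esum_le_sumP; first by move=> k; exact: sqr_ge0.
exact: (riesz_boundP b0 hb.1).1 hb f lf.
Qed.

Lemma riesz_of_bessel F : bessel (@L2 R) F -> exists2 b, 0 <= b & riesz_bound F b.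
Proof.
(* The constant in [bessel] carries no sign. *)
move=> [lF [b hb]]; have b0 : 0 <= Num.max b 0 by rewrite le_max lexx orbT.
exists (Num.max b 0) => //; apply/(riesz_boundP b0 lF) => f lf.
apply/esum_le_sumP; first by move=> k; exact: sqr_ge0.
apply: le_trans (hb f lf) _; rewrite L2normE// -EFin_expe -EFinM lee_fin.
by rewrite ler_wpM2r ?sqr_ge0// le_max lexx.
Qed.

Lemma translates_lincomb (A : {fset int}) c phi k : exists (B : {fset int}) d,
  translates (lincomb A c (translates phi)) k = lincomb B d (translates phi).
Proof.
have uA : uniq [seq j + k | j <- enum_fset A].
  by rewrite map_inj_uniq ?fset_uniq//; exact: addIr.
exists (seq_fset tt [seq j + k | j <- enum_fset A]), (fun j => c (j - k)).
apply/funext => x; rewrite /lincomb big_seq_fset// big_map.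
apply: eq_bigr => j _; rewrite addrK; congr (_ * phi _).
by rewrite rmorphD /= opprD addrA addrAC.
Qed.

Lemma closed_span_translates phi f k : L2 phi -> closed_span (translates phi) f ->
  closed_span (translates phi) (translates f k).
Proof.
move=> lphi; have lk j : L2 (translates phi j) by exact: L2_translates.
move=> /(closed_spanP _ lk)[lf hf]; apply/(closed_spanP _ lk); split.
  exact: L2_translates.
move=> e /hf[A [c hA]]; have [B [d E]] := translates_lincomb A c phi k.
exists B, d; rewrite -E; apply: le_lt_trans hA.
have lA : L2 (lincomb A c (translates phi)) by exact: L2_lincomb.
by have [_ <-] := L2_shift (- k%:~R) (L2B lf lA).
Qed.

End BesselFamilies.

(** * The mixed frame operator as a multiplier, the equivalence and the frame bounds *)

Section Equivalence.
Variable R : realType.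
Variables (phi phi1 phit H : R -> R[i]) (beta beta1 C : R).
Hypotheses (lphi : L2 phi) (lphi1 : L2 phi1) (lphit : L2 phit).
Hypotheses (beta0 : 0 <= beta) (rb : riesz_bound (translates phi) beta).
Hypotheses (beta10 : 0 <= beta1) (rb1 : riesz_bound (translates phi1) beta1).
Hypotheses (mH : cmeasurable H) (pH : periodic H) (C0 : 0 <= C) (bH : ae_bounded H C).
Hypothesis Fphit : {ae mu R, forall xi, fourier phit xi = H xi * fourier phi1 xi}.

Let a := fourier phi.
Let b := fourier phi1.
Let la : L2 a. Proof. exact: L2_fourier. Qed.
Let lb : L2 b. Proof. exact: L2_fourier. Qed.
Let lphik k : L2 (translates phi k). Proof. exact: L2_translates. Qed.

Definition symbol (x : R) : R[i] := conjc (H x) * pbracket a b x.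

Lemma cmeasurable_symbol : cmeasurable symbol.
Proof. by apply: cmeasurableM; [exact: cmeasurable_conjc|exact: cmeasurable_pbracket]. Qed.

Lemma symbol_periodic : periodic symbol.
Proof. by move=> x k; rewrite /symbol pH pbracket_periodic. Qed.

Lemma symbol_bounded : ae_bounded symbol (C * (beta + beta1)).
Proof.
apply: ae_bounded_mul => //; first by apply: aeS bH => x; rewrite modulus_conjc.
by apply: pbracket_bounded => //; exact: bessel_periodization_le.
Qed.

Let D0 : 0 <= C * (beta + beta1). Proof. by rewrite mulr_ge0// addr_ge0. Qed.

Section OneSymbol.
Variables (A : {fset int}) (c : int -> R[i]).
Let p := lincomb A c (@chi R).
Let f := lincomb A c (translates phi).
Let g x := (\1_(@U R) x)%:C%C * (p x * symbol x).
Let lf : L2 f. Proof. exact: L2_lincomb. Qed.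
Let mp : cmeasurable p. Proof. exact: cmeasurable_trig. Qed.
Let bps : ae_bounded (fun x => p x * symbol x)
  ((\sum_(k <- A) modulus (c k)) * (C * (beta + beta1))).
Proof. by have [? ?] := trig_ae_bounded A c; apply: ae_bounded_mul => //; exact: symbol_bounded. Qed.
Let K0 : 0 <= (\sum_(k <- A) modulus (c k)) * (C * (beta + beta1)).
Proof. by rewrite mulr_ge0//; exact: (trig_ae_bounded A c).1. Qed.
Let mps : cmeasurable (fun x => p x * symbol x).
Proof. by apply: cmeasurableM => //; exact: cmeasurable_symbol. Qed.
Let lg : L2 g.
Proof.
rewrite (_ : g = fun x => (p x * symbol x) * (\1_(@U R) x)%:C%C); last first.
  by apply/funext => x; rewrite /g mulrC.
exact: (L2_ae_bounded_mul K0 mps bps (L2_indicU R)).1.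
Qed.

(** Folding turns an inner product over the line into a Fourier coefficient over one period. The
    index is [- k] because translation by [k] becomes multiplication by [chi k = char (- k)]. *)
Lemma analysis_trig k : inner f (translates phit k) = inner g (circ (- k)).
Proof.
have lFt := L2_fourier lphit.
have lk : L2 (translates phit k) by exact: L2_translates.
rewrite -inner_fourier//.
rewrite (@ae_inner _ _ (fun x => p x * a x) _ (fun x => chi k x * (H x * b x))); last 6 first.
- by apply: L2_measurable; exact: L2_fourier.
- by apply: L2_measurable; exact: L2_trig_mul.
- by apply: L2_measurable; exact: L2_fourier.
- apply: cmeasurableM; first exact: cmeasurable_char.
  by apply: cmeasurableM => //; exact: L2_measurable.
- exact: fourier_lincomb.
- by apply: aeS2 (fourier_translates k lphit) Fphit => x -> ->.
pose nu x := char k x * (p x * conjc (H x)).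
have [p0 bp] := trig_ae_bounded A c.
have bnu : ae_bounded nu (1 * ((\sum_(k <- A) modulus (c k)) * C)).
  apply: ae_bounded_mul => //; first by apply: aeT => x; rewrite modulus_char.
  by apply: ae_bounded_mul => //; apply: aeS bH => x; rewrite modulus_conjc.
have mnu : cmeasurable nu.
  apply: cmeasurableM; first exact: cmeasurable_char.
  by apply: cmeasurableM => //; exact: cmeasurable_conjc.
have pnu : periodic nu.
  by move=> x j; rewrite /nu char_periodic [p _]trig_periodic pH.
have K0' : 0 <= 1 * ((\sum_(k <- A) modulus (c k)) * C) by rewrite mul1r mulr_ge0.
transitivity (cintegral (fun x => nu x * (a x * conjc (b x)))).
  congr cintegral; apply/funext => x.
  by rewrite !conjcM /chi conjc_char opprK /nu; ring.
rewrite (cintegral_pbracket K0' la lb pnu mnu bnu); congr cintegral; apply/funext => x.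
rewrite /g /nu /symbol /circ conjcM conjc_indicU conjc_char opprK.
have := sqr_indicU x; set i := \1_U x => hi.
have {}hi : i%:C%C * i%:C%C = i%:C%C :> R[i] by rewrite -rmorphM -expr2 hi.
by rewrite -[X in X * _ = _]hi; ring.
Qed.

(** The Fourier series of [p * symbol] on the circle, reindexed by negation: its coefficients are
    the analysis coefficients of [f]. *)
Lemma trig_net_limit e : 0 < e -> exists A0 : {fset int}, forall B : {fset int},
  (A0 `<=` B)%fset -> nrm (fun x => (\1_(@U R) x)%:C%C *
    (p x * symbol x - lincomb B (analysis (translates phit) f) chi x)) <= e.
Proof.
move=> e0.
have g0 x : ~ U x -> g x = 0 by move=> Ux; rewrite /g indicE memNset// mul0r.
have [h _] := circle_parseval lg g0.
have [A0 hA0] := h e e0.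
pose opp (S : {fset int}) : {fset int} := seq_fset tt [seq - k | k <- enum_fset S].
have uS (S : {fset int}) : uniq [seq - k | k <- enum_fset S].
  by rewrite map_inj_uniq ?fset_uniq//; exact: oppr_inj.
exists (opp A0) => B hB.
have {}hB : (A0 `<=` opp B)%fset.
  apply/fsubsetP => k kA; rewrite seq_fsetE; apply/mapP; exists (- k); rewrite ?opprK//.
  by apply: (fsubsetP hB); rewrite seq_fsetE; apply/mapP; exists k.
have := hA0 _ hB; congr (nrm _ <= _); apply/funext => x /=.
rewrite mulrBr lincomb_circ; congr (_ - _ * _).
rewrite /lincomb big_seq_fset// big_map; apply: eq_bigr => k _.
by rewrite /analysis analysis_trig.
Qed.

(** The transformed partial sums have two limits: the transform of [s], by isometry, and
    [p * symbol * a], since the bound on the periodization of [a] carries the convergence on the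
    circle over to the line. Limits are unique up to a null set. *)
Lemma fourier_synthesis s : L2 s ->
  net_limit (translates phi) (analysis (translates phit) f) s ->
  {ae mu R, forall xi, fourier s xi = p xi * symbol xi * a xi}.
Proof.
move=> ls hs; set cf := analysis _ _ in hs.
have lG : L2 (fun x => p x * symbol x * a x).
  exact: (L2_ae_bounded_mul K0 mps bps la).1.
have lFs := L2_fourier ls.
pose F (k : int) x := chi k x * a x.
have lF k : L2 (F k) by exact: (L2_chiM k la).1.
have FE (B : {fset int}) x : lincomb B cf F x = lincomb B cf chi x * a x.
  by rewrite /lincomb mulr_suml; apply: eq_bigr => k _; rewrite mulrA.
have h1 : net_limit F cf (fourier s).
  move=> e /hs[A0 hA0]; exists A0 => B /hA0; congr (_ <= _).
  have lB : L2 (lincomb B cf (translates phi)) by exact: L2_lincomb.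
  rewrite -(fourierP (L2B ls lB)).2; apply: ae_nrm.
  - by apply: L2_measurable; apply: L2_fourier; exact: L2B.
  - by apply: L2_measurable; apply: L2B => //; exact: L2_lincomb.
  - have := is_fourier_unique (fourierP (L2B ls lB)).1 (is_fourierB (fourierP ls).1 (fourierP lB).1).
    by apply: aeS2 (fourier_lincomb B cf lphi) => x h -> /=; rewrite FE h.
have h2 : net_limit F cf (fun x => p x * symbol x * a x).
  (* Chosen so that [beta * (e / (beta + 1))^2 <= e^2], also for [beta = 0]. *)
  move=> e e0; have be : 0 < e / (beta + 1) by rewrite divr_gt0// ltr_wpDl.
  have [A0 hA0] := trig_net_limit be; exists A0 => B /hA0 hB.
  pose nu x := p x * symbol x - lincomb B cf chi x.
  have [q0 bq] := trig_ae_bounded B cf.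
  have bnu : ae_bounded nu ((\sum_(k <- A) modulus (c k)) * (C * (beta + beta1)) +
      \sum_(k <- B) modulus (cf k)).
    apply: aeS2 bps bq => x u v; apply: le_trans (modulusD _ _) _.
    by rewrite modulusN lerD.
  have mnu : cmeasurable nu by apply: cmeasurableB => //; exact: cmeasurable_trig.
  have pnu : periodic nu.
    by move=> x j; rewrite /nu [p _]trig_periodic symbol_periodic trig_periodic.
  rewrite (_ : _ \- _ = fun x => nu x * a x); last first.
    by apply/funext => x; rewrite /= FE /nu mulrBl.
  apply: sqr_le_le; first exact: ltW.
  have := nrm_periodic_mul_le (addr_ge0 K0 q0) la (bessel_periodization_le beta0 lphi rb) pnu mnu bnu.
  move/le_trans; apply; apply: (@le_trans _ _ (beta * (e / (beta + 1)) ^+ 2)).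
    by rewrite ler_wpM2l// ler_pXn2r ?nnegrE ?nrm_ge0//; exact: ltW.
  have b1 : 0 < beta + 1 by rewrite ltr_wpDl.
  rewrite expr_div_n mulrCA; apply: ler_piMr; first exact: sqr_ge0.
  by rewrite ler_pdivrMr ?exprn_gt0// mul1r; nra.
have := net_limit_unique lF lFs lG h1 h2.
move/(nrm_eq0_ae (L2B lFs lG)); apply: aeS => x /eqP.
by rewrite subr_eq0 => /eqP.
Qed.

Lemma nrm_sub_synthesis s : L2 s ->
  net_limit (translates phi) (analysis (translates phit) f) s ->
  integrableR (fun x => (\1_(@U R) x *
    (modulus (p x * (1 - symbol x)) ^+ 2 * fine (periodization a x)))%:E) /\
  nrm (f \- s) ^+ 2 = \int[mu R]_x (\1_(@U R) x *
    (modulus (p x * (1 - symbol x)) ^+ 2 * fine (periodization a x))).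
Proof.
move=> ls hs; have lfs := L2B lf ls.
have lG : L2 (fun x => p x * symbol x * a x).
  exact: (L2_ae_bounded_mul K0 mps bps la).1.
have l1 : L2 (fun x => p x * (1 - symbol x) * a x).
  rewrite (_ : (fun x => _) = (fun x => p x * a x) \- (fun x => p x * symbol x * a x)).
    by apply: L2B => //; exact: L2_trig_mul.
  by apply/funext => x /=; ring.
have pp : periodic (fun x => p x * (1 - symbol x)).
  by move=> x j; rewrite [p _]trig_periodic symbol_periodic.
have [i <-] := nrm_periodic_mul pp l1; split => //.
rewrite -(fourierP lfs).2; congr (_ ^+ 2); apply: ae_nrm.
- by apply: L2_measurable; exact: L2_fourier.
- exact: L2_measurable.
- have := is_fourier_unique (fourierP lfs).1 (is_fourierB (fourierP lf).1 (fourierP ls).1).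
  have := aeS2 (fun x h1 h2 => conj h1 h2) (fourier_lincomb A c lphi) (fourier_synthesis ls hs).
  by apply: aeS2 => x [h1 h2] -> /=; rewrite h1 h2 -/p -/a; ring.
Qed.

End OneSymbol.

Let bt := C ^+ 2 * beta1.
Let bt0 : 0 <= bt. Proof. by rewrite mulr_ge0 ?sqr_ge0. Qed.

Lemma riesz_bound_phit : riesz_bound (translates phit) bt.
Proof. exact: riesz_bound_multiplier rb1 mH bH Fphit. Qed.

Lemma analysis_phit_le f : L2 f -> forall A : {fset int},
  \sum_(k <- A) modulus (analysis (translates phit) f k) ^+ 2 <= bt * nrm f ^+ 2.
Proof.
move=> lf; apply: (riesz_boundP bt0 (fun k => L2_translates k lphit)).1 lf.
exact: riesz_bound_phit.
Qed.

Definition frame_op f := synthesis (translates phi) (analysis (translates phit) f).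

Lemma frame_opP f : L2 f -> L2 (frame_op f) /\
  net_limit (translates phi) (analysis (translates phit) f) (frame_op f).
Proof. by move=> lf; exact: (synthesisP beta0 rb (analysis_phit_le lf)). Qed.

(** Each value of [frame_op] is a separately chosen representative, so continuity is stated as an
    estimate on norms; this is what the passage to the closure uses. *)
Lemma frame_op_lipschitz f g : L2 f -> L2 g ->
  nrm (frame_op f \- frame_op g) <= Num.sqrt (beta * bt) * nrm (f \- g).
Proof.
move=> lf lg; have [lSf hf] := frame_opP lf; have [lSg hg] := frame_opP lg.
have lk k : L2 (translates phit k) by exact: L2_translates.
apply: sqr_le_le; first by rewrite mulr_ge0 ?sqrtr_ge0 ?nrm_ge0.
rewrite exprMn sqr_sqrtr ?mulr_ge0// -mulrA.
have := net_limitB lphik lSf lSg hf hg.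
apply: (net_limit_nrm beta0 rb (L2B lSf lSg)) => A.
have := analysis_phit_le (L2B lf lg) A; congr (_ <= _); apply: eq_bigr => k _.
by rewrite /analysis innerBl.
Qed.

Lemma nrm_lincomb_weight (A : {fset int}) c :
  integrableR (fun x => (\1_(@U R) x *
    (modulus (lincomb A c (@chi R) x) ^+ 2 * fine (periodization a x)))%:E) /\
  nrm (lincomb A c (translates phi)) ^+ 2 = \int[mu R]_x (\1_(@U R) x *
    (modulus (lincomb A c (@chi R) x) ^+ 2 * fine (periodization a x))).
Proof.
rewrite nrm_lincomb_translates//; apply: nrm_periodic_mul; first exact: trig_periodic.
exact: L2_trig_mul.
Qed.

(** The density whose integral against [|p|^2] is [eps^2 ||f||^2 - ||f - S f||^2]: (i) on the span
    is the sign of these integrals, (ii) the sign of the density. *)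
Definition approx_weight (eps : R) (x : R) : R :=
  \1_(@U R) x * ((eps ^+ 2 - modulus (1 - symbol x) ^+ 2) * fine (periodization a x)).

Lemma approx_weight_trig (eps : R) (A : {fset int}) c :
  integrableR (fun x => (modulus (lincomb A c (@chi R) x) ^+ 2 * approx_weight eps x)%:E) /\
  \int[mu R]_x (modulus (lincomb A c (@chi R) x) ^+ 2 * approx_weight eps x) =
  eps ^+ 2 * nrm (lincomb A c (translates phi)) ^+ 2 -
  nrm (lincomb A c (translates phi) \- frame_op (lincomb A c (translates phi))) ^+ 2.
Proof.
have lf : L2 (lincomb A c (translates phi)) by exact: L2_lincomb.
have [lS hS] := frame_opP lf.
have [i1 ->] := nrm_lincomb_weight A c.
have [i2 ->] := nrm_sub_synthesis lS hS.
have E x : modulus (lincomb A c (@chi R) x) ^+ 2 * approx_weight eps x =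
   eps ^+ 2 * (\1_(@U R) x *
    (modulus (lincomb A c (@chi R) x) ^+ 2 * fine (periodization a x))) -
   \1_(@U R) x * (modulus (lincomb A c (@chi R) x * (1 - symbol x)) ^+ 2 *
      fine (periodization a x)).
  by rewrite /approx_weight modulusM; ring.
have i3 := integrableRZ (eps ^+ 2) i1.
split; first by under eq_fun do rewrite E; exact: integrableRB.
by under eq_Rintegral do rewrite E; rewrite RintegralB// RintegralZl.
Qed.

(** Finite combinations suffice, since they correspond to the trigonometric polynomials against
    which [weight_ge0] tests [approx_weight]. *)
Lemma symbol_near1_of_approx (eps : R) : 0 <= eps ->
  (forall A c, nrm (lincomb A c (translates phi) \- frame_op (lincomb A c (translates phi)))
     <= eps * nrm (lincomb A c (translates phi))) ->
  {ae mu R, forall x, periodization a x <> 0%E -> modulus (symbol x - 1) <= eps}.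
Proof.
move=> eps0 h.
have iw : integrableR (fun x => (approx_weight eps x)%:E).
  have [+ _] := approx_weight_trig eps [fset 0]%fset (fun=> 1).
  congr (integrable _ _ _); apply/funext => x; congr EFin.
  by rewrite /lincomb big_seq_fset1 mul1r modulus_char expr1n mul1r.
have : {ae mu R, forall x, 0 <= approx_weight eps x}.
  apply: weight_ge0 => //.
    by move=> x Ux; rewrite /approx_weight indicE memNset// mul0r.
  move=> P; have [A [c E]] := poly_chi P; under eq_Rintegral do rewrite E.
  rewrite (approx_weight_trig eps A c).2 subr_ge0 -exprMn.
  by rewrite ler_pXn2r ?nnegrE ?mulr_ge0 ?nrm_ge0.
move=> w0; apply: ae_periodic.
  by move=> x k; rewrite periodization_periodic symbol_periodic.
apply: aeS2 w0 (periodization_fin la) => x; rewrite /approx_weight => hx Pfin Ux Px.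
have P0 : 0 < fine (periodization a x).
  rewrite fine_gt0// Pfin andbT lt0e periodization_ge0 andbT; exact/eqP.
move: hx; rewrite indicE mem_set//= mul1r pmulr_lge0// subr_ge0 => hx.
by rewrite -modulusN opprB; exact: sqr_le_le.
Qed.

Lemma approx_of_symbol_near1 (eps : R) : 0 <= eps ->
  {ae mu R, forall x, periodization a x <> 0%E -> modulus (symbol x - 1) <= eps} ->
  forall f, closed_span (translates phi) f -> nrm (f \- frame_op f) <= eps * nrm f.
Proof.
move=> eps0 h.
have w0 : {ae mu R, forall x, 0 <= approx_weight eps x}.
  apply: aeS h => x hx; apply: mulr_ge0; first exact: indicU_ge0.
  have [P0|P0] := pselect (periodization a x = 0%E); first by rewrite P0 mulr0.
  apply: mulr_ge0; last by rewrite fine_ge0// periodization_ge0.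
  rewrite subr_ge0 ler_pXn2r ?nnegrE ?modulus_ge0// -modulusN opprB.
  exact: hx.
have hl (A : {fset int}) c : nrm (lincomb A c (translates phi) \-
      frame_op (lincomb A c (translates phi))) <= eps * nrm (lincomb A c (translates phi)).
  have [i E] := approx_weight_trig eps A c.
  apply: sqr_le_le; first by rewrite mulr_ge0 ?nrm_ge0.
  rewrite exprMn -subr_ge0 -E; apply: Rintegral_ge0_ae; first exact: integrableR_EFin.
  by apply: aeS w0 => x hx; rewrite mulr_ge0 ?sqr_ge0.
move=> f /(closed_spanP _ lphik)[lf hf].
rewrite -subr_le0; apply: le0_all_eps => e e0; rewrite lerBlDr.
set K := Num.sqrt (beta * bt).
(* An error [d] in approximating [f] by [f'] enters three times: [d] itself, [eps * d] through the
   norm of [f'], and [K * d] through the Lipschitz bound. *)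
have K0 : 0 < 1 + eps + K by have := sqrtr_ge0 (beta * bt); rewrite -/K; lra.
have de : 0 < e / (1 + eps + K) by rewrite divr_gt0.
have [A [c]] := hf _ de; set f' := lincomb A c _ => hf'.
have lf' : L2 f' by exact: L2_lincomb.
have [lS _] := frame_opP lf; have [lS' _] := frame_opP lf'.
have h1 := nrm_triangle lf lf' lS.
have h2 := nrm_triangle lf' lS' lS.
have h3 : nrm (f' \- frame_op f') <= eps * nrm f' := hl A c.
have h4 : nrm (frame_op f' \- frame_op f) <= K * nrm (f \- f').
  by rewrite (nrmBC f f'); exact: frame_op_lipschitz.
have h5 : nrm f' <= nrm f + nrm (f \- f') by rewrite (nrmBC f f'); exact: nrm_le_sub.
have h6 : nrm (f \- f') * (1 + eps + K) <= e by rewrite -ler_pdivlMr//; exact: ltW.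
apply: le_trans h1 _; apply: (@le_trans _ _ (nrm (f \- f') * (1 + eps + K) + eps * nrm f)).
  rewrite mulrDr mulrDr mulr1 -!addrA lerD2l; apply: le_trans h2 _.
  rewrite [leRHS](_ : _ = eps * (nrm f + nrm (f \- f')) + K * nrm (f \- f')); last by ring.
  by apply: lerD h4; apply: le_trans h3 _; rewrite ler_wpM2l.
by rewrite lerD2r.
Qed.

Let W := closed_span (translates phi).
Let cW : closed_subspace W. Proof. exact: closed_span_subspace. Qed.
Let WL f : W f -> L2 f. Proof. by case. Qed.
Let proj_phit := orth_proj W phit.
Let Wproj : W proj_phit. Proof. exact: (orth_projP cW lphit).1. Qed.

Lemma analysis_proj f k : W f ->
  inner f (translates proj_phit k) = inner f (translates phit k).
Proof.
move=> Wf; have lf := WL Wf; have lP := WL Wproj.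
have l1 := L2_translates k lphit; have l2 := L2_translates k lP.
apply/eqP; rewrite eq_sym -subr_eq0 -innerBr//.
have Ef : f = translates (translates f (- k)) k.
  by apply/funext => x; rewrite /translates /translate rmorphN /= opprK subrK.
rewrite {1}Ef -[_ \- _]/(translates (phit \- proj_phit) k).
have lfk : L2 (translates f (- k)) by exact: L2_translates.
have lq := L2B lphit lP.
rewrite (inner_shift (- k%:~R) lfk lq) innerC//.
have -> : inner (phit \- proj_phit) (translates f (- k)) = 0.
  by apply: (orth_projP cW lphit).2; exact: closed_span_translates.
by rewrite conjc0.
Qed.

(** The translates of the projected generator lie in [W] and see only the component of [f] in [W].
    This reduces the operator norm over L2 to the estimate on [W]. *)
Lemma analysis_orth_proj f : L2 f ->
  analysis (translates proj_phit) f = analysis (translates phit) (orth_proj W f).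
Proof.
move=> lf; apply/funext => k; have [WP hP] := orth_projP cW lf.
have Wk : W (translates proj_phit k) by exact: closed_span_translates.
rewrite /analysis -analysis_proj//; apply/eqP; rewrite -subr_eq0 -innerBl//; try exact: WL.
by rewrite hP.
Qed.

Variable eps : R.
Hypotheses (eps0 : 0 <= eps) (eps1 : eps < 1).
Hypothesis approx : forall f, W f -> nrm (f \- frame_op f) <= eps * nrm f.

(** [X] and [Y] stay free: one is taken to be a Bessel bound times [||f||^2], the other the sum to
    be bounded below, and exchanging these roles serves both systems. *)
Lemma analysis_mul_lower f (X Y : R) : W f ->
  (forall A : {fset int}, \sum_(k <- A) modulus (inner f (translates phi k)) ^+ 2 <= X) ->
  (forall A : {fset int}, \sum_(k <- A) modulus (inner f (translates phit k)) ^+ 2 <= Y) ->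
  ((1 - eps) * nrm f ^+ 2) ^+ 2 <= Y * X.
Proof.
move=> Wf hX hY; have lf := WL Wf; have [lS hS] := frame_opP lf.
have X0 : 0 <= X by have := hX fset0; rewrite big_nil.
have Y0 : 0 <= Y by have := hY fset0; rewrite big_nil.
have n0 := nrm_ge0 f.
have h1 : (1 - eps) * nrm f ^+ 2 <= modulus (inner (frame_op f) f).
  have : nrm f ^+ 2 <= modulus (inner (f \- frame_op f) f) + modulus (inner (frame_op f) f).
    apply: le_trans (modulusD _ _); rewrite innerBl// subrK inner_self//.
    by rewrite modulus_real ger0_norm ?sqr_ge0.
  have := cauchy_schwarz (L2B lf lS) lf.
  have := ler_wpM2r n0 (approx Wf).
  by rewrite mulrBl mul1r expr2 mulrA lerBlDl; lra.
have h2 : modulus (inner (frame_op f) f) <= Num.sqrt (Y * X).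
  rewrite -subr_le0; apply: le0_all_eps => e e0; rewrite lerBlDr.
  have [A hA] := net_limit_inner lphik lS lf hS e0.
  have {}hA := hA A (fsubset_refl _).
  set z := \sum_(k <- A) _ in hA.
  have -> : inner (frame_op f) f = (inner (frame_op f) f - z) + z by ring.
  apply: le_trans (modulusD _ _) (lerD hA _).
  apply: sqr_le_le; first exact: sqrtr_ge0.
  rewrite sqr_sqrtr ?mulr_ge0//; apply: le_trans (cauchy_schwarz_csum _ _ _) _.
  apply: ler_pM; try by apply: sumr_ge0 => k _; exact: sqr_ge0.
    exact: hY.
  have := hX A; congr (_ <= _); apply: eq_bigr => k _.
  by rewrite (innerC lf (lphik k)) modulus_conjc.
have h3 : 0 <= (1 - eps) * nrm f ^+ 2 by rewrite mulr_ge0 ?sqr_ge0// subr_ge0 ltW.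
rewrite -[leRHS]sqr_sqrtr ?mulr_ge0// ler_pXn2r ?nnegrE ?sqrtr_ge0//.
exact: le_trans h1 h2.
Qed.

Lemma lower_frame_bound (F : int -> R -> R[i]) (m : R) : 0 <= m -> bessel W F ->
  (forall f (X : R), W f ->
    (forall A : {fset int}, \sum_(k <- A) modulus (inner f (F k)) ^+ 2 <= X) ->
    ((1 - eps) * nrm f ^+ 2) ^+ 2 <= m * nrm f ^+ 2 * X) ->
  frame W F.
Proof.
move=> m0 bF h; split => //; have [_ [bw hb]] := bF.
have e1 : 0 < 1 - eps by rewrite subr_gt0.
(* Cancelling [||f||^2] would give [(1 - eps)^2 / m]; the [+ 1] covers [m = 0]. *)
exists ((1 - eps) ^+ 2 / (m + 1)); first by rewrite divr_gt0 ?exprn_gt0// ltr_wpDl.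
move=> f Wf; have := hb f Wf; rewrite L2normE; last exact: WL.
set E := (\esum_(k in _) _)%E => hE.
have E0 : (0 <= E)%E by apply: esum_ge0 => k _; rewrite lee_fin sqr_ge0.
have EX : E = (fine E)%:E.
  rewrite fineK// ge0_fin_numE//; apply: le_lt_trans hE _.
  by rewrite -EFin_expe -EFinM ltry.
rewrite EX -EFin_expe -EFinM lee_fin.
have hX : forall A : {fset int}, \sum_(k <- A) modulus (inner f (F k)) ^+ 2 <= fine E.
  by apply/esum_le_sumP; [move=> k; exact: sqr_ge0|rewrite -EX].
have X0 : 0 <= fine E by exact: fine_ge0.
have := h f _ Wf hX; rewrite exprMn => hh.
rewrite mulrAC ler_pdivrMr ?ltr_wpDl//.
have [n0|n0] := eqVneq (nrm f ^+ 2) 0; first by rewrite n0 mulr0 mulr_ge0// addr_ge0.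
have np : 0 < nrm f ^+ 2 by rewrite lt0r n0 sqr_ge0.
apply: (@le_trans _ _ (fine E * m)); last by rewrite ler_wpM2l// lerDl.
rewrite -(ler_pM2r np); move: hh; congr (_ <= _); ring.
Qed.

Lemma approx_dual_frames_proj :
  approx_dual_frames eps W (translates phi) (translates (orth_proj W phit)).
Proof.
have bF : bessel W (translates phi).
  by apply: (bessel_of_riesz beta0 rb) => // k; exact: closed_span_gen.
(* On [W] the coefficients are those of the unprojected generator, whose Bessel bound holds on all
   of L2. *)
have bG : bessel W (translates proj_phit).
  split; first by move=> k; exact: closed_span_translates.
  have [_ [bw hb]] := bessel_of_riesz bt0 riesz_bound_phit (fun f => id)
    (fun k => L2_translates k lphit).
  exists bw => f Wf; under eq_esum => k _ do rewrite analysis_proj//.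
  exact: hb (WL Wf).
split.
- apply: (lower_frame_bound bt0 bF) => f X Wf hX.
  exact: (analysis_mul_lower Wf hX (analysis_phit_le (WL Wf))).
- apply: (lower_frame_bound beta0 bG) => f Y Wf hY.
  rewrite [leRHS]mulrC; apply: (analysis_mul_lower Wf ((riesz_boundP beta0 lphik).1 rb f (WL Wf))) => A.
  by have := hY A; congr (_ <= _); apply: eq_bigr => k _; rewrite analysis_proj.
- apply: ge_ereal_sup => _ [f [lf f1] <-].
  rewrite analysis_orth_proj// -/(frame_op (orth_proj W f)).
  have [WP _] := orth_projP cW lf; have lP := WL WP; have [lS _] := frame_opP lP.
  rewrite L2normE; last exact: L2B.
  move: f1; rewrite L2normE// !lee_fin => f1.
  apply: le_trans (approx WP) _; rewrite -[leRHS]mulr1 ler_wpM2l//.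
  exact: le_trans (orth_proj_nrm cW lf) f1.
Qed.

End Equivalence.

Theorem theorem7p4 (R : realType) (phi phi1 phit phi1t H : R -> R[i]) (eps : R)
    (Lphi : L2 phi) (Lphi1 : L2 phi1)
    (Bphi : bessel (@L2 R) (translates phi)) (Bphi1 : bessel (@L2 R) (translates phi1))
    (Wphi1t : closed_span (translates phi) phi1t)
    (Vphit : closed_span (translates phi1) phit)
    (perH : Cper +oo%E H)
    (Fphi1t : {ae mu R, forall xi,
       fourier phi1t xi = conjc (H xi) * fourier phi xi})
    (Fphit : {ae mu R, forall xi, fourier phit xi = H xi * fourier phi1 xi})
    (eps0 : 0 <= eps) :
  let W := closed_span (translates phi) in
  let V := closed_span (translates phi1) in
  let NPhi := zeroset (periodization (fourier phi)) in
  let NPhi1 := zeroset (periodization (fourier phi1)) in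
  let cond_i := forall f, W f ->
    (L2norm (f \- synthesis (translates phi) (analysis (translates phit) f))
       <= eps%:E * L2norm f)%E in
  let cond_ii := {ae mu R, forall xi, (~` NPhi) xi ->
    modulus (conjc (H xi) * bracket (fourier phi) (fourier phi1) xi - 1)
      <= eps} in
  [/\ bessel (@L2 R) (translates phit),
      bessel (@L2 R) (translates phi1t),
      (cond_i <-> cond_ii) &
      (cond_ii -> eps < 1 -> {ae mu R, forall xi, NPhi1 xi <-> NPhi xi} ->
        approx_dual_frames eps W (translates phi) (translates (orth_proj W phit)) /\
        approx_dual_frames eps V (translates phi1) (translates (orth_proj V phi1t)))].
Proof.
move=> W V NPhi NPhi1 cond_i cond_ii.
have [beta beta0 rb] := riesz_of_bessel Bphi.
have [beta1 beta10 rb1] := riesz_of_bessel Bphi1.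
have [mH pH [C C0 bH]] := Cper_ae_bounded perH.
have lphit : L2 phit by case: Vphit.
have lphi1t : L2 phi1t by case: Wphi1t.
have la := L2_fourier Lphi; have lb := L2_fourier Lphi1.
have mH' : cmeasurable (fun x => conjc (H x)) by exact: cmeasurable_conjc.
have pH' : periodic (fun x => conjc (H x)) by move=> x k; rewrite pH.
have bH' : ae_bounded (fun x => conjc (H x)) C by apply: aeS bH => x; rewrite modulus_conjc.
have rbt := riesz_bound_phit Lphi1 lphit rb1 mH C0 bH Fphit.
have rb1t := riesz_bound_phit Lphi lphi1t rb mH' C0 bH' Fphi1t.
have lphik k : L2 (translates phi k) by exact: L2_translates.
have frame_opL f : L2 f -> L2 (frame_op phi phit f).
  by move=> lf; exact: (frame_opP Lphi1 lphit beta0 rb beta10 rb1 mH C0 bH Fphit lf).1.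
have Ei f : L2 f -> (L2norm (f \- synthesis (translates phi) (analysis (translates phit) f))
    <= eps%:E * L2norm f)%E <-> nrm (f \- frame_op phi phit f) <= eps * nrm f.
  move=> lf; rewrite -/(frame_op phi phit f).
  by rewrite (L2normE (L2B lf (frame_opL f lf))) (L2normE lf) -EFinM lee_fin.
pose near1 := {ae mu R, forall x, periodization (fourier phi) x <> 0%E ->
  modulus (symbol phi phi1 H x - 1) <= eps}.
(* The bracket of the statement and its periodic representative inside [symbol] agree almost
   everywhere. *)
have Eii : cond_ii <-> near1.
  split; apply: aeS2 (bracket_pbracket la lb) => x E.
    by rewrite /symbol E; exact.
  by rewrite E; exact.
have near1_approx : near1 -> forall f, W f -> nrm (f \- frame_op phi phit f) <= eps * nrm f.
  exact: (approx_of_symbol_near1 Lphi Lphi1 lphit beta0 rb beta10 rb1 mH pH C0 bH Fphit eps0).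
split.
- apply: (bessel_of_riesz _ rbt) => //; first by rewrite mulr_ge0 ?sqr_ge0.
  by move=> k; exact: L2_translates.
- apply: (bessel_of_riesz _ rb1t) => //; first by rewrite mulr_ge0 ?sqr_ge0.
  by move=> k; exact: L2_translates.
- split=> [hi|/Eii/near1_approx h f Wf]; last by apply/Ei; [case: Wf|exact: h].
  apply/Eii; apply: (symbol_near1_of_approx Lphi Lphi1 lphit beta0 rb beta10 rb1 mH pH C0 bH Fphit eps0).
  move=> A c; apply/Ei; first exact: L2_lincomb.
  by apply: hi; exact: closed_span_lincomb.
- move=> /Eii h eps1 EN; split.
    exact: (approx_dual_frames_proj Lphi Lphi1 lphit beta0 rb beta10 rb1 mH C0 bH Fphit
      eps0 eps1 (near1_approx h)).
  (* The exchanged symbol is the conjugate of the original one, hence equally close to 1; the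
     agreement of the zero sets moves the estimate to where the periodization of [phi1] is
     nonzero. *)
  have h' : {ae mu R, forall x, periodization (fourier phi1) x <> 0%E ->
      modulus (symbol phi1 phi (fun x => conjc (H x)) x - 1) <= eps}.
    apply: aeS2 h EN => x hx [_ Nx] P1x.
    have {}hx : modulus (symbol phi phi1 H x - 1) <= eps by apply: hx => /Nx.
    rewrite -modulus_conjc conjcB /symbol pbracketC -conjcM conjcK conjc1.
    exact: hx.
  exact: (approx_dual_frames_proj Lphi1 Lphi lphi1t beta10 rb1 beta0 rb mH' C0 bH' Fphi1t
    eps0 eps1 (approx_of_symbol_near1 Lphi1 Lphi lphi1t beta10 rb1 beta0 rb mH' pH' C0 bH' Fphi1t eps0 h')).
Qed.
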